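(* Fix positive integers $l$ and $m$. Consider the huge $l\times m\times n$ threeway table problem: given a number $t$ of layer types, vertical line-sums $g\in\mathbb{Z}_+^{l\times m}$, and for each type $k=1,\dots,t$ column-sums $e^k\in\mathbb{Z}_+^m$ and row-sums $f^k\in\mathbb{Z}_+^l$, and positive integers $n_1,\dots,n_t,n$ with $n_1+\cdots+n_t=n$, decide whether there exists a table $x=(x^1,\dots,x^n)$ with each layer $x^i\in\mathbb{Z}_+^{l\times m}$ such that: the first $n_1$ layers are of type $1$, the next $n_2$ layers are of type $2$, and so on, the last $n_t$ layers being of type $t$, where a layer $x^i$ of type $k$ must satisfy $\sum_{a=1}^l x^i_{a,j}=e^k_j$ for all $j=1,\dots,m$ and $\sum_{j=1}^m x^i_{a,j}=f^k_a$ for all $a=1,\dots,l$; and $\sum_{i=1}^n x^i_{a,j}=g_{a,j}$ for all $a,j$. All input data other than $t$ (namely $g$, the $e^k$, $f^k$, and $n_1,\dots,n_t,n$) are encoded in binary. Then: (i) for every fixed $t$, this decision problem is in P; (ii) when $t$ is a variable part of the input encoded in unary, this decision problem is in NP $\cap$ coNP.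
   Context: The number $n$ of layers is encoded in binary (this is what ''huge'' means), so a table cannot in general be written down explicitly; the problem size is the length of the binary encodings of $g,e^k,f^k,n_1,\dots,n_t,n$ plus $t$ (in unary in part (ii)). The dimensions $l,m$ are constants not part of the input. *)

(* Defs.v *)
From mathcomp Require Import all_boot.

Set Implicit Arguments.
Unset Strict Implicit.
Unset Printing Implicit Defensive.

Inductive sym := S0 | S1 | Sep.

Definition bit (b : bool) : sym := if b then S1 else S0.

Inductive move := MoveL | MoveR | Stay.

Record TM : Type := MkTM {
  tm_Q : finType;
  tm_G : finType;
  tm_blank : tm_G;
  tm_inj : sym -> tm_G;
  tm_delta : tm_Q -> tm_G -> tm_Q * tm_G * move;
  tm_q0 : tm_Q;
  tm_acc : tm_Q;
  tm_rej : tm_Q }.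

(* configuration: state, cells left of the head (nearest first),
   scanned cell, cells right of the head (nearest first) *)
Record config (M : TM) := Config {
  cq : tm_Q M; cl : seq (tm_G M); ch : tm_G M; cr : seq (tm_G M) }.

Definition halted (M : TM) (c : config M) : bool :=
  (cq c == tm_acc M) || (cq c == tm_rej M).

Definition step (M : TM) (c : config M) : config M :=
  if halted c then c else
  let: (q', w, mv) := tm_delta (cq c) (ch c) in
  match mv with
  | MoveL => match cl c with
             | [::] => Config q' [::] (tm_blank M) (w :: cr c)
             | x :: l' => Config q' l' x (w :: cr c)
             end
  | MoveR => match cr c with
             | [::] => Config q' (w :: cl c) (tm_blank M) [::]
             | x :: r' => Config q' (w :: cl c) x r'
             end
  | Stay => Config q' (cl c) w (cr c)
  end.

Definition init (M : TM) (w : seq sym) : config M :=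
  match map (tm_inj M) w with
  | [::] => Config (tm_q0 M) [::] (tm_blank M) [::]
  | x :: r => Config (tm_q0 M) [::] x r
  end.

Definition run (M : TM) (k : nat) (w : seq sym) : config M :=
  iter k (@step M) (init M w).

(* a language is a predicate on strings; the time bounds (|w|+2)^c
   range over all polynomials up to domination *)
Definition InP (L : seq sym -> Prop) : Prop :=
  exists (M : TM) (c : nat), forall w : seq sym,
    halted (run M ((size w).+2 ^ c) w) /\
    (cq (run M ((size w).+2 ^ c) w) = tm_acc M <-> L w).

Definition InNP (L : seq sym -> Prop) : Prop :=
  exists (M : TM) (c : nat), forall w : seq sym,
    L w <-> exists y : seq bool, size y <= (size w).+2 ^ c /\
      cq (run M ((size w).+2 ^ c) (w ++ Sep :: map bit y)) = tm_acc M.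

Definition InCoNP (L : seq sym -> Prop) : Prop := InNP (fun w => ~ L w).

Record ltype (l m : nat) := LType {
  lt_e : 'I_m -> nat; lt_f : 'I_l -> nat; lt_n : nat }.

Definition ltype0 (l m : nat) : ltype l m :=
  @LType l m (fun _ => 0) (fun _ => 0) 0.

Record inst (l m : nat) := Inst {
  in_g : 'I_l -> 'I_m -> nat; in_types : seq (ltype l m); in_n : nat }.

Definition layer_ok (l m : nat) (e : 'I_m -> nat) (f : 'I_l -> nat)
  (y : 'I_l -> 'I_m -> nat) : Prop :=
  (forall j : 'I_m, \sum_(a < l) y a j = e j) /\
  (forall a : 'I_l, \sum_(j < m) y a j = f a).

Definition prefix_n (l m : nat) (s : seq (ltype l m)) (k : nat) : nat :=
  \sum_(T <- take k s) lt_n T.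

(* layers are indexed 0..n-1; layer i has type k (0-based) iff
   prefix_n k <= i < prefix_n (k+1) *)
Definition yes_instance (l m : nat) (I : inst l m) : Prop :=
  let s := in_types I in
  let d := ltype0 l m in
  [/\ 0 < size s,
      (forall k, k < size s -> 0 < lt_n (nth d s k)),
      prefix_n s (size s) = in_n I &
      exists x : nat -> 'I_l -> 'I_m -> nat,
        (forall k i, k < size s -> prefix_n s k <= i < prefix_n s k.+1 ->
           layer_ok (lt_e (nth d s k)) (lt_f (nth d s k)) (x i)) /\
        (forall (a : 'I_l) (j : 'I_m), \sum_(i < in_n I) x i a j = in_g I a j)].

Fixpoint bits (fuel n : nat) : seq bool :=
  match fuel with
  | 0 => [::]
  | fuel'.+1 => if n == 0 then [::] else odd n :: bits fuel' n./2
  end.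
Definition bin (n : nat) : seq bool := bits n n.

Definition enc_nat (n : nat) : seq sym := map bit (bin n) ++ [:: Sep].

Definition enc_vec (k : nat) (v : 'I_k -> nat) : seq sym :=
  flatten [seq enc_nat (v j) | j <- enum 'I_k].

Definition enc_mat (l m : nat) (g : 'I_l -> 'I_m -> nat) : seq sym :=
  flatten [seq enc_nat (g a j) | a <- enum 'I_l, j <- enum 'I_m].

Definition enc_type (l m : nat) (T : ltype l m) : seq sym :=
  enc_vec (lt_e T) ++ enc_vec (lt_f T) ++ enc_nat (lt_n T).

Definition encode (l m : nat) (I : inst l m) : seq sym :=
  nseq (size (in_types I)) S1 ++ Sep :: enc_mat (in_g I)
  ++ flatten (map (@enc_type l m) (in_types I)) ++ enc_nat (in_n I).

Definition HugeTable (l m : nat) (w : seq sym) : Prop :=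
  exists I : inst l m, encode I = w /\ yes_instance I.

Definition HugeTable_t (l m t : nat) (w : seq sym) : Prop :=
  exists I : inst l m, size (in_types I) = t /\ encode I = w /\ yes_instance I.

(* Main.v *)
Require Import Defs.
From mathcomp Require Import all_boot zify.
From Stdlib Require Import FunctionalExtensionality Classical.

(** A sum of [n] layers with margins [e], [f] is exactly a table with margins
    [n e], [n f] (transportation polytopes have the integer decomposition
    property), so a huge table exists iff there is a table of [t] such sums, one
    per type, with vertical sums [g].  All constraints are made soft: [violation]
    is the total absolute error over nonnegative integer tables.  By Dickson's
    lemma, applied first inside a layer and then across layers, a table that does
    not minimize it can be improved within an L1-distance depending only on [l]
    and [m]; hence a ball of polynomial size suffices for local search.  Scaling
    makes the descent short: twice an optimum for the halved right-hand sides is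
    within a polynomial of the optimum.  So the problem is in P even for variable
    [t], and all claims follow.

    Polynomial time is transferred to single-tape machines through a class [PT]
    of functions between types encoded by trees, closed under folds whose
    intermediate results stay polynomially bounded. *)

Set Implicit Arguments.
Unset Strict Implicit.
Unset Printing Implicit Defensive.

(** * Stack programs and their flowcharts *)

(** The constraints must be soft because rounding the halved right-hand sides can destroy
    feasibility. The least total error, by contrast, exists at every scale, and its values at
    consecutive scales differ by a factor 2 up to a polynomial term; so optimality passes from scale
    to scale, beginning with the zero table for the zero system. The search radius must not depend
    on the number of types. Dickson's lemma inside a layer leaves finitely many elementary changes,
    the same for all layers; across layers it is enough to count how often each is used, so the
    second application again has a fixed number of coordinates. A small part of [y - x], for a
    better table [y], is useful by convexity: added to [x] and removed from [y], it does not
    increase the sum of the two errors, so either [x] improves or [y] is replaced by a table nearer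
    to [x]. Excluded middle suffices for the radius, which is a constant built into the machine and
    never computed by it. Folds need the bound on intermediate results, because iterating a
    polynomial-time function can square a number at each turn. *)

Definition store := nat -> seq bool.

Definition upd (st : store) (i : nat) (v : seq bool) : store :=
  fun j => if j == i then v else st j.

Inductive cmd :=
| Skip
| Push (i : nat) (b : bool)
| Seq (c1 c2 : cmd)
| Loop (i : nat) (c0 c1 : cmd)
| Case (i : nat) (cn c0 c1 : cmd).

(* [Loop i c0 c1] pops register [i] until it is empty, running [c0] or [c1]
   according to the popped bit; [Case] pops once. *)
Inductive exec : cmd -> store -> nat -> store -> Prop :=
| ExecSkip st : exec Skip st 1 st
| ExecPush i b st : exec (Push i b) st 1 (upd st i (b :: st i))
| ExecSeq c1 c2 st n1 st1 n2 st2 :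
    exec c1 st n1 st1 -> exec c2 st1 n2 st2 -> exec (Seq c1 c2) st (n1 + n2) st2
| ExecLoop0 i c0 c1 st : st i = [::] -> exec (Loop i c0 c1) st 1 st
| ExecLoopS i c0 c1 st b r n1 st1 n2 st2 :
    st i = b :: r -> exec (if b then c1 else c0) (upd st i r) n1 st1 ->
    exec (Loop i c0 c1) st1 n2 st2 -> exec (Loop i c0 c1) st (n1 + n2).+1 st2
| ExecCase0 i cn c0 c1 st n st' :
    st i = [::] -> exec cn st n st' -> exec (Case i cn c0 c1) st n.+1 st'
| ExecCaseS i cn c0 c1 st b r n st' :
    st i = b :: r -> exec (if b then c1 else c0) (upd st i r) n st' ->
    exec (Case i cn c0 c1) st n.+1 st'.

Inductive instr (X : Type) :=
| IGoto (x : X)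
| IPush (i : nat) (b : bool) (x : X)
| IPop (i : nat) (x : option bool -> X).

Definition map_instr X Y (g : X -> Y) (I : instr X) : instr Y :=
  match I with
  | IGoto x => IGoto (g x)
  | IPush i b x => IPush i b (g x)
  | IPop i x => IPop i (fun o => g (x o))
  end.

Definition instr_step X (I : instr X) (st : store) : X * store :=
  match I with
  | IGoto x => (x, st)
  | IPush i b x => (x, upd st i (b :: st i))
  | IPop i x => if st i is b :: r then (x (Some b), upd st i r) else (x None, st)
  end.

Definition instr_reg X (I : instr X) : nat :=
  match I with IGoto _ => 0 | IPush i _ _ => i | IPop i _ => i end.

(** Control points form a finite type, so that they can serve as states of a machine; in [code], the
    target [None] is the exit. *)
Fixpoint loc (c : cmd) : finType :=
  match c with
  | Skip | Push _ _ => unit : finType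
  | Seq a b => (loc a + loc b)%type : finType
  | Loop _ a b => (unit + (loc a + loc b))%type : finType
  | Case _ n a b => (unit + (loc n + (loc a + loc b)))%type : finType
  end.

Fixpoint entry (c : cmd) : loc c :=
  match c return loc c with
  | Skip | Push _ _ => tt
  | Seq a b => inl (entry a)
  | Loop _ _ _ | Case _ _ _ _ => inl tt
  end.

Fixpoint code (c : cmd) : loc c -> instr (option (loc c)) :=
  match c return loc c -> instr (option (loc c)) with
  | Skip => fun _ => IGoto None
  | Push i b => fun _ => IPush i b None
  | Seq a b => fun x =>
      match x with
      | inl y => map_instr (fun o => Some (if o is Some z then inl z else inr (entry b)))
                           (code y)
      | inr y => map_instr (omap inr) (code y)
      end
  | Loop i a b => fun x =>
      match x with
      | inl _ => IPop i (fun o => match o with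
          | None => None
          | Some false => Some (inr (inl (entry a)))
          | Some true => Some (inr (inr (entry b))) end)
      | inr (inl y) =>
          map_instr (fun o => Some (if o is Some z then inr (inl z) else inl tt)) (code y)
      | inr (inr y) =>
          map_instr (fun o => Some (if o is Some z then inr (inr z) else inl tt)) (code y)
      end
  | Case i n a b => fun x =>
      match x with
      | inl _ => IPop i (fun o => match o with
          | None => Some (inr (inl (entry n)))
          | Some false => Some (inr (inr (inl (entry a))))
          | Some true => Some (inr (inr (inr (entry b)))) end)
      | inr (inl y) => map_instr (omap (fun z => inr (inl z))) (code y)
      | inr (inr (inl y)) => map_instr (omap (fun z => inr (inr (inl z)))) (code y)
      | inr (inr (inr y)) => map_instr (omap (fun z => inr (inr (inr z)))) (code y)
      end
  end.

Fixpoint regs (c : cmd) : nat :=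
  match c with
  | Skip => 1
  | Push i _ => i.+1
  | Seq a b => maxn (regs a) (regs b)
  | Loop i a b => maxn i.+1 (maxn (regs a) (regs b))
  | Case i n a b => maxn i.+1 (maxn (regs n) (maxn (regs a) (regs b)))
  end.

Lemma instr_reg_map X Y (g : X -> Y) (I : instr X) :
  instr_reg (map_instr g I) = instr_reg I.
Proof. by case: I. Qed.

Lemma code_reg c (q : loc c) : instr_reg (code q) < regs c.
Proof.
elim: c q => [|i b|a IHa b IHb|i a IHa b IHb|i n IHn a IHa b IHb] //=.
- by case=> q; rewrite instr_reg_map leq_max ?IHa ?IHb ?orbT.
- by case=> [_|[q|q]] /=; rewrite ?instr_reg_map !leq_max ?leqnn ?IHa ?IHb ?orbT.
- by case=> [_|[q|[q|q]]] /=;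
    rewrite ?instr_reg_map !leq_max ?leqnn ?IHa ?IHb ?IHn ?orbT.
Qed.

Inductive reach X (cd : X -> instr (option X)) :
  option X -> store -> nat -> option X -> store -> Prop :=
| Reach0 q st : reach cd q st 0 q st
| ReachS q st q1 st1 n q2 st2 :
    instr_step (cd q) st = (q1, st1) -> reach cd q1 st1 n q2 st2 ->
    reach cd (Some q) st n.+1 q2 st2.

Lemma reach_trans X (cd : X -> instr (option X)) q st n1 q1 st1 n2 q2 st2 :
  reach cd q st n1 q1 st1 -> reach cd q1 st1 n2 q2 st2 -> reach cd q st (n1 + n2) q2 st2.
Proof. by elim=> [//|{}q {}st q' st' n q'' st'' E _ IH /IH]; apply: ReachS. Qed.

Lemma instr_step_map X Y (g : X -> Y) (I : instr X) st :
  instr_step (map_instr g I) st = (g (instr_step I st).1, (instr_step I st).2).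
Proof. by case: I => //= i x; case: (st i). Qed.

(** Composing programs only redirects exits: [emb] places a subprogram in the larger flowchart, and
    [g] says where its exit now leads. *)
Lemma reach_lift X Y (cd : X -> instr (option X)) (cd' : Y -> instr (option Y))
    (emb : X -> Y) (g : option X -> option Y) q st n r st' :
  (forall x, cd' (emb x) = map_instr g (cd x)) -> (forall x, g (Some x) = Some (emb x)) ->
  reach cd q st n r st' -> q <> None -> reach cd' (g q) st n (g r) st'.
Proof.
move=> Hc Hg; elim=> [q0 s0 _|q0 s0 q1 s1 n0 q2 s2 E R IH _]; first exact: Reach0.
rewrite Hg; apply: ReachS.
  by rewrite Hc instr_step_map E.
case: q1 {E} R IH => [q1|] R IH; first exact: IH.
by inversion R; subst; exact: Reach0.
Qed.

Lemma exec_reach c st n st' :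
  exec c st n st' -> reach (@code c) (Some (entry c)) st n None st'.
Proof.
elim=> {c st n st'}
  [st|i b st|c1 c2 st n1 st1 n2 st2 _ R1 _ R2|i c0 c1 st E
  |i c0 c1 st b r n1 st1 n2 st2 E _ R1 _ R2
  |i cn c0 c1 st n st' E _ R|i cn c0 c1 st b r n st' E _ R].
- by apply: ReachS (Reach0 _ _ _).
- by apply: ReachS (Reach0 _ _ _).
- apply: reach_trans.
    exact: (reach_lift (cd' := @code (Seq c1 c2)) (emb := inl)
      (g := fun o => Some (if o is Some z then inl z else inr (entry c2))) _ _ R1).
  exact: (reach_lift (cd' := @code (Seq c1 c2)) (emb := inr) (g := omap inr) _ _ R2).
- by apply: ReachS (Reach0 _ _ _); rewrite /= E.
- apply: ReachS; first by rewrite /= E.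
  apply: reach_trans R2; case: b E R1 => E R1.
  + exact: (reach_lift (cd' := @code (Loop i c0 c1)) (emb := fun z => inr (inr z))
        (g := fun o => Some (if o is Some z then inr (inr z) else inl tt)) _ _ R1).
  + exact: (reach_lift (cd' := @code (Loop i c0 c1)) (emb := fun z => inr (inl z))
        (g := fun o => Some (if o is Some z then inr (inl z) else inl tt)) _ _ R1).
- apply: ReachS; first by rewrite /= E.
  exact: (reach_lift (cd' := @code (Case i cn c0 c1)) (emb := fun z => inr (inl z))
     (g := omap (fun z => inr (inl z))) _ _ R).
- apply: ReachS; first by rewrite /= E.
  case: b E R => E R.
  + exact: (reach_lift (cd' := @code (Case i cn c0 c1))
       (emb := fun z => inr (inr (inr z))) (g := omap (fun z => inr (inr (inr z)))) _ _ R).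
  + exact: (reach_lift (cd' := @code (Case i cn c0 c1))
       (emb := fun z => inr (inr (inl z))) (g := omap (fun z => inr (inr (inl z)))) _ _ R).
Qed.

(** * Simulation by a single-tape machine *)

Definition at_pos (M : TM) (c : config M) (q : tm_Q M) (tp : nat -> tm_G M) (p : nat) :=
  [/\ cq c = q, cl c = [seq tp j | j <- rev (iota 0 p)], ch c = tp p &
      forall j, nth (tm_blank M) (cr c) j = tp (p + j.+1)].

Definition set_cell T (tp : nat -> T) (p : nat) (w : T) : nat -> T :=
  fun j => if j == p then w else tp j.

Section Moves.
Variables (M : TM) (c : config M) (q : tm_Q M) (tp : nat -> tm_G M) (p : nat).
Hypothesis Hc : at_pos c q tp p.
Hypothesis Hq : (q == tm_acc M) || (q == tm_rej M) = false.

Let map_set w s : p \notin s -> [seq set_cell tp p w j | j <- s] = [seq tp j | j <- s].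
Proof.
move=> ps; apply/eq_in_map => j js; rewrite /set_cell.
by case: eqP => // E; rewrite -E js in ps.
Qed.

Lemma step_stay q' w : tm_delta q (tp p) = (q', w, Stay) ->
  at_pos (step c) q' (set_cell tp p w) p.
Proof.
case: Hc => E1 E2 E3 E4 D; rewrite /step /halted E1 Hq E3 D; split => //=.
- by rewrite E2 map_set // mem_rev mem_iota ltnn andbF.
- by rewrite /set_cell eqxx.
- by move=> j; rewrite E4 /set_cell -[X in _ == X]addn0 eqn_add2l.
Qed.

Lemma step_right q' w : tm_delta q (tp p) = (q', w, MoveR) ->
  at_pos (step c) q' (set_cell tp p w) p.+1.
Proof.
case: Hc => E1 E2 E3 E4 D; rewrite /step /halted E1 Hq E3 D.
have L : w :: cl c = [seq set_cell tp p w j | j <- rev (iota 0 p.+1)].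
  rewrite -addn1 iotaD rev_cat map_cat /= add0n E2 map_set; last first.
    by rewrite mem_rev mem_iota ltnn andbF.
  by rewrite /set_cell eqxx.
have N j : set_cell tp p w (p + j.+1) = tp (p + j.+1).
  by rewrite /set_cell -[X in _ == X]addn0 eqn_add2l.
case Er: (cr c) E4 => [|x r'] E4; split => //=.
- by rewrite -[p.+1]addn1 N -E4.
- by move=> j; rewrite addSnnS N -E4 !nth_nil.
- by rewrite -[p.+1]addn1 N -E4.
- by move=> j; rewrite addSnnS N -E4.
Qed.

Lemma step_left q' w : 0 < p -> tm_delta q (tp p) = (q', w, MoveL) ->
  at_pos (step c) q' (set_cell tp p w) p.-1.
Proof.
case: Hc => E1 E2 E3 E4 p0 D; rewrite /step /halted E1 Hq E3 D.
have := E2; case: p p0 E4 => // p' _ E4.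
rewrite -addn1 iotaD rev_cat map_cat /= add0n => E2'.
have N j : j != p'.+1 -> set_cell tp p'.+1 w j = tp j by rewrite /set_cell => /negbTE->.
rewrite addn1 E2'; split => //=.
- apply/eq_in_map => j; rewrite mem_rev mem_iota => /andP [_ jp].
  by rewrite N // neq_ltn; lia.
- by rewrite N // neq_ltn; lia.
- case=> [|j] /=; first by rewrite addn1 /set_cell eqxx.
  rewrite E4 N; first by rewrite !addnS addSn.
  by lia.
Qed.

End Moves.

Section Simulation.
Variable c : cmd.
Let k := (regs c).+1.

(** The Boolean flags cell 0, the left end for the return scan. Each track holds one stack with its
    bottom in cell 0, so that a push or a pop alters a single cell, at the top. *)
Definition cell : finType := (bool * {ffun 'I_k.+1 -> option bool})%type.
Definition trk (x : cell) (i : nat) : option bool := x.2 (inord i).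
Definition set_trk (x : cell) (i : nat) (v : option bool) : cell :=
  (x.1, [ffun j => if j == inord i then v else x.2 j]).

Definition sim_Q : finType := ((option (loc c) * option bool) + option bool)%type.

(* Phase [None] scans right for the top of a stack, [Some false] erases it,
   [Some true] returns to the flagged cell 0. *)
Definition sim_delta (q : sim_Q) (x : cell) : sim_Q * cell * move :=
  match q with
  | inr _ => (inl (Some (entry c), None), (true, x.2), Stay)
  | inl (o, Some true) =>
      if x.1 then (inl (o, None), x, Stay) else (q, x, MoveL)
  | inl (None, _) => (inr (Some (trk x 1 : bool)), x, Stay)
  | inl (Some q', ph) =>
      match code q', ph with
      | IGoto o, _ => (inl (o, None), x, Stay)
      | IPush i b o, _ =>
          if trk x i is Some _ then (q, x, MoveR)
          else (inl (o, Some true), set_trk x i (Some b), Stay)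
      | IPop i f, None =>
          if trk x i is Some _ then (q, x, MoveR)
          else if x.1 then (inl (f None, None), x, Stay)
          else (inl (Some q', Some false), x, MoveL)
      | IPop i f, _ => (inl (f (trk x i), Some true), set_trk x i None, Stay)
      end
  end.

(* The input symbols are pairs of bits, so that the input is loaded in the
   first two stacks, bottom first. *)
Definition sim_inj (s : sym) : cell :=
  (false, [ffun i : 'I_k.+1 => if val i == 0 then Some (if s is S1 then true else false)
     else if val i == 1 then Some (if s is Sep then true else false) else None]).

Definition simTM : TM :=
  @MkTM sim_Q cell (false, [ffun => None]) sim_inj sim_delta
    (inr None) (inr (Some true)) (inr (Some false)).

Definition stack_bit (s : seq bool) (j : nat) : option bool := nth None (map Some s) j.

Definition tape_of (st : store) (j : nat) : cell :=
  (j == 0, [ffun i : 'I_k.+1 => stack_bit (rev (st i)) j]).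

Lemma trk_tape st i j : i <= k -> trk (tape_of st j) i = stack_bit (rev (st i)) j.
Proof. by move=> ik; rewrite /trk ffunE inordK. Qed.

Lemma stack_bit_lt s j : j < size s -> stack_bit s j.
Proof. by move=> js; rewrite /stack_bit (nth_map false). Qed.

Lemma stack_bit_ge s j : size s <= j -> stack_bit s j = None.
Proof. by move=> js; rewrite /stack_bit nth_default // size_map. Qed.

Lemma ord_eq_inord (i0 : 'I_k.+1) i : i <= k -> (i0 == inord i) = (nat_of_ord i0 == i).
Proof. by move=> ik; rewrite -val_eqE /= inordK. Qed.

Lemma tape_push st i b : i <= k ->
  set_cell (tape_of st) (size (st i)) (set_trk (tape_of st (size (st i))) i (Some b)) =
  tape_of (upd st i (b :: st i)).
Proof.
move=> ik; apply: functional_extensionality => j; rewrite /set_cell.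
case: eqP => [->|/eqP nj]; rewrite /tape_of /set_trk /=; congr pair;
  apply/ffunP => i0; rewrite !ffunE /upd ?ord_eq_inord //=.
  case: eqP => [_|//]; rewrite rev_cons /stack_bit map_rcons nth_rcons.
  by rewrite size_map size_rev ltnn eqxx.
case: eqP => [->|//]; rewrite rev_cons /stack_bit map_rcons nth_rcons.
rewrite size_map size_rev (negbTE nj).
by case: ltnP => // ?; rewrite nth_default ?size_map ?size_rev.
Qed.

Lemma tape_pop st i b r : i <= k -> st i = b :: r ->
  set_cell (tape_of st) (size r) (set_trk (tape_of st (size r)) i None) =
  tape_of (upd st i r).
Proof.
move=> ik E; apply: functional_extensionality => j; rewrite /set_cell.
case: eqP => [->|/eqP nj]; rewrite /tape_of /set_trk /=; congr pair;
  apply/ffunP => i0; rewrite !ffunE /upd ?ord_eq_inord //=.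
  by case: eqP => [_|//]; rewrite stack_bit_ge ?size_rev.
case: eqP => [->|//]; rewrite E rev_cons /stack_bit map_rcons nth_rcons.
rewrite size_map size_rev (negbTE nj).
by case: ltnP => // ?; rewrite nth_default ?size_map ?size_rev.
Qed.

Lemma set_cell_id T (tp : nat -> T) p : set_cell tp p (tp p) = tp.
Proof. by apply: functional_extensionality => j; rewrite /set_cell; case: eqP => [->|]. Qed.

Lemma sim_nhalt x :
  ((inl x : sim_Q) == tm_acc simTM) || ((inl x : sim_Q) == tm_rej simTM) = false.
Proof. by []. Qed.

Notation simstep := (@step simTM).

Lemma scan_right st i q ph (d : config simTM) p n :
  (forall x, trk x i -> sim_delta (inl (q, ph)) x = (inl (q, ph), x, MoveR)) ->
  i <= k -> p + n <= size (st i) ->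
  at_pos d (inl (q, ph)) (tape_of st) p ->
  at_pos (iter n simstep d) (inl (q, ph)) (tape_of st) (p + n).
Proof.
move=> Hd ik; elim: n => [|n IH] pn Hp; first by rewrite addn0.
have pn' : p + n <= size (st i) by lia.
have D : sim_delta (inl (q, ph)) (tape_of st (p + n)) =
    (inl (q, ph), tape_of st (p + n), MoveR).
  by apply: Hd; rewrite trk_tape // stack_bit_lt // size_rev; lia.
have := @step_right simTM _ _ _ _ (IH pn' Hp) (sim_nhalt _) _ _ D.
by rewrite set_cell_id addnS.
Qed.

Lemma scan_left st o (d : config simTM) p :
  at_pos d (inl (o, Some true)) (tape_of st) p ->
  at_pos (iter p.+1 simstep d) (inl (o, None)) (tape_of st) 0.
Proof.
elim: p d => [|p IH] d Hp.
  have D : sim_delta (inl (o, Some true)) (tape_of st 0) = (inl (o, None), tape_of st 0, Stay).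
    by case: o {Hp}.
  by have := @step_stay simTM _ _ _ _ Hp (sim_nhalt _) _ _ D; rewrite set_cell_id.
have D : sim_delta (inl (o, Some true)) (tape_of st p.+1) =
    (inl (o, Some true), tape_of st p.+1, MoveL) by case: o {Hp IH}.
rewrite iterSr; apply: IH.
by have := @step_left simTM _ _ _ _ Hp (sim_nhalt _) _ _ isT D; rewrite set_cell_id.
Qed.

(** The cost is that of one scan to the top of a stack and one scan back. *)
Lemma sim_instr st q (d : config simTM) B :
  at_pos d (inl (Some q, None)) (tape_of st) 0 -> (forall i, size (st i) <= B) ->
  exists2 T, T <= 2 * B + 4 &
    let r := instr_step (code q) st in
    at_pos (iter T simstep d) (inl (r.1, None)) (tape_of r.2) 0.
Proof.
move=> Hd HB; case E: (code q) => [o|i b o|i f] /=.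
- exists 1; first by lia.
  have D : sim_delta (inl (Some q, None)) (tape_of st 0) = (inl (o, None), tape_of st 0, Stay).
    by rewrite /= E.
  by have := @step_stay simTM _ _ _ _ Hd (sim_nhalt _) _ _ D; rewrite set_cell_id.
- have ik : i <= k by have := code_reg q; rewrite E /= /k; lia.
  have S1 : at_pos (iter (size (st i)) simstep d) (inl (Some q, None)) (tape_of st)
      (0 + size (st i)).
    by apply: (scan_right (i := i)) Hd => // x; rewrite /= E; case: (trk x i).
  rewrite add0n in S1.
  have S2 := step_stay S1 (sim_nhalt _).
  have {}S2 := S2 (inl (o, Some true)) (set_trk (tape_of st (size (st i))) i (Some b)).
  have {}S2 := S2 ltac:(by rewrite /= E trk_tape // stack_bit_ge // size_rev).
  rewrite tape_push // in S2; have := scan_left S2; rewrite -iterS -iterD => S3.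
  by exists ((size (st i)).+1 + (size (st i)).+1); first by have := HB i; lia.
- have ik : i <= k by have := code_reg q; rewrite E /= /k; lia.
  case Ei: (st i) => [|b r] /=.
    exists 1; first by lia.
    have D : sim_delta (inl (Some q, None)) (tape_of st 0) =
        (inl (f None, None), tape_of st 0, Stay) by rewrite /= E trk_tape // Ei.
    by have := @step_stay simTM _ _ _ _ Hd (sim_nhalt _) _ _ D; rewrite set_cell_id.
  have S1 : at_pos (iter (size (st i)) simstep d) (inl (Some q, None)) (tape_of st)
      (0 + size (st i)).
    by apply: (scan_right (i := i)) Hd => // x; rewrite /= E; case: (trk x i).
  rewrite add0n in S1.
  have := @step_left _ _ _ _ _ S1 (sim_nhalt _) (inl (Some q, Some false))
    (tape_of st (size (st i))).
  rewrite Ei /= E set_cell_id trk_tape // stack_bit_ge ?size_rev ?Ei //= => S2.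
  have {}S2 := S2 isT erefl.
  have := @step_stay _ _ _ _ _ S2 (sim_nhalt _) (inl (f (Some b), Some true))
    (set_trk (tape_of st (size r)) i None).
  rewrite /= E trk_tape // Ei rev_cons /stack_bit map_rcons nth_rcons size_map size_rev.
  rewrite ltnn eqxx => S3; have {}S3 := S3 erefl.
  rewrite (tape_pop ik Ei) in S3; have := scan_left S3; rewrite -!iterS -iterD => S4.
  by eexists; last exact: S4; have := HB i; rewrite Ei /=; lia.
Qed.

Lemma instr_step_size X (I : instr X) st i B :
  (forall i, size (st i) <= B) -> size ((instr_step I st).2 i) <= B.+1.
Proof.
move=> H; have := H i; case: I => [x|j b x|j x] /=; first by lia.
  by rewrite /upd; case: eqP => [->|] //=; lia.
case Ej: (st j) => [|b r] /=; first by lia.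
by rewrite /upd; case: eqP => [->|] //=; rewrite ?Ej /=; lia.
Qed.

Lemma sim_reach q st n q' st' : reach (@code c) q st n q' st' ->
  forall (d : config simTM) B,
  at_pos d (inl (q, None)) (tape_of st) 0 -> (forall i, size (st i) <= B) ->
  exists2 T, T <= n * (2 * (B + n) + 4) &
    at_pos (iter T simstep d) (inl (q', None)) (tape_of st') 0.
Proof.
elim=> {q st n q' st'} [q st|q st q1 st1 n q2 st2 E _ IH] d B Hd HB.
  by exists 0.
have [T1 T1B] := sim_instr Hd HB; rewrite E /= => H1.
have B1 i : size (st1 i) <= B.+1.
  by have := @instr_step_size _ (code q) st i B HB; rewrite E.
have [T2 T2B H2] := IH _ _ H1 B1.
exists (T2 + T1); last by rewrite iterD.
by nia.
Qed.

Definition load (w : seq sym) : store := fun i =>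
  if i == 0 then rev [seq (if s is S1 then true else false) | s <- w]
  else if i == 1 then rev [seq (if s is Sep then true else false) | s <- w]
  else [::].

Lemma sim_init w :
  at_pos (simstep (init simTM w)) (inl (Some (entry c), None)) (tape_of (load w)) 0.
Proof.
pose tp j := nth (tm_blank simTM) (map sim_inj w) j.
have H0 : at_pos (init simTM w) (inr None) tp 0.
  by rewrite /init /tp; case: w {tp} => [|s w]; split => //= j; rewrite ?nth_nil ?add0n.
suff E0 : tape_of (load w) = set_cell tp 0  (true, (tp 0).2).
  by rewrite E0; exact: (@step_stay simTM _ _ _ _ H0 erefl _ _ erefl).
apply: functional_extensionality => j; rewrite /tape_of /set_cell.
have E : [ffun i : 'I_k.+1 => stack_bit (rev (load w i)) j] = (tp j).2.
  apply/ffunP => i; rewrite ffunE /load /tp.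
  case: (ltnP j (size w)) => jw; last first.
    rewrite nth_default ?size_map // ffunE.
    case: ifP => _; first by rewrite revK stack_bit_ge // size_map.
    case: ifP => _; first by rewrite revK stack_bit_ge // size_map.
    by rewrite stack_bit_ge.
  rewrite (nth_map S0) // ffunE.
  case: ifP => _; first by rewrite revK /stack_bit -map_comp (nth_map S0).
  case: ifP => _; first by rewrite revK /stack_bit -map_comp (nth_map S0).
  by rewrite stack_bit_ge.
rewrite E; case: eqP => [->//|/eqP nj].
rewrite /tp; case: (ltnP j (size w)) => jw; last by rewrite nth_default ?size_map.
by rewrite (nth_map S0).
Qed.

Lemma iter_halted (M : TM) n (d : config M) : halted d -> iter n (@step M) d = d.
Proof. by move=> Hd; elim: n => //= n ->; rewrite /step Hd. Qed.

(** A stack grows by at most one bit per instruction, so every instruction costs time linear in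
    [n + size w]. Halted configurations are stationary, hence the claim for all later times. *)
Lemma sim_run w n st' : exec c (load w) n st' ->
  exists2 T, T <= (n + size w + 3) ^ 3 & forall T', T <= T' ->
    cq (run simTM T' w) = inr (Some (st' 1 != [::])).
Proof.
move=> /exec_reach R; have Bw i : size (load w i) <= size w.
  by rewrite /load; do 2 (case: ifP => _; rewrite ?size_rev ?size_map //).
have [T TB HT] := sim_reach R (sim_init w) Bw.
have := @step_stay simTM _ _ _ _ HT (sim_nhalt _) (inr (Some (trk (tape_of st' 0) 1 : bool)))
  (tape_of st' 0) erefl.
rewrite -iterS -iterSr => HT2; exists T.+2.
  have : n * (2 * (size w + n) + 4) + 2 <= (n + size w + 3) ^ 3.
    have H : n * (2 * (size w + n) + 4) + 2 <= (n + size w + 3) * (3 * (n + size w + 3)) by nia.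
    by apply: leq_trans H _; rewrite !expnS expn0; nia.
  by lia.
move=> T' TT; rewrite /run -(subnK TT) iterD iter_halted; last first.
  by case: HT2 => E _ _ _; rewrite /halted E; case: (trk _ _ : bool).
case: HT2 => -> _ _ _; rewrite trk_tape //; congr (inr (Some _)).
case: (st' 1) => [|b r]; first by rewrite stack_bit_ge.
by rewrite stack_bit_lt // size_rev.
Qed.

End Simulation.

(** * Programs on serialized trees *)

(** The base [n.+2] is that of the time bounds in [InP]; being at least 2, it lets the exponent
    absorb constants. *)
Definition pbound (p : nat -> nat) := exists c, forall n, p n <= n.+2 ^ c.

Lemma leq_expl m n e : m <= n -> m ^ e <= n ^ e.
Proof. by case: e => // e mn; rewrite leq_exp2r. Qed.

Lemma pbound_le p q : (forall n, p n <= q n) -> pbound q -> pbound p.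
Proof. by move=> pq [c H]; exists c => n; apply: leq_trans (H n). Qed.

Lemma pbound_const a : pbound (fun _ => a).
Proof.
exists a => n; apply: leq_trans (leq_expl a (_ : 2 <= n.+2)) => //.
exact: ltnW (ltn_expl _ _).
Qed.

Lemma pbound_id : pbound id.
Proof. by exists 1 => n; rewrite expn1; lia. Qed.

Lemma pbound_mul p q : pbound p -> pbound q -> pbound (fun n => p n * q n).
Proof. by move=> [c Hc] [d Hd]; exists (c + d) => n; rewrite expnD leq_mul. Qed.

Lemma pbound_add p q : pbound p -> pbound q -> pbound (fun n => p n + q n).
Proof.
move=> [c Hc] [d Hd]; exists (c + d).+1 => n; rewrite expnS expnD.
have := Hc n; have := Hd n; have := expn_gt0 n.+2 c; have := expn_gt0 n.+2 d.
by move: (n.+2 ^ c) (n.+2 ^ d) => x y; nia.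
Qed.

Lemma pbound_exp p c : pbound p -> pbound (fun n => p n ^ c).
Proof.
move=> Hp; elim: c => [|c IH]; first exact: pbound_const.
by apply: (@pbound_le _ (fun n => p n * p n ^ c)) => [n|]; [rewrite expnS|exact: pbound_mul].
Qed.

Lemma pbound_exps p c : pbound p -> pbound (fun n => (p n).+2 ^ c).
Proof.
move=> Hp; apply: pbound_exp; apply: (@pbound_le _ (fun n => p n + 2)) => [n|]; first lia.
by apply: pbound_add => //; apply: pbound_const.
Qed.

Ltac pb := repeat first
  [ assumption | apply: pbound_id | apply: pbound_const | apply: pbound_add
  | apply: pbound_mul | apply: pbound_exps | apply: pbound_exp ].

Inductive tree := Leaf | Node of tree & tree.

(** A prefix code: the end of a tree can be recognized from its bits, so several trees can lie on
    one stack without separators. *)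
Fixpoint ser (t : tree) : seq bool :=
  if t is Node a b then true :: ser a ++ ser b else [:: false].

Class Enc (A : Type) := enc : A -> tree.
#[global] Hint Mode Enc ! : typeclass_instances.

Definition sz A `{Enc A} (a : A) : nat := size (ser (enc a)).

#[global] Instance enc_tree : Enc tree := id.
(* Both booleans have the same size, so the size of a number only depends on its
   number of bits. *)
#[global] Instance enc_bool : Enc bool :=
  fun b => if b then Node (Node Leaf Leaf) Leaf else Node Leaf (Node Leaf Leaf).
#[global] Instance enc_prod A B `{Enc A} `{Enc B} : Enc (A * B) :=
  fun p => Node (enc p.1) (enc p.2).
#[global] Instance enc_seq A `{Enc A} : Enc (seq A) :=
  fix F s := if s is x :: s' then Node (enc x) (F s') else Leaf.

Lemma sz_gt0 A `{Enc A} (a : A) : 0 < sz a.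
Proof. by rewrite /sz; case: (enc a). Qed.

Lemma sz_pair A B `{Enc A} `{Enc B} (p : A * B) : sz p = (sz p.1 + sz p.2).+1.
Proof. by rewrite /sz /= size_cat. Qed.

Lemma sz_cons A `{Enc A} (x : A) s : sz (x :: s) = (sz x + sz s).+1.
Proof. by rewrite /sz /= size_cat. Qed.

Lemma sz_nil A `{Enc A} : sz ([::] : seq A) = 1.
Proof. by []. Qed.

Definition execs (P : cmd) st B st' := exists2 n, n <= B & exec P st n st'.

Lemma execs_le P st B B' st' : execs P st B st' -> B <= B' -> execs P st B' st'.
Proof. by case=> n nB E BB; exists n => //; apply: leq_trans BB. Qed.

Lemma execs_skip st : execs Skip st 1 st.
Proof. by exists 1 => //; constructor. Qed.

Lemma execs_push i b st : execs (Push i b) st 1 (upd st i (b :: st i)).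
Proof. by exists 1 => //; constructor. Qed.

Lemma execs_seq P Q st B1 st1 B2 st2 :
  execs P st B1 st1 -> execs Q st1 B2 st2 -> execs (Seq P Q) st (B1 + B2) st2.
Proof.
move=> [n1 H1 E1] [n2 H2 E2]; exists (n1 + n2); first by rewrite leq_add.
exact: ExecSeq E1 E2.
Qed.

Lemma execs_loop0 i P Q st : st i = [::] -> execs (Loop i P Q) st 1 st.
Proof. by exists 1 => //; constructor. Qed.

Lemma execs_loopS i P Q st b r B1 st1 B2 st2 :
  st i = b :: r -> execs (if b then Q else P) (upd st i r) B1 st1 ->
  execs (Loop i P Q) st1 B2 st2 -> execs (Loop i P Q) st (B1 + B2).+1 st2.
Proof.
move=> E [n1 H1 E1] [n2 H2 E2]; exists (n1 + n2).+1; first by rewrite ltnS leq_add.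
exact: ExecLoopS E E1 E2.
Qed.

Lemma execs_caseS i N P Q st b r B st' :
  st i = b :: r -> execs (if b then Q else P) (upd st i r) B st' ->
  execs (Case i N P Q) st B.+1 st'.
Proof. by move=> E [n H1 E1]; exists n.+1 => //; apply: ExecCaseS E E1. Qed.

Lemma exec_size P st n st' : exec P st n st' -> forall i, size (st' i) <= size (st i) + n.
Proof.
elim=> {P st n st'} [st|i b st|c1 c2 st n1 st1 n2 st2 _ R1 _ R2|i c0 c1 st E
  |i c0 c1 st b r n1 st1 n2 st2 E _ R1 _ R2
  |i cn c0 c1 st n st' E _ R|i cn c0 c1 st b r n st' E _ R] j.
- by rewrite leq_addr.
- by rewrite /upd; case: eqP => [->|] /=; lia.
- by have := R1 j; have := R2 j; lia.
- by rewrite leq_addr.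
- have := R1 j; have := R2 j; rewrite /upd; case: eqP => [->|] /=; rewrite ?E /=; lia.
- by have := R j; lia.
- have := R j; rewrite /upd; case: eqP => [->|] /=; rewrite ?E /=; lia.
Qed.

Ltac st_eq := apply: functional_extensionality => ?; rewrite /upd;
  repeat (case: eqP => ?; subst); try congruence; try lia; auto.

Lemma updE st i v : upd st i v i = v. Proof. by rewrite /upd eqxx. Qed.
Lemma updN st i j v : j != i -> upd st i v j = st j.
Proof. by rewrite /upd => /negbTE->. Qed.
Lemma upd_id st i v : st i = v -> upd st i v = st.
Proof. by move=> E; st_eq. Qed.
Lemma upd2 st i v w : upd (upd st i v) i w = upd st i w.
Proof. by st_eq. Qed.
Lemma updC st i j v w : i != j -> upd (upd st i v) j w = upd (upd st j w) i v.
Proof. by move=> ij; st_eq; rewrite eqxx in ij. Qed.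

(** A transfer reverses the stack; two transfers in a row restore the order. *)
Definition mv i j := Loop i (Push j false) (Push j true).

Lemma execs_mv i j st s : st i = s -> i != j ->
  execs (mv i j) st (2 * size s).+1 (upd (upd st i [::]) j (catrev s (st j))).
Proof.
move=> E ij; elim: s st E => [|b s IH] st E.
  have -> : upd (upd st i [::]) j (catrev [::] (st j)) = st by st_eq.
  exact: execs_loop0.
apply: (@execs_le _ _ (1 + (2 * size s).+1).+1); last by rewrite /=; lia.
have ji : j != i by rewrite eq_sym.
apply: (execs_loopS E); first by case: b {E}; apply: execs_push.
have := IH (upd (upd st i s) j (b :: upd st i s j)).
rewrite updN // updE => /(_ erefl).
by rewrite !updE (updN _ _ ji) (updC _ _ _ ji) !upd2.
Qed.

Definition clear i := Loop i Skip Skip.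

Lemma execs_clear i st s : st i = s -> execs (clear i) st (2 * size s).+1 (upd st i [::]).
Proof.
move=> E; elim: s st E => [|b s IH] st E; first by rewrite upd_id //; exact: execs_loop0.
apply: (@execs_le _ _ (1 + (2 * size s).+1).+1); last by rewrite /=; lia.
apply: (execs_loopS E); first by case: b {E}; apply: execs_skip.
by have := IH (upd st i s) (updE _ _ _); rewrite upd2.
Qed.

Definition mv2 i j k := Loop i (Seq (Push j false) (Push k false)) (Seq (Push j true) (Push k true)).

Lemma execs_mv2 i j k st s : st i = s -> i != j -> i != k -> j != k ->
  execs (mv2 i j k) st (3 * size s).+1
    (upd (upd (upd st i [::]) j (catrev s (st j))) k (catrev s (st k))).
Proof.
move=> E ij ik jk; elim: s st E => [|b s IH] st E.
  have -> : upd (upd (upd st i [::]) j (catrev [::] (st j))) k (catrev [::] (st k)) = st by st_eq.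
  exact: execs_loop0.
apply: (@execs_le _ _ (2 + (3 * size s).+1).+1); last by rewrite /=; lia.
have [ji ki kj] : [/\ j != i, k != i & k != j] by split; rewrite eq_sym.
set st1 := upd (upd (upd st i s) j (b :: st j)) k (b :: st k).
apply: (execs_loopS (st1 := st1) E).
  have -> : st1 = upd (upd (upd st i s) j (b :: upd st i s j)) k
      (b :: upd (upd st i s) j (b :: upd st i s j) k) by rewrite /st1 !updN.
  by case: b @st1 {E}; apply: (@execs_seq _ _ _ 1 _ 1); apply: execs_push.
have -> : upd (upd (upd st i [::]) j (catrev (b :: s) (st j))) k (catrev (b :: s) (st k)) =
    upd (upd (upd st1 i [::]) j (catrev s (st1 j))) k (catrev s (st1 k)).
  have -> : st1 j = b :: st j by rewrite /st1 !(updE, updN).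
  have -> : st1 k = b :: st k by rewrite /st1 !(updE, updN).
  by rewrite /st1; st_eq.
by apply: IH; rewrite /st1 !(updE, updN).
Qed.

(* A copy of the top tree of register [i] is moved, reversed, to register [j];
   register [u] counts in unary the subtrees still to be read. *)
Definition tsplit_body i j u :=
  Case i Skip (Push j false) (Seq (Push j true) (Seq (Push u true) (Push u true))).
Definition tsplit i j u := Seq (Push u true) (Loop u (tsplit_body i j u) (tsplit_body i j u)).

(** Generalized to a list of pending trees: a leaf removes one of them, a node is replaced by its
    two subtrees. The induction is on the number of bits, since the list itself can grow. *)
Lemma execs_tsplit_loop i j u st (ts : seq tree) r :
  i != j -> i != u -> j != u ->
  st i = flatten (map ser ts) ++ r -> st u = nseq (size ts) true ->
  execs (Loop u (tsplit_body i j u) (tsplit_body i j u)) st (5 * size (flatten (map ser ts))).+1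
    (upd (upd (upd st i r) j (catrev (flatten (map ser ts)) (st j))) u [::]).
Proof.
move=> ij iu ju; have [n] := ubnP (size (flatten (map ser ts))).
elim: n ts st => // n IH [|t ts] st Hn Ei Eu.
  have -> : upd (upd (upd st i r) j (catrev (flatten (map ser [::])) (st j))) u [::] = st.
    by st_eq.
  exact: execs_loop0.
have ji : j != i by rewrite eq_sym.
have ui : u != i by rewrite eq_sym.
have uj : u != j by rewrite eq_sym.
case: t Hn Ei Eu => [|t1 t2] /= Hn Ei Eu.
- apply: (@execs_le _ _ (2 + (5 * size (flatten (map ser ts))).+1).+1); last by lia.
  apply: (execs_loopS Eu).
    by apply: execs_caseS; [rewrite updN //; exact: Ei|apply: execs_push].
  set st1 := upd _ j _.
  have -> : upd (upd (upd st i r) j (catrev (flatten (map ser ts)) (false :: st j))) u [::] =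
     upd (upd (upd st1 i r) j (catrev (flatten (map ser ts)) (st1 j))) u [::].
    rewrite {2}/st1 updE /st1 !updN //; st_eq.
  apply: IH; first by lia.
    by rewrite /st1 !(updE, updN).
  by rewrite /st1 !(updE, updN).
- have Es : flatten (map ser [:: t1, t2 & ts]) = ser t1 ++ ser t2 ++ flatten (map ser ts) by [].
  apply: (@execs_le _ _ (4 + (5 * size (flatten (map ser [:: t1, t2 & ts]))).+1).+1); last first.
    by rewrite Es !size_cat in Hn *; lia.
  apply: (execs_loopS Eu).
    apply: execs_caseS; first by rewrite updN //; exact: Ei.
    by apply: (@execs_seq _ _ _ 1 _ 2); last apply: (@execs_seq _ _ _ 1 _ 1); apply: execs_push.
  set st1 := upd _ u _.
  have -> : upd (upd (upd st i r) j
       (catrev ((ser t1 ++ ser t2) ++ flatten (map ser ts)) (true :: st j))) u [::] =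
     upd (upd (upd st1 i r) j (catrev (flatten (map ser [:: t1, t2 & ts])) (st1 j))) u [::].
    have -> : st1 j = true :: st j by rewrite /st1 !(updE, updN).
    rewrite Es catA; rewrite /st1; st_eq.
  apply: IH; first by rewrite Es !size_cat in Hn *; lia.
    by rewrite /st1 !(updE, updN) // Es !catA.
  by rewrite /st1 !(updE, updN).
Qed.

Lemma execs_tsplit i j u st t r :
  i != j -> i != u -> j != u -> st i = ser t ++ r -> st u = [::] ->
  execs (tsplit i j u) st (5 * size (ser t) + 2) (upd (upd st i r) j (catrev (ser t) (st j))).
Proof.
move=> ij iu ju Ei Eu; apply: (@execs_le _ _ (1 + (5 * size (ser t)).+1)); last by lia.
apply: execs_seq; first exact: execs_push.
have ui : u != i by rewrite eq_sym.
have uj : u != j by rewrite eq_sym.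
set st1 := upd _ _ _.
have := @execs_tsplit_loop i j u st1 [:: t] r ij iu ju.
rewrite /= cats0 /st1 !(updE, updN) // Eu => /(_ Ei erefl).
by congr execs; st_eq.
Qed.

(** Registers [1] to [k.-1] are scratch space, empty before and after. Registers from [k] on are
    arbitrary and end unchanged, so that a caller can keep data there during a call. *)
Definition computes (P : cmd) (k c : nat) A B `{Enc A} `{Enc B} (f : A -> B) :=
  forall a st, st 0 = ser (enc a) -> (forall i, 0 < i < k -> st i = [::]) ->
  execs P st ((sz a).+2 ^ c) (upd st 0 (ser (enc (f a)))).

Definition PT A B `{Enc A} `{Enc B} (f : A -> B) :=
  exists P k c, computes P k c f.

Lemma computes_weak P k c k' A B `{Enc A} `{Enc B} (f : A -> B) :
  computes P k c f -> k <= k' -> computes P k' c f.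
Proof.
move=> Hf kk a st E0 Ek; apply: Hf => // i /andP [i0 ik].
by apply: Ek; rewrite i0 (leq_trans ik kk).
Qed.

Lemma PT_intro P k (p : nat -> nat) A B `{Enc A} `{Enc B} (f : A -> B) :
  pbound p ->
  (forall a st, st 0 = ser (enc a) -> (forall i, 0 < i < k -> st i = [::]) ->
   execs P st (p (sz a)) (upd st 0 (ser (enc (f a))))) -> PT f.
Proof.
by move=> [c Hc] H1; exists P, k, c => a st E0 Ek; apply: execs_le (H1 _ _ E0 Ek) _.
Qed.

(** A step lengthens a register by at most one bit, so the time bounds the size of the output. This
    is what keeps compositions polynomial. *)
Lemma PT_size A B `{Enc A} `{Enc B} (f : A -> B) :
  PT f -> exists2 p, pbound p & forall a, sz (f a) <= p (sz a).
Proof.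
move=> [P [k [c Hf]]]; exists (fun n => n + n.+2 ^ c); first by pb; apply: pbound_id.
move=> a; have [] := Hf a (upd (fun _ => [::]) 0 (ser (enc a))) (updE _ _ _).
  by case.
move=> n nB E.
by have := exec_size E 0; rewrite updE /sz => /leq_trans; apply; rewrite leq_add2l.
Qed.

(** Programs see only trees, so a change of type that preserves the encoding costs nothing. *)
Lemma PT_recode A B A' B' `{Enc A} `{Enc B} `{Enc A'} `{Enc B'} (g : A -> A')
    (f : A -> B) (h : A' -> B') :
  (forall a, enc (g a) = enc a) -> (forall a, enc (f a) = enc (h (g a))) -> PT h -> PT f.
Proof.
move=> Eg Ef [P [k [c Hh]]]; exists P, k, c => a st E0 Ek.
by rewrite Ef /sz -Eg; apply: Hh; rewrite ?Eg.
Qed.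

Lemma PT_id A `{Enc A} : PT (fun a : A => a).
Proof.
apply: (@PT_intro Skip 1 (fun _ => 1)); first exact: pbound_const.
by move=> a st E0 _; rewrite upd_id //; apply: execs_skip.
Qed.

Fixpoint pushes i (s : seq bool) : cmd :=
  if s is b :: s' then Seq (pushes i s') (Push i b) else Skip.

Lemma execs_pushes i s st : execs (pushes i s) st (size s).+1 (upd st i (s ++ st i)).
Proof.
elim: s => [|b s IH] /=; first by rewrite upd_id //; apply: execs_skip.
apply: (@execs_le _ _ ((size s).+1 + 1)); last by lia.
apply: execs_seq IH _.
by have := execs_push i b (upd st i (s ++ st i)); rewrite updE upd2.
Qed.

Lemma PT_const A B `{Enc A} `{Enc B} (b : B) : PT (fun _ : A => b).
Proof.
apply: (@PT_intro (Seq (clear 0) (pushes 0 (ser (enc b)))) 1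
  (fun n => 2 * n + (size (ser (enc b))).+2)); first by pb.
move=> a st E0 _.
apply: (@execs_le _ _ ((2 * sz a).+1 + (size (ser (enc b))).+1)); last by lia.
apply: execs_seq; first exact: execs_clear E0.
set v := ser _; have := execs_pushes 0 v (upd st 0 [::]).
by rewrite updE upd2 cats0.
Qed.

Lemma PT_comp A B C `{Enc A} `{Enc B} `{Enc C} (g : B -> C) (f : A -> B) :
  PT g -> PT f -> PT (fun a => g (f a)).
Proof.
move=> [Pg [kg [cg Hg]]] Hf; have [p pp Hp] := PT_size Hf.
case: Hf => [Pf [kf [cf Hf]]].
apply: (@PT_intro (Seq Pf Pg) (maxn kf kg) (fun n => n.+2 ^ cf + (p n).+2 ^ cg)).
  by pb; apply: pbound_id.
move=> a st E0 Ek; apply: execs_seq.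
  exact: (computes_weak Hf (leq_maxl _ _) E0 Ek).
set st1 := upd st 0 _.
have -> : upd st 0 (ser (enc (g (f a)))) = upd st1 0 (ser (enc (g (f a)))) by rewrite /st1 upd2.
have I1 : st1 0 = ser (enc (f a)) by rewrite /st1 updE.
have I2 i : 0 < i < maxn kf kg -> st1 i = [::] by move=> ik; rewrite /st1 updN ?Ek //; lia.
apply: execs_le (computes_weak Hg (leq_maxr kf kg) I1 I2) _.
by rewrite leq_expl // !ltnS Hp.
Qed.

(* The result of [f] waits, reversed, in register K+1, and the input in register K. *)
Lemma PT_pair A B C `{Enc A} `{Enc B} `{Enc C} (f : A -> B) (g : A -> C) :
  PT f -> PT g -> PT (fun a => (f a, g a)).
Proof.
move=> Hf [Pg [kg [cg Hg]]]; have [p pp Hp] := PT_size Hf.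
case: Hf => [Pf [kf [cf Hf]]].
pose K := (maxn kf kg).+1.
apply: (@PT_intro
  (Seq (mv 0 K) (Seq (mv2 K 0 K.+1) (Seq Pf (Seq (mv 0 K) (Seq (mv K.+1 K.+2)
    (Seq (mv K.+2 0) (Seq Pg (Seq (mv K 0) (Push 0 true)))))))))
  K.+3 (fun n => (2 * n + 1) + ((3 * n + 1) + (n.+2 ^ cf + ((2 * p n + 1) + ((2 * n + 1)
     + ((2 * n + 1) + (n.+2 ^ cg + ((2 * p n + 1) + 1))))))))).
  by pb; apply: pbound_id.
move=> a st E0 Ek.
have [K1 K2 K3 K4] : [/\ K != K.+1, 0 != K.+1, K.+1 != K & K.+1 != K.+2] by split; lia.
have EK : st K = [::] by apply: Ek; lia.
have EK1 : st K.+1 = [::] by apply: Ek; lia.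
have EK2 : st K.+2 = [::] by apply: Ek; lia.
set u := ser (enc a) in E0 *.
apply: execs_seq.
  by apply: execs_le (execs_mv E0 _) _ => //; rewrite /sz -/u; lia.
rewrite EK; apply: execs_seq.
  apply: execs_le (execs_mv2 (s := rev u) _ _ _ _) _; rewrite ?updE //.
  by rewrite size_rev /sz -/u; lia.
have -> : upd (upd (upd (upd (upd st 0 [::]) K (catrev u [::])) K [::]) 0
    (catrev (rev u) (upd (upd st 0 [::]) K (catrev u [::]) 0))) K.+1
    (catrev (rev u) (upd (upd st 0 [::]) K (catrev u [::]) K.+1)) = upd st K.+1 u.
  have -> : upd (upd st 0 [::]) K (catrev u [::]) 0 = [::] by rewrite updN // updE.
  have -> : upd (upd st 0 [::]) K (catrev u [::]) K.+1 = [::] by rewrite !updN //; lia.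
  by rewrite -!/(rev _) !revK; st_eq.
apply: execs_seq.
  have I1 : upd st K.+1 u 0 = ser (enc a) by rewrite updN.
  have I2 i : 0 < i < K -> upd st K.+1 u i = [::] by move=> ik; rewrite updN ?Ek //; lia.
  apply: (computes_weak Hf _ I1 I2); lia.
apply: execs_seq.
  apply: execs_le (execs_mv (s := ser (enc (f a))) _ _) _; rewrite ?updE //.
  by have := Hp a; rewrite /sz; lia.
apply: execs_seq.
  apply: execs_le (execs_mv (s := u) _ _) _ => //; last by rewrite /sz -/u; lia.
    by rewrite !(updE, updN) //; lia.
apply: execs_seq.
  apply: execs_le (execs_mv (s := rev u) _ _) _ => //; last by rewrite size_rev /sz -/u; lia.
  by rewrite updE !updN ?EK2 //; lia.
set st1 := upd _ 0 _.
have {st1}-> : st1 = upd (upd st 0 u) K (rev (ser (enc (f a)))).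
  rewrite /st1 !(updE, updN) //; try lia.
  rewrite EK EK2 -!/(rev _) !revK; st_eq.
apply: execs_seq.
  set st1 := upd _ K _.
  have I1 : st1 0 = ser (enc a) by rewrite /st1 updN // updE.
  have I2 i : 0 < i < K -> st1 i = [::] by move=> ik; rewrite /st1 !updN ?Ek //; lia.
  apply: (computes_weak Hg _ I1 I2); lia.
apply: execs_seq.
  apply: execs_le (execs_mv (s := rev (ser (enc (f a)))) _ _) _ => //.
    by rewrite updN ?updE.
  by rewrite size_rev; have := Hp a; rewrite /sz; lia.
set st1 := upd _ 0 _.
have -> : upd st 0 (ser (enc (f a, g a))) = upd st1 0 (true :: st1 0).
  rewrite /st1 updE !(updE, updN) //= catrevE revK; st_eq.
exact: execs_push.
Qed.

Definition tfst (t : tree) := if t is Node a _ then a else Leaf.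
Definition tsnd (t : tree) := if t is Node _ b then b else Leaf.

Lemma PT_tfst : PT tfst.
Proof.
apply: (@PT_intro (Case 0 Skip (Push 0 false)
  (Seq (tsplit 0 1 2) (Seq (clear 0) (mv 1 0)))) 3 (fun n => 9 * n + 5)); first by pb.
move=> [|a b] st E0 Ek.
  apply: (@execs_le _ _ 2); last by rewrite /sz /=; lia.
  apply: (@execs_caseS _ _ _ _ _ false [::] 1) => //.
  by have := execs_push 0 false (upd st 0 [::]); rewrite updE upd2.
rewrite /sz /= size_cat; set na := size _; set nb := size _.
apply: (@execs_le _ _ ((5 * na + 2) + ((2 * nb).+1 + (2 * na).+1)).+1); last by lia.
apply: (@execs_caseS _ _ _ _ _ true (ser a ++ ser b)) => //; apply: execs_seq.
  by apply: execs_tsplit; rewrite ?updE ?updN ?Ek.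
apply: execs_seq; first by apply: execs_clear; rewrite updN // updE.
set st1 := upd _ 0 [::].
have := @execs_mv 1 0 st1 (rev (ser a)); rewrite size_rev /st1.
rewrite !(updE, updN) // Ek // => /(_ erefl isT).
rewrite -!/(rev _) !revK.
set s1 := upd _ 0 (ser a); set s2 := upd st 0 (ser (enc _)).
suff -> : s1 = s2 by [].
by rewrite /s1 /s2; have E1 := Ek 1 isT; st_eq.
Qed.

Lemma PT_tsnd : PT tsnd.
Proof.
apply: (@PT_intro (Case 0 Skip (Push 0 false)
  (Seq (tsplit 0 1 2) (clear 1))) 3 (fun n => 9 * n + 5)); first by pb.
move=> [|a b] st E0 Ek.
  apply: (@execs_le _ _ 2); last by rewrite /sz /=; lia.
  apply: (@execs_caseS _ _ _ _ _ false [::] 1) => //.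
  by have := execs_push 0 false (upd st 0 [::]); rewrite updE upd2.
rewrite /sz /= size_cat; set na := size _; set nb := size _.
apply: (@execs_le _ _ ((5 * na + 2) + (2 * na).+1).+1); last by lia.
apply: (@execs_caseS _ _ _ _ _ true (ser a ++ ser b)) => //; apply: execs_seq.
  by apply: execs_tsplit; rewrite ?updE ?updN ?Ek.
set st1 := upd _ 1 _.
have := @execs_clear 1 st1 (rev (ser a)); rewrite size_rev /st1.
rewrite !(updE, updN) // Ek // => /(_ erefl).
set s1 := upd _ 1 [::]; set s2 := upd st 0 (ser (enc _)).
suff -> : s1 = s2 by [].
by rewrite /s1 /s2; have E1 := Ek 1 isT; st_eq.
Qed.

Definition is_leaf (t : tree) := if t is Leaf then true else false.

(** Whether a tree is a leaf shows in the first bit of its serialization. [PT_if] and [PT_nilp] are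
    obtained from this test. *)
Lemma PT_ifleaf A B C `{Enc A} `{Enc B} `{Enc C} (f : A -> C) (g h : A -> B) :
  PT f -> PT g -> PT h -> PT (fun a => if is_leaf (enc (f a)) then g a else h a).
Proof.
move=> Hf [Pg [kg [cg Hg]]] [Ph [kh [ch Hh]]]; have [p pp Hp] := PT_size Hf.
case: Hf => [Pf [kf [cf Hf]]].
pose K := (maxn kf (maxn kg kh)).+1.
pose back := Seq (mv K.+1 K) (mv K 0).
apply: (@PT_intro
  (Seq (mv 0 K) (Seq (mv2 K 0 K.+1) (Seq Pf (Case 0 Skip (Seq back Pg)
     (Seq (clear 0) (Seq back Ph))))))
  K.+2 (fun n => (2 * n + 1) + ((3 * n + 1) + (n.+2 ^ cf + (((2 * p n + 1) + ((2 * n + 1)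
     + (2 * n + 1) + (n.+2 ^ cg + n.+2 ^ ch))) + 1))))).
  by pb; apply: pbound_id.
move=> a st E0 Ek.
have [K1 K2 K3 K4] : [/\ K != K.+1, 0 != K.+1, K.+1 != K & K.+1 != K.+2] by split; lia.
have EK : st K = [::] by apply: Ek; lia.
have EK1 : st K.+1 = [::] by apply: Ek; lia.
set u := ser (enc a) in E0 *.
apply: execs_seq.
  by apply: execs_le (execs_mv E0 _) _ => //; rewrite /sz -/u; lia.
rewrite EK; apply: execs_seq.
  apply: execs_le (execs_mv2 (s := rev u) _ _ _ _) _; rewrite ?updE //.
  by rewrite size_rev /sz -/u; lia.
have -> : upd (upd (upd (upd (upd st 0 [::]) K (catrev u [::])) K [::]) 0
    (catrev (rev u) (upd (upd st 0 [::]) K (catrev u [::]) 0))) K.+1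
    (catrev (rev u) (upd (upd st 0 [::]) K (catrev u [::]) K.+1)) = upd st K.+1 u.
  have -> : upd (upd st 0 [::]) K (catrev u [::]) 0 = [::] by rewrite updN // updE.
  have -> : upd (upd st 0 [::]) K (catrev u [::]) K.+1 = [::] by rewrite !updN //; lia.
  by rewrite -!/(rev _) !revK; st_eq.
apply: execs_seq.
  have I1 : upd st K.+1 u 0 = ser (enc a) by rewrite updN.
  have I2 i : 0 < i < K -> upd st K.+1 u i = [::] by move=> ik; rewrite updN ?Ek //; lia.
  apply: (computes_weak Hf _ I1 I2); lia.
have Hback s : s 0 = [::] -> s K.+1 = u -> s K = [::] ->
    execs back s ((2 * sz a + 1) + (2 * sz a + 1)) (upd (upd s K.+1 [::]) 0 u).
  move=> e0 eK1 eK; apply: execs_seq.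
    by apply: execs_le (execs_mv eK1 _) _; rewrite /sz -/u; lia.
  have := @execs_mv K 0 (upd (upd s K.+1 [::]) K (catrev u (s K))) (rev u).
  rewrite updE eK => /(_ erefl isT); rewrite size_rev !updN //; try lia.
  rewrite e0 -!/(rev _) !revK => H3.
  have -> : upd (upd s K.+1 [::]) 0 u = upd (upd (upd (upd s K.+1 [::]) K (rev u)) K [::]) 0 u.
    by st_eq.
  by apply: execs_le H3 _; rewrite /sz -/u; lia.
case Ef: (enc (f a)) => [|t1 t2]; rewrite addn1.
- apply: execs_caseS; first by rewrite updE.
  apply: (@execs_le _ _ ((2 * sz a + 1) + (2 * sz a + 1) + (sz a).+2 ^ cg)); last by lia.
  apply: execs_seq; first by apply: Hback; rewrite !(updE, updN) //; lia.
  set st1 := upd _ 0 u; have -> : st1 = st by rewrite /st1; st_eq.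
  by apply: Hg => // i ik; apply: Ek; rewrite /K; lia.
- have pa := Hp a; rewrite /sz Ef /= in pa.
  apply: execs_caseS; first by rewrite updE.
  apply: (@execs_le _ _ ((2 * size (ser t1 ++ ser t2)).+1 + ((2 * sz a + 1) + (2 * sz a + 1)
    + (sz a).+2 ^ ch))); last by rewrite /sz; lia.
  apply: execs_seq; first by apply: execs_clear; rewrite updE.
  apply: execs_seq; first by apply: Hback; rewrite !(updE, updN) //; lia.
  set st1 := upd _ 0 u; have -> : st1 = st by rewrite /st1; st_eq.
  by apply: Hh => // i ik; apply: Ek; rewrite /K; lia.
Qed.

(** The list in register [K] drives the loop by its own constructors: a popped [true] announces an
    element, while the final [false] runs [Skip] and leaves the register empty. With the element on
    top of the accumulator, pushing [true] serializes the pair [(x, a)], whence the argument order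
    of [h]. *)
Lemma execs_fold A X `{Enc A} `{Enc X} (h : X * A -> A) Ph kh ch K Bx M (l : seq X) a st :
  computes Ph kh ch h -> kh <= K -> 2 < K ->
  st 0 = ser (enc a) -> st K = ser (enc l) ->
  (forall i, 0 < i < K -> st i = [::]) -> st K.+1 = [::] -> st K.+2 = [::] ->
  (forall n, sz (foldl (fun a x => h (x, a)) a (take n l)) <= M) ->
  sz l <= Bx ->
  execs (Loop K Skip (Seq (tsplit K K.+1 K.+2) (Seq (mv K.+1 0) (Seq (Push 0 true) Ph))))
    st (size l * (7 * Bx + 5 + (Bx + M).+3 ^ ch) + 3)
    (upd (upd st 0 (ser (enc (foldl (fun a x => h (x, a)) a l)))) K [::]).
Proof.
move=> Hh kK K3; elim: l a st => [|x l IH] a st E0 EK Ei E1 E2 HM HB.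
  have -> : upd (upd st 0 (ser (enc (foldl (fun a x => h (x, a)) a [::])))) K [::]
    = upd st K [::] by st_eq.
  apply: (@execs_le _ _ (1 + 1).+1) => //.
  apply: (@execs_loopS _ _ _ _ false [::]) => //; first exact: execs_skip.
  by apply: execs_loop0; rewrite updE.
set c := 7 * Bx + 5 + _; rewrite sz_cons in HB.
have [K1 K2 K4 K5] : [/\ K != K.+1, 0 != K.+1, K != K.+2 & K.+1 != K.+2] by split; lia.
have [K6 K7 K8 K9] : [/\ K.+1 != K, 0 != K, K.+2 != K & K.+2 != K.+1] by split; lia.
apply: (@execs_le _ _ (c.-1 + (size l * c + 3)).+1); last by rewrite /= mulSn {2}/c /c; move: (size l * _) => y; lia.
apply: (@execs_loopS _ _ _ _ true (ser (enc x) ++ ser (enc l))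
   _ (upd (upd st 0 (ser (enc (h (x, a))))) K (ser (enc l)))) => //.
  apply: (@execs_le _ _ ((5 * sz x + 2) + ((2 * sz x).+1 + (1 + (sz (x, a)).+2 ^ ch)))); last first.
    have : (sz (x, a)).+2 ^ ch <= (Bx + M).+3 ^ ch.
      by apply: leq_expl; have := HM 0; rewrite take0 sz_pair /= => HH; lia.
    by rewrite /c => HH; lia.
  apply: execs_seq.
    by apply: execs_tsplit; rewrite ?updE ?updN.
  apply: execs_seq.
    have := @execs_mv K.+1 0; set s1 := upd _ K.+1 _ => /(_ s1 (rev (ser (enc x)))).
    rewrite size_rev; apply => //.
    by rewrite /s1 !(updE, updN) ?E1.
  apply: execs_seq; first exact: execs_push.
  set s1 := upd _ 0 (true :: _).
  have Es1 : s1 = upd (upd st 0 (ser (enc (x, a)))) K (ser (enc l)).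
    by rewrite /s1 !(updE, updN) // E0 !catrevE E1 cats0 revK; st_eq.
  have I1 : s1 0 = ser (enc (x, a)) by rewrite Es1 updN // updE.
  have I2 i : 0 < i < K -> s1 i = [::].
    by move=> ik; rewrite Es1 !updN ?Ei //; lia.
  have -> : upd (upd st 0 (ser (enc (h (x, a))))) K (ser (enc l)) =
     upd s1 0 (ser (enc (h (x, a)))).
    by rewrite Es1; st_eq.
  exact: (computes_weak Hh kK I1 I2).
set s1 := upd _ K _.
have -> : upd (upd st 0 (ser (enc (foldl (fun a x => h (x, a)) a (x :: l))))) K [::]
   = upd (upd s1 0 (ser (enc (foldl (fun a x => h (x, a)) (h (x, a)) l)))) K [::].
  by rewrite /s1; st_eq.
apply: IH; rewrite ?/s1 ?updE //; try by rewrite !updN //.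
- by rewrite updN // updE.
- by move=> i ik; rewrite !updN ?Ei //; lia.
- by move=> n; have := HM n.+1.
- by lia.
Qed.

Lemma sz_size X `{Enc X} (l : seq X) : size l <= sz l.
Proof. by elim: l => // x l IH; rewrite sz_cons /=; lia. Qed.

Lemma PT_fold E A X `{Enc E} `{Enc A} `{Enc X} (h : X * A -> A) (G : E -> A * seq X) :
  PT h -> PT G ->
  (exists2 p, pbound p &
    forall e n, sz (foldl (fun a x => h (x, a)) (G e).1 (take n (G e).2)) <= p (sz e)) ->
  PT (fun e => foldl (fun a x => h (x, a)) (G e).1 (G e).2).
Proof.
move=> [Ph [kh [ch Hh]]] HG [q qq Hq]; have [p pp Hp] := PT_size HG.
case: HG => [Pg [kg [cg Hg]]].
pose K := maxn 3 (maxn kh kg).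
pose body := Seq (tsplit K K.+1 K.+2) (Seq (mv K.+1 0) (Seq (Push 0 true) Ph)).
apply: (@PT_intro (Seq Pg (Case 0 Skip Skip (Seq (tsplit 0 1 2) (Seq (mv 0 K.+1)
   (Seq (mv K.+1 K) (Seq (mv 1 0) (Loop K Skip body))))))) K.+3
  (fun n => n.+2 ^ cg + (5 * p n + 2 + (2 * p n + 1 + (2 * p n + 1 + (2 * p n + 1 +
     (p n * (7 * p n + 5 + (p n + q n + 1).+2 ^ ch) + 3)))) + 1))).
  by pb; apply: pbound_id.
move=> e st E0 Ek.
have [K1 K2 K4 K5] : [/\ K != K.+1, 0 != K.+1, K != K.+2 & K.+1 != K.+2] by split; lia.
have [K6 K7 K8 K9] : [/\ K.+1 != K, 0 != K, K.+2 != K & K.+2 != K.+1] by split; lia.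
have [L1 L2 L3 L4] : [/\ 1 != K, 1 != K.+1, K != 1 & K.+1 != 1] by split; lia.
have EK : st K = [::] by apply: Ek; lia.
have EK1 : st K.+1 = [::] by apply: Ek; lia.
have EK2 : st K.+2 = [::] by apply: Ek; lia.
have E1 : st 1 = [::] by apply: Ek; lia.
have E2 : st 2 = [::] by apply: Ek; lia.
apply: execs_seq.
  apply: Hg => // i ik; apply: Ek; lia.
have := Hp e; case EG : (G e) (Hq e) => [a l] /= Hal; rewrite sz_pair /= => Hpe.
rewrite addn1; apply: (@execs_caseS _ _ _ _ _ true (ser (enc a) ++ ser (enc l))).
  by rewrite updE.
apply: execs_seq.
  apply: execs_le (execs_tsplit _ _ _ _ _) _ => //; rewrite ?updE ?updN //.
  by rewrite -/(sz a); lia.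
apply: execs_seq.
  apply: execs_le (execs_mv (s := ser (enc l)) _ _) _ => //.
  by rewrite -/(sz l); lia.
apply: execs_seq.
  apply: execs_le (execs_mv (s := rev (ser (enc l))) _ _) _ => //.
    by rewrite !(updE, updN) // EK1.
  by rewrite size_rev -/(sz l); lia.
apply: execs_seq.
  apply: execs_le (execs_mv (s := rev (ser (enc a))) _ _) _ => //.
    by rewrite !(updE, updN) // E1.
  by rewrite size_rev -/(sz a); lia.
set s1 := upd _ 0 _.
have {s1}-> : s1 = upd (upd st K (ser (enc l))) 0 (ser (enc a)).
  rewrite /s1 !(updE, updN) // !catrevE EK1 E1 EK !cats0 ?revK.
  by st_eq.
have -> : upd st 0 (ser (enc (foldl (fun a x => h (x, a)) a l))) =
  upd (upd (upd (upd st K (ser (enc l))) 0 (ser (enc a))) 0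
   (ser (enc (foldl (fun a x => h (x, a)) a l)))) K [::] by st_eq.
apply: execs_le (execs_fold (Bx := p (sz e)) (M := q (sz e)) Hh _ _ _ _ _ _ _ Hal _) _.
all: rewrite ?(updE, updN) //; try lia.
- by move=> i ik; rewrite !updN ?Ek //; lia.
- by rewrite leq_add2r addn1; apply: leq_mul => //; apply: (leq_trans (sz_size l)); lia.
Qed.

(** * Polynomial-time functions on lists and binary numbers *)

Lemma PT_ext A B `{Enc A} `{Enc B} (f g : A -> B) : f =1 g -> PT f -> PT g.
Proof. by move=> fg; apply: (PT_recode (g := fun a => a)) => // a; rewrite fg. Qed.

Lemma PT_fst A B C `{Enc A} `{Enc B} `{Enc C} (f : A -> B * C) :
  PT f -> PT (fun a => (f a).1).
Proof.
move=> Hf; apply: (PT_comp (g := fun p => p.1)) Hf.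
exact: (PT_recode (g := fun p : B * C => enc p) _ _ PT_tfst).
Qed.

Lemma PT_snd A B C `{Enc A} `{Enc B} `{Enc C} (f : A -> B * C) :
  PT f -> PT (fun a => (f a).2).
Proof.
move=> Hf; apply: (PT_comp (g := fun p => p.2)) Hf.
exact: (PT_recode (g := fun p : B * C => enc p) _ _ PT_tsnd).
Qed.

Lemma PT_cons A B `{Enc A} `{Enc B} (f : A -> B) (s : A -> seq B) :
  PT f -> PT s -> PT (fun a => f a :: s a).
Proof.
move=> Hf Hs.
exact: (PT_recode (g := fun a => a) (h := fun a => (f a, s a)) _ _ (PT_pair Hf Hs)).
Qed.

Lemma PT_if A B `{Enc A} `{Enc B} (b : A -> bool) (f g : A -> B) :
  PT b -> PT f -> PT g -> PT (fun a => if b a then f a else g a).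
Proof.
move=> Hb Hf Hg.
apply: (@PT_ext _ _ _ _ (fun a => if is_leaf (enc (tfst (enc (b a)))) then g a else f a)).
  by move=> a; case: (b a).
apply: PT_ifleaf => //; apply: (PT_comp (g := tfst)); first exact: PT_tfst.
by apply: (PT_recode (g := fun a => a) _ _ Hb).
Qed.

Ltac ptv1 := lazymatch goal with
  | |- PT (fun e => e) => apply: PT_id
  | |- PT (@fst _ _) => apply: (PT_fst (f := fun p => p))
  | |- PT (@snd _ _) => apply: (PT_snd (f := fun p => p))
  | |- PT (fun e => fst (@?f e)) => apply: PT_fst
  | |- PT (fun e => snd (@?f e)) => apply: PT_snd
  | |- PT (fun e => pair (@?f e) (@?g e)) => apply: PT_pair
  end.
Ltac ptv := repeat ptv1.

Lemma PT_nilp A X `{Enc A} `{Enc X} (s : A -> seq X) : PT s -> PT (fun a => nilp (s a)).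
Proof.
move=> Hs; apply: (@PT_ext _ _ _ _ (fun a => if is_leaf (enc (s a)) then true else false)).
  by move=> a; case: (s a).
by apply: PT_ifleaf => //; apply: PT_const.
Qed.

Lemma PT_behead A X `{Enc A} `{Enc X} (s : A -> seq X) : PT s -> PT (fun a => behead (s a)).
Proof.
move=> Hs; apply: (PT_comp (g := behead)) Hs.
by apply: (PT_recode (g := fun s : seq X => enc s) _ _ PT_tsnd) => //; case.
Qed.

Lemma PT_head A X `{Enc A} `{Enc X} (x0 : A -> X) (s : A -> seq X) :
  PT x0 -> PT s -> PT (fun a => head (x0 a) (s a)).
Proof.
move=> Hx Hs.
have Ht : PT (fun a => if nilp (s a) then enc (x0 a) else tfst (enc (s a))).
  apply: PT_if; first exact: PT_nilp.
    by apply: (PT_recode (g := fun a => a) _ _ Hx).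
  apply: (PT_comp (g := tfst)); first exact: PT_tfst.
  by apply: (PT_recode (g := fun a => a) _ _ Hs).
by apply: (PT_recode (g := fun a => a) _ _ Ht) => // a; case: (s a).
Qed.

Lemma PT_andb A `{Enc A} (f g : A -> bool) : PT f -> PT g -> PT (fun a => f a && g a).
Proof. by move=> Hf Hg; apply: PT_if => //; apply: PT_const. Qed.

Lemma PT_orb A `{Enc A} (f g : A -> bool) : PT f -> PT g -> PT (fun a => f a || g a).
Proof. by move=> Hf Hg; apply: PT_if => //; apply: PT_const. Qed.

Lemma PT_negb A `{Enc A} (f : A -> bool) : PT f -> PT (fun a => ~~ f a).
Proof. by move=> Hf; apply: PT_if => //; apply: PT_const. Qed.

Lemma PT_addb A `{Enc A} (f g : A -> bool) : PT f -> PT g -> PT (fun a => f a (+) g a).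
Proof.
move=> Hf Hg; apply: (@PT_ext _ _ _ _ (fun a => if f a then ~~ g a else g a)).
  by move=> a; case: (f a).
by apply: PT_if => //; apply: PT_negb.
Qed.

(** The environment [e] travels inside the accumulator, because the step function of [PT_fold] sees
    nothing else. *)
Lemma PT_foldl E A X `{Enc E} `{Enc A} `{Enc X} (h : E -> A -> X -> A) (i : E -> A)
    (s : E -> seq X) :
  PT (fun p : E * A * X => h p.1.1 p.1.2 p.2) -> PT i -> PT s ->
  (exists2 p, pbound p & forall e n, sz (foldl (h e) (i e) (take n (s e))) <= p (sz e)) ->
  PT (fun e => foldl (h e) (i e) (s e)).
Proof.
move=> Hh Hi Hs [p pp Hp].
pose h' (q : X * (E * A)) := (q.2.1, h q.2.1 q.2.2 q.1).
have Eh e a l : foldl (fun a x => h' (x, a)) (e, a) l = (e, foldl (h e) a l).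
  by elim: l a => //= x l IH a; rewrite IH.
apply: (@PT_ext _ _ _ _ (fun e =>
    (foldl (fun a x => h' (x, a)) ((e, i e), s e).1 ((e, i e), s e).2).2)).
  by move=> e; rewrite Eh.
apply: PT_snd; apply: (PT_fold (h := h') (G := fun e => ((e, i e), s e))).
- apply: PT_pair; first by apply: PT_fst; apply: PT_snd; apply: PT_id.
  apply: (PT_comp (g := fun p : E * A * X => h p.1.1 p.1.2 p.2)
    (f := fun q : X * (E * A) => ((q.2.1, q.2.2), q.1))) => //.
  by ptv.
- by apply: PT_pair => //; apply: PT_pair => //; apply: PT_id.
exists (fun n => n + p n + 1); first by pb; apply: pbound_id.
by move=> e n /=; rewrite Eh sz_pair /= addn1 ltnS leq_add2l.
Qed.

Lemma sz_take X `{Enc X} n (l : seq X) : sz (take n l) <= sz l.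
Proof.
elim: l n => [|x l IH] n //; case: n => [|n]; first by rewrite take0 sz_nil sz_gt0.
by rewrite take_cons !sz_cons ltnS leq_add2l.
Qed.

(** Increments bounded in terms of the environment and the element alone add up to a polynomial;
    growth by a constant factor at each turn would not. *)
Lemma PT_foldl_add E A X `{Enc E} `{Enc A} `{Enc X} (h : E -> A -> X -> A) (i : E -> A)
    (s : E -> seq X) :
  PT (fun p : E * A * X => h p.1.1 p.1.2 p.2) -> PT i -> PT s ->
  (exists2 q, pbound q & forall e a x, sz (h e a x) <= sz a + q (sz e + sz x)) ->
  PT (fun e => foldl (h e) (i e) (s e)).
Proof.
move=> Hh Hi Hs [q [c Hc] Hq]; apply: PT_foldl => //.
have [p1 pp1 Hp1] := PT_size Hi; have [p2 pp2 Hp2] := PT_size Hs.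
exists (fun n => p1 n + p2 n * (n + p2 n).+2 ^ c); first by pb; apply: pbound_id.
move=> e n; set l := take n (s e).
have Hl : sz l <= p2 (sz e) by apply: leq_trans (sz_take _ _) _.
clearbody l.
have key : forall a : A, sz (foldl (h e) a l) <= sz a + size l * (sz e + p2 (sz e)).+2 ^ c.
  elim: l Hl => [|x l IH] Hl a /=; first by rewrite leq_addr.
  rewrite sz_cons in Hl; apply: leq_trans (IH _ _) _; first by lia.
  rewrite mulSn addnA leq_add2r; apply: leq_trans (Hq _ _ _) _; rewrite leq_add2l.
  by apply: leq_trans (Hc _) _; apply: leq_expl; lia.
apply: leq_trans (key (i e)) _; apply: leq_add => //.
by rewrite leq_mul2r (leq_trans (sz_size l)) ?orbT.
Qed.

Lemma PT_rev A X `{Enc A} `{Enc X} (s : A -> seq X) : PT s -> PT (fun a => rev (s a)).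
Proof.
move=> Hs; apply: (@PT_ext _ _ _ _ (fun a => foldl (fun acc x => x :: acc) [::] (s a))).
  move=> a; rewrite /rev; elim: (s a) [::] => //=.
apply: (PT_foldl_add (h := fun _ acc x => x :: acc)) => //.
- by apply: PT_cons; ptv.
- exact: PT_const.
- exists (fun n => n + 1); first by pb.
  by move=> e a x; rewrite sz_cons; lia.
Qed.

Lemma PT_foldr E A X `{Enc E} `{Enc A} `{Enc X} (h : E -> X -> A -> A) (i : E -> A)
    (s : E -> seq X) :
  PT (fun p : E * A * X => h p.1.1 p.2 p.1.2) -> PT i -> PT s ->
  (exists2 q, pbound q & forall e a x, sz (h e x a) <= sz a + q (sz e + sz x)) ->
  PT (fun e => foldr (h e) (i e) (s e)).
Proof.
move=> Hh Hi Hs Hq.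
apply: (@PT_ext _ _ _ _ (fun e => foldl (fun a x => h e x a) (i e) (rev (s e)))).
  by move=> e; rewrite foldl_rev.
by apply: (PT_foldl_add (h := fun e a x => h e x a)) => //; apply: PT_rev.
Qed.

Lemma PT_size2 A B C `{Enc A} `{Enc B} `{Enc C} (h : A -> B -> C) :
  PT (fun p : A * B => h p.1 p.2) ->
  exists2 q, pbound q & forall a b, sz (h a b) <= q (sz a + sz b).
Proof.
move=> Hh; have [p [c Hc] Hp] := PT_size Hh.
exists (fun n => (n + 1).+2 ^ c); first by pb; apply: pbound_id.
move=> a b; apply: leq_trans (Hp (a, b)) _; apply: leq_trans (Hc _) _.
by rewrite sz_pair addn1.
Qed.

Lemma PT_map E X Y `{Enc E} `{Enc X} `{Enc Y} (f : E -> X -> Y) (s : E -> seq X) :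
  PT (fun p : E * X => f p.1 p.2) -> PT s -> PT (fun e => [seq f e x | x <- s e]).
Proof.
move=> Hf Hs; apply: (PT_foldr (h := fun e x a => f e x :: a)) => //.
- apply: PT_cons; last by ptv.
  apply: (PT_comp (g := fun p : E * X => f p.1 p.2)
     (f := fun p : E * seq Y * X => (p.1.1, p.2))) => //; ptv.
- exact: PT_const.
have [q qq Hq] := PT_size2 Hf; exists (fun n => q n + 1); first by pb.
by move=> e a x; rewrite sz_cons; have := Hq e x; lia.
Qed.

Lemma PT_filter E X `{Enc E} `{Enc X} (f : E -> X -> bool) (s : E -> seq X) :
  PT (fun p : E * X => f p.1 p.2) -> PT s -> PT (fun e => [seq x <- s e | f e x]).
Proof.
move=> Hf Hs; apply: (@PT_ext _ _ _ _ (fun e => foldr (fun x a => if f e x then x :: a else a) [::] (s e))).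
  by move=> e; elim: (s e) => //= x l <-.
apply: (PT_foldr (h := fun e x a => if f e x then x :: a else a)) => //.
- apply: PT_if; [|by apply: PT_cons; ptv|by ptv].
  apply: (PT_comp (g := fun p : E * X => f p.1 p.2)
     (f := fun p : E * seq X * X => (p.1.1, p.2))) => //; ptv.
- exact: PT_const.
exists (fun n => n + 1); first by pb.
by move=> e a x; case: (f e x); rewrite ?sz_cons; lia.
Qed.

Lemma PT_all E X `{Enc E} `{Enc X} (f : E -> X -> bool) (s : E -> seq X) :
  PT (fun p : E * X => f p.1 p.2) -> PT s -> PT (fun e => all (f e) (s e)).
Proof.
move=> Hf Hs; apply: (@PT_ext _ _ _ _ (fun e => nilp [seq x <- s e | ~~ f e x])).
  by move=> e; rewrite /nilp size_filter; elim: (s e) => //= x l <-; case: (f e x).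
by apply: PT_nilp; apply: (PT_filter (f := fun e x => ~~ f e x)) => //; apply: PT_negb.
Qed.

Lemma PT_cat E X `{Enc E} `{Enc X} (s t : E -> seq X) :
  PT s -> PT t -> PT (fun e => s e ++ t e).
Proof.
move=> Hs Ht; apply: (@PT_ext _ _ _ _ (fun e => foldr cons (t e) (s e))).
  by move=> e; elim: (s e) => //= x l ->.
apply: (PT_foldr (h := fun _ => cons)) => //; first by apply: PT_cons; ptv.
exists (fun n => n + 1); first by pb.
by move=> e a x; rewrite sz_cons; lia.
Qed.

Lemma sz_cat X `{Enc X} (s t : seq X) : (sz (s ++ t)).+1 = sz s + sz t.
Proof. by elim: s => [|x s IH]; rewrite ?sz_nil //= !sz_cons; lia. Qed.

Lemma PT_flatten E X `{Enc E} `{Enc X} (s : E -> seq (seq X)) :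
  PT s -> PT (fun e => flatten (s e)).
Proof.
move=> Hs; apply: (PT_foldr (h := fun _ => cat)) => //.
- by apply: PT_cat; ptv.
- exact: PT_const.
exists id; first exact: pbound_id.
by move=> e a x /=; rewrite -ltnS sz_cat; lia.
Qed.

(** * Arithmetic on little-endian binary numbers *)

Definition nbits (s : seq bool) : nat := foldr (fun (b : bool) n => b + n.*2) 0 s.

(** Computed bit lists may have zeros at the high end, whereas a number is encoded by its canonical
    list [bin]. *)
Definition trim (s : seq bool) : seq bool :=
  foldr (fun b a => if nilp a && ~~ b then [::] else b :: a) [::] s.

Lemma bits_fuel f g n : n <= f -> n <= g -> bits f n = bits g n.
Proof.
elim: f g n => [|f IH] [|g] [|n] //= nf ng.
by congr cons; apply: IH; lia.
Qed.

Lemma bin_rec n : bin n = if n == 0 then [::] else odd n :: bin n./2.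
Proof. by case: n => [|n] //=; congr cons; apply: bits_fuel; lia. Qed.

Lemma nbits_bin n : nbits (bin n) = n.
Proof.
have [k] := ubnP n; elim: k n => // k IH n nk; rewrite bin_rec.
case: eqP => [->//|n0]; rewrite /= IH; first exact: odd_double_half.
by lia.
Qed.

Lemma bin_nbits s : bin (nbits s) = trim s.
Proof.
elim: s => //= b s IH; rewrite bin_rec -IH.
have -> : nilp (bin (nbits s)) = (nbits s == 0).
  by rewrite bin_rec; case: eqP.
rewrite addn_eq0 eqb0 double_eq0 andbC.
case: ifP => // _; rewrite oddD odd_double addbF oddb; congr (_ :: bin _).
by rewrite halfD odd_double andbF doubleK; case: b.
Qed.

Lemma nbits_ltn s : nbits s < 2 ^ size s.
Proof. by elim: s => //= b s IH; rewrite expnS; case: b => /=; lia. Qed.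

Lemma ltn_bin n : n < 2 ^ size (bin n).
Proof. by rewrite -{1}(nbits_bin n) nbits_ltn. Qed.

Lemma size_bin n k : n < 2 ^ k -> size (bin n) <= k.
Proof.
elim: k n => [|k IH] n nk; rewrite bin_rec; case: eqP => // n0.
  by rewrite expn0 in nk; lia.
by rewrite /= ltnS IH //; rewrite expnS in nk; lia.
Qed.

Lemma nbits_cat s t : nbits (s ++ t) = nbits s + 2 ^ size s * nbits t.
Proof. by elim: s => [|b s IH] /=; rewrite ?mul1n // IH expnS; lia. Qed.

Lemma nbits_rcons s b : nbits (rcons s b) = nbits s + 2 ^ size s * b.
Proof. by rewrite -cats1 nbits_cat /= addn0. Qed.

Lemma nbits_head s : nbits s = head false s + (nbits (behead s)).*2.
Proof. by case: s. Qed.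

#[global] Instance enc_nat_bin : Enc nat := fun n => enc (bin n).

Lemma sz_bool (b : bool) : sz b = 5. Proof. by case: b. Qed.

Lemma sz_bits (s : seq bool) : sz s = 6 * size s + 1.
Proof. by elim: s => [|b s IH]; rewrite ?sz_nil // sz_cons sz_bool IH /=; lia. Qed.

Lemma sz_nat (n : nat) : sz n = 6 * size (bin n) + 1.
Proof. exact: sz_bits. Qed.

Lemma PT_bin A `{Enc A} (f : A -> nat) : PT f -> PT (fun a => bin (f a)).
Proof. by move=> Hf; apply: (PT_recode (g := fun a => a) _ _ Hf). Qed.

Lemma PT_nbits A `{Enc A} (f : A -> seq bool) : PT f -> PT (fun a => nbits (f a)).
Proof.
move=> Hf.
have Ht : PT (fun a => trim (f a)).
  apply: (PT_foldr (h := fun _ b a => if nilp a && ~~ b then [::] else b :: a)) => //.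
  - apply: PT_if; first by apply: PT_andb; [apply: PT_nilp|apply: PT_negb]; ptv.
      exact: PT_const.
    by apply: PT_cons; ptv.
  - exact: PT_const.
  exists (fun n => n + 1); first by pb.
  by move=> e a x; case: ifP => _; rewrite ?sz_cons ?sz_nil; lia.
apply: (PT_recode (g := fun a => a) _ _ Ht) => // a.
by rewrite /enc /enc_nat_bin bin_nbits.
Qed.

(* Addition and subtraction differ only in [carry]. *)
Definition digit_step (carry : bool -> bool -> bool -> bool)
    (z : bool * (seq bool * (seq bool * seq bool))) (_ : bool) :=
  let: (c, (a, (b, out))) := z in
  (carry (head false a) (head false b) c,
   (behead a, (behead b, (head false a (+) head false b (+) c) :: out))).

(** The clock has [size a + size b + 1] ticks, enough to exhaust both numbers and the last carry. *)
Definition digits carry (a b : seq bool) :=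
  foldl (digit_step carry) (false, (a, (b, [::]))) (false :: a ++ b).

Lemma sz_behead X `{Enc X} (s : seq X) : sz (behead s) <= sz s.
Proof. by case: s => [|x s] //; rewrite sz_cons /=; lia. Qed.

Lemma PT_digits A `{Enc A} carry (a b : A -> seq bool) :
  PT a -> PT b -> PT (fun e => digits carry (a e) (b e)).
Proof.
move=> Ha Hb; apply: (PT_foldl_add (h := fun _ => digit_step carry)).
- apply: (@PT_ext _ _ _ _ (fun p => 
    let z := p.1.2 in
    (if head false z.2.1 then
       if head false z.2.2.1 then if z.1 then carry true true true else carry true true false
       else if z.1 then carry true false true else carry true false false
     else if head false z.2.2.1 then if z.1 then carry false true true else carry false true false
       else if z.1 then carry false false true else carry false false false,
     (behead z.2.1, (behead z.2.2.1, (head false z.2.1 (+) head false z.2.2.1 (+) z.1) :: z.2.2.2))))).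
    move=> [[e [c [u [v out]]]] x] /=.
    by case: (head false u); case: (head false v); case: c.
  cbv zeta; repeat first [ptv1 | apply: PT_if | apply: PT_cons | apply: PT_behead | apply: PT_head
    | apply: PT_const | apply: PT_addb].
- by ptv; try assumption; apply: PT_const.
- by apply: PT_cons; [apply: PT_const|apply: PT_cat].
exists (fun n => n + 6); first by pb.
move=> e [c [u [v out]]] x /=; rewrite !sz_pair /= !sz_bool sz_cons sz_bool.
apply: (@leq_trans (5 + (sz u + (sz v + (5 + sz out).+1).+1).+1).+1); last by lia.
by rewrite !(ltnS, leq_add2l) leq_add ?sz_behead // !(ltnS, leq_add2l) leq_add ?sz_behead.
Qed.

Lemma add_inv (clock a b out : seq bool) c :
  let: (c', (a', (b', out'))) :=
    foldl (digit_step (fun x y c => if x then y || c else y && c)) (c, (a, (b, out))) clock in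
  [/\ nbits (rev out') + 2 ^ size out' * (c' + nbits a' + nbits b') =
     nbits (rev out) + 2 ^ size out * (c + nbits a + nbits b),
   size out' = size clock + size out, a' = drop (size clock) a & b' = drop (size clock) b].
Proof.
elim: clock c a b out => [|x clock IH] c a b out; first by rewrite /= !drop0.
rewrite [foldl _ _ _]/=; set cc := if _ then _ else _; set o := _ (+) _.
have := IH cc (behead a) (behead b) (o :: out).
case: (foldl _ _ _) => c' [a' [b' out']] [-> -> -> ->]; split.
- rewrite rev_cons nbits_rcons size_rev (nbits_head a) (nbits_head b) /=.
  rewrite expnS /cc /o; move: (2 ^ size out) => u {IH cc o}.
  by case: (head false a); case: (head false b); case: c => /=; nia.
- by rewrite /= addnS.
- by rewrite -drop1 drop_drop addn1.
- by rewrite -drop1 drop_drop addn1.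
Qed.

Lemma PT_addn A `{Enc A} (f g : A -> nat) : PT f -> PT g -> PT (fun a => f a + g a).
Proof.
move=> Hf Hg.
pose cy x y c := if x then y || c else y && c.
apply: (@PT_ext _ _ _ _ (fun e => nbits (rev (digits cy (bin (f e)) (bin (g e))).2.2.2))).
  move=> e; set a := bin _; set b := bin _.
  have := add_inv (false :: a ++ b) a b [::] false; rewrite -/(digits cy a b).
  case: (digits cy a b) => c' [a' [b' out']] /= [E1 E2 Ea Eb].
  rewrite size_cat in E2 Ea Eb; rewrite mul1n !nbits_bin in E1.
  rewrite drop_oversize in Ea; last by lia.
  rewrite drop_oversize in Eb; last by lia.
  (* A final carry would force the sum to be at least [2 ^ size out'], which the length of the clock
     excludes. *)
  move: E1; rewrite Ea Eb /= !addn0; case: c' => /=; last by rewrite muln0 addn0.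
  have := ltn_bin (f e); have := ltn_bin (g e); rewrite -/a -/b muln1 E2 addn0 expnS expnD.
  have : 0 < 2 ^ size a by rewrite expn_gt0.
  have : 0 < 2 ^ size b by rewrite expn_gt0.
  by move: (2 ^ _) (2 ^ _) => x y; nia.
by apply: PT_nbits; apply: PT_rev; do 3 apply: PT_snd; apply: PT_digits; apply: PT_bin.
Qed.

(** The subtrahend and the borrow are kept on the opposite side of each equation, which avoids
    truncated subtraction in the invariant. *)
Lemma sub_inv (clock a b out : seq bool) c :
  let: (c', (a', (b', out'))) :=
    foldl (digit_step (fun x y c => if x then y && c else y || c)) (c, (a, (b, out))) clock in
  [/\ nbits (rev out') + 2 ^ size out' * nbits a' + 2 ^ size out * (c + nbits b) =
     nbits (rev out) + 2 ^ size out * nbits a + 2 ^ size out' * (c' + nbits b'),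
   size out' = size clock + size out, a' = drop (size clock) a & b' = drop (size clock) b].
Proof.
elim: clock c a b out => [|x clock IH] c a b out.
  by rewrite /= !drop0; split => //; lia.
rewrite [foldl _ _ _]/=; set cc := if _ then _ else _; set o := _ (+) _.
have := IH cc (behead a) (behead b) (o :: out).
case: (foldl _ _ _) => c' [a' [b' out']] [E1 E2 Ea Eb]; split.
- move: E1; rewrite rev_cons nbits_rcons size_rev (nbits_head a) (nbits_head b) /= expnS.
  rewrite /cc /o; move: (2 ^ size out) (2 ^ size out') => u v.
  case: (head false a); case: (head false b); case: c {IH cc o E2 Ea Eb} => /=; nia.
- by rewrite E2 /= addnS.
- by rewrite Ea -drop1 drop_drop addn1.
- by rewrite Eb -drop1 drop_drop addn1.
Qed.

Lemma PT_subn A `{Enc A} (f g : A -> nat) : PT f -> PT g -> PT (fun a => f a - g a).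
Proof.
move=> Hf Hg.
pose cy x y c := if x then y && c else y || c.
apply: (@PT_ext _ _ _ _ (fun e => if (digits cy (bin (f e)) (bin (g e))).1 then 0 else
   nbits (rev (digits cy (bin (f e)) (bin (g e))).2.2.2))).
  move=> e; set a := bin _; set b := bin _.
  have := sub_inv (false :: a ++ b) a b [::] false; rewrite -/(digits cy a b).
  case: (digits cy a b) => c' [a' [b' out']] /= [E1 E2 Ea Eb].
  rewrite size_cat in E2 Ea Eb; rewrite !mul1n !nbits_bin in E1.
  rewrite drop_oversize in Ea; last by lia.
  rewrite drop_oversize in Eb; last by lia.
  (* A final borrow means [f e < g e], where truncated subtraction gives 0. *)
  move: E1; rewrite Ea Eb /= !addn0 muln0; case: c' => /=; last by lia.
  by have := nbits_ltn (rev out'); rewrite size_rev; lia.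
have Hd : PT (fun e => digits cy (bin (f e)) (bin (g e))).
  by apply: PT_digits; apply: PT_bin.
apply: PT_if; [exact: PT_fst|exact: PT_const|].
by apply: PT_nbits; apply: PT_rev; do 3 apply: PT_snd.
Qed.

Lemma PT_eqn0 A `{Enc A} (f : A -> nat) : PT f -> PT (fun a => f a == 0).
Proof.
move=> Hf; apply: (@PT_ext _ _ _ _ (fun a => nilp (bin (f a)))).
  by move=> a; rewrite bin_rec; case: eqP.
by apply: PT_nilp; apply: PT_bin.
Qed.

Lemma PT_leq A `{Enc A} (f g : A -> nat) : PT f -> PT g -> PT (fun a => f a <= g a).
Proof. by move=> Hf Hg; apply: PT_eqn0; apply: PT_subn. Qed.

Lemma PT_ltn A `{Enc A} (f g : A -> nat) : PT f -> PT g -> PT (fun a => f a < g a).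
Proof.
move=> Hf Hg; apply: (@PT_ext _ _ _ _ (fun a => ~~ (g a <= f a))).
  by move=> a; rewrite ltnNge.
by apply: PT_negb; apply: PT_leq.
Qed.

Lemma PT_eqn A `{Enc A} (f g : A -> nat) : PT f -> PT g -> PT (fun a => f a == g a).
Proof.
move=> Hf Hg; apply: (@PT_ext _ _ _ _ (fun a => (f a <= g a) && (g a <= f a))).
  by move=> a; rewrite eqn_leq.
by apply: PT_andb; apply: PT_leq.
Qed.

Lemma PT_double A `{Enc A} (f : A -> nat) : PT f -> PT (fun a => (f a).*2).
Proof.
move=> Hf; apply: (@PT_ext _ _ _ _ (fun a => f a + f a)); first by move=> a; rewrite addnn.
exact: PT_addn.
Qed.

Lemma PT_half A `{Enc A} (f : A -> nat) : PT f -> PT (fun a => (f a)./2).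
Proof.
move=> Hf; apply: (@PT_ext _ _ _ _ (fun a => nbits (behead (bin (f a))))).
  move=> a; rewrite bin_rec; case: eqP => [->//|_] /=; exact: nbits_bin.
by apply: PT_nbits; apply: PT_behead; apply: PT_bin.
Qed.

Lemma size_bin_add m n : size (bin (m + n)) <= size (bin m) + size (bin n) + 1.
Proof.
apply: size_bin; have := ltn_bin m; have := ltn_bin n; rewrite !expnD expn1.
have : 0 < 2 ^ size (bin m) by rewrite expn_gt0.
have : 0 < 2 ^ size (bin n) by rewrite expn_gt0.
by move: (2 ^ _) (2 ^ _) => x y; nia.
Qed.

Lemma sz_add (m n : nat) : sz (m + n) <= sz m + sz n + 5.
Proof. by rewrite !sz_nat; have := size_bin_add m n; lia. Qed.

(** Horner's rule on the bits of [f a]: one turn adds at most one bit for the doubling and about the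
    size of [g a] for the addition. *)
Lemma PT_muln A `{Enc A} (f g : A -> nat) : PT f -> PT g -> PT (fun a => f a * g a).
Proof.
move=> Hf Hg.
apply: (@PT_ext _ _ _ _ (fun a =>
   foldr (fun b acc => acc.*2 + (if b then g a else 0)) 0 (bin (f a)))).
  move=> a; rewrite -{2}(nbits_bin (f a)); elim: (bin _) => //= b s ->.
  by case: b => /=; lia.
have [p pp Hp] := PT_size Hg.
apply: (PT_foldr (h := fun e (b : bool) acc => acc.*2 + (if b then g e else 0))) => //.
- apply: PT_addn; first by apply: PT_double; ptv.
  apply: PT_if; [by ptv| |exact: PT_const].
  by apply: (PT_comp (g := g)) => //; ptv.
- exact: PT_const.
case: pp => c Hc; exists (fun n => n.+2 ^ c + 12); first by pb; apply: pbound_id.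
move=> e a x; apply: leq_trans (sz_add _ _) _.
have H1 : sz a.*2 <= sz a + 6.
  rewrite !sz_nat; suff: size (bin a.*2) <= (size (bin a)).+1 by lia.
  by apply: size_bin; rewrite expnS; have := ltn_bin a; lia.
have H2 : sz (if x then g e else 0) <= (sz e + sz x).+2 ^ c + 1.
  case: x => /=; last by rewrite sz_nat /=; lia.
  apply: leq_trans (Hp e) _; apply: leq_trans (Hc _) _.
  by apply: leq_trans (leq_addr 1 _); apply: leq_expl; lia.
by lia.
Qed.

(** * From functions to languages *)

Definition sym_bits (s : sym) : bool * bool :=
  (if s is S1 then true else false, if s is Sep then true else false).

#[global] Instance enc_sym : Enc sym := fun s => enc (sym_bits s).

Definition read_sym (p : bool * bool) : cmd := pushes 2 (true :: ser (enc p)).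
(** The last input symbol is on top of registers 0 and 1, so consing the symbols as they are popped
    rebuilds the word in its original order. *)
Definition reader : cmd :=
  Seq (Push 2 false) (Seq
    (Loop 0 (Case 1 Skip (read_sym (false, false)) (read_sym (false, true)))
            (Case 1 Skip (read_sym (true, false)) (read_sym (true, true))))
    (Seq (mv 2 3) (mv 3 0))).

Lemma execs_reader_loop (w v : seq sym) st :
  st 0 = rev [seq (sym_bits s).1 | s <- w] -> st 1 = rev [seq (sym_bits s).2 | s <- w] ->
  st 2 = ser (enc v) ->
  execs (Loop 0 (Case 1 Skip (read_sym (false, false)) (read_sym (false, true)))
            (Case 1 Skip (read_sym (true, false)) (read_sym (true, true))))
   st (20 * size w + 1) (upd (upd (upd st 0 [::]) 1 [::]) 2 (ser (enc (w ++ v)))).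
Proof.
elim/last_ind: w v st => [|w s IH] v st E0 E1 E2.
  rewrite (_ : upd _ _ _ = st); last by rewrite /= in E0 E1; st_eq.
  exact: execs_loop0.
rewrite map_rcons rev_rcons in E0; rewrite map_rcons rev_rcons in E1.
have [st1 Est1] : exists st1, st1 = upd (upd (upd st 0 (rev [seq (sym_bits s).1 | s <- w])) 1
   (rev [seq (sym_bits s).2 | s <- w])) 2 (ser (enc (s :: v))) by eexists.
apply: (@execs_le _ _ (15 + (20 * size w + 1)).+1); last by rewrite size_rcons; lia.
apply: (@execs_loopS _ _ _ _ _ _ _ st1 _ _ E0).
  have Hp p : p = sym_bits s -> execs (read_sym p) (upd (upd st 0
      (rev [seq (sym_bits s).1 | s <- w])) 1 (rev [seq (sym_bits s).2 | s <- w])) 13 st1.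
    move=> ->; apply: (@execs_le _ _ (size (true :: ser (enc (sym_bits s)))).+1); last first.
      by case: (s).
    set st0 := upd _ 1 _.
    have -> : st1 = upd st0 2 ((true :: ser (enc (sym_bits s))) ++ st0 2).
      by rewrite Est1 /st0 !(updE, updN) // E2.
    exact: execs_pushes.
  by case: (s) E1 Hp => E1 Hp /=; apply: execs_caseS;
    rewrite ?updN ?E1 //; apply: execs_le (Hp _ _) _.
have -> : upd (upd (upd st 0 [::]) 1 [::]) 2 (ser (enc (rcons w s ++ v))) =
    upd (upd (upd st1 0 [::]) 1 [::]) 2 (ser (enc (w ++ s :: v))).
  by rewrite cat_rcons Est1; st_eq.
by apply: IH; rewrite Est1 !(updE, updN).
Qed.

Lemma execs_reader (w : seq sym) :
  execs reader (load w) (100 * size w + 20) (upd (fun _ => [::]) 0 (ser (enc w))).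
Proof.
have Ez : sz w <= 12 * size w + 1.
  elim: w => [|s w IH] //; rewrite sz_cons /=.
  have Hs : sz s <= 11 by case: (s).
  by lia.
apply: (@execs_le _ _ (1 + (20 * size w + 1 + ((2 * sz w).+1 + (2 * sz w).+1)))); last by lia.
apply: execs_seq; first exact: execs_push.
apply: execs_seq.
  by apply: (@execs_reader_loop w [::]); rewrite ?updE ?updN //.
rewrite cats0; set st := upd _ 2 (ser _).
apply: execs_seq.
  by apply: execs_mv => //; rewrite /st updE.
set u := ser _; have := @execs_mv 3 0 (upd (upd st 2 [::]) 3 (rev u)) (rev u).
rewrite updE size_rev => /(_ erefl isT) H.
have E3 : catrev u (st 3) = rev u by rewrite /st !updN //.
have -> : upd (fun=> [::]) 0 u = upd (upd (upd (upd st 2 [::]) 3 (rev u)) 3 [::]) 0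
    (catrev (rev u) (upd (upd st 2 [::]) 3 (rev u) 0)).
  rewrite !updN // catrevE revK /st !(updE, updN) // cats0 /load.
  by st_eq; do 2 case: ifP => [/eqP ?|_] //; congruence.
by rewrite -E3 in H *.
Qed.

Lemma PT_decide (d : seq sym -> bool) : PT d ->
  exists M c, forall w T, (size w).+2 ^ c <= T ->
    halted (run M T w) /\ (cq (run M T w) = tm_acc M <-> d w).
Proof.
move=> Hd; have [p pp Hp] := PT_size Hd; case: Hd => [P [k [c Hd]]].
(* The first bit of a serialized Boolean is the root node and the second one is its value; the
   machine accepts when register 1 is nonempty. *)
pose fin := Case 0 Skip Skip (Case 0 Skip Skip (Push 1 true)).
pose C := Seq reader (Seq P fin).
have [c' Hc'] : pbound (fun n => ((100 * n + 20) + ((12 * n + 1).+2 ^ c + 3) + n + 3) ^ 3).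
  by apply: pbound_exp; pb; apply: pbound_id.
exists (simTM C), c' => w T HT.
have Ez : sz w <= 12 * size w + 1.
  elim: (w) => [|s w' IH] //; rewrite sz_cons /=.
  have Hs : sz s <= 11 by case: (s).
  by lia.
have [st' [n nB E] E'] : exists2 st', execs C (load w)
    ((100 * size w + 20) + ((12 * size w + 1).+2 ^ c + 3)) st' & (st' 1 != [::]) = d w.
  have Hfin st : st 0 = ser (enc (d w)) -> st 1 = [::] ->
      exists2 st', execs fin st 3 st' & (st' 1 != [::]) = d w.
    rewrite /fin; case: (d w) => E0 E1.
      exists (upd (upd (upd st 0 [:: true; false; false; false]) 0
         [:: false; false; false]) 1 [:: true]); last by rewrite updE.
      apply: (@execs_caseS _ _ _ _ _ _ _ 2 _ E0).
      apply: (@execs_caseS _ _ _ _ _ true [:: false; false; false] 1); first by rewrite updE.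
      by have := execs_push 1 true (upd (upd st 0 [:: true; false; false; false]) 0
         [:: false; false; false]); rewrite !updN // E1.
    exists (upd (upd st 0 [:: false; true; false; false]) 0 [:: true; false; false]).
      apply: (@execs_caseS _ _ _ _ _ _ _ 2 _ E0).
      apply: (@execs_caseS _ _ _ _ _ false [:: true; false; false] 1); first by rewrite updE.
      exact: execs_skip.
    by rewrite !updN // E1.
  have [|//|st' H1 H2] := Hfin (upd (upd (fun _ => [::]) 0 (ser (enc w))) 0 (ser (enc (d w)))).
    by rewrite updE.
  exists st' => //; apply: execs_seq; first exact: execs_reader.
  apply: execs_seq H1; apply: execs_le (Hd w _ _ _) _; first by rewrite updE.
    by case.
  by apply: leq_expl; lia.
have [T0 T0B HT0] := sim_run E.
have HTT : T0 <= T.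
  apply: leq_trans T0B _; apply: leq_trans HT; apply: leq_trans (Hc' _).
  by apply: leq_expl; lia.
rewrite /halted HT0 // E'; split; first by case: (d w).
by case: (d w).
Qed.

Lemma PT_InP (L : seq sym -> Prop) (d : seq sym -> bool) :
  PT d -> (forall w, d w <-> L w) -> InP L.
Proof.
move=> /PT_decide [M [c H]] HL; exists M, c => w.
by have [H1 H2] := H w _ (leqnn _); split => //; rewrite H2.
Qed.

Lemma PT_sym_bits A `{Enc A} (f : A -> sym) : PT f -> PT (fun a => sym_bits (f a)).
Proof. by move=> Hf; apply: (PT_recode (g := fun a => a) _ _ Hf). Qed.

(** Read from the right, the first separator met is the delimiter, as a certificate consists of bits
    only. The flag records that it has been passed. *)
Definition strip_step (a : bool * seq sym) (s : sym) : bool * seq sym :=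
  if a.1 then (true, s :: a.2) else ((sym_bits s).2, [::]).

Definition strip_cert (w : seq sym) : seq sym :=
  (foldl strip_step (false, [::]) (rev w)).2.

Lemma PT_strip_cert : PT strip_cert.
Proof.
apply: PT_snd; apply: (PT_foldl_add (h := fun _ => strip_step)).
- apply: PT_if; [by ptv| |].
    by apply: PT_pair; [exact: PT_const|apply: PT_cons; ptv].
  by apply: PT_pair; [apply: PT_snd; apply: PT_sym_bits; ptv|exact: PT_const].
- exact: PT_const.
- by apply: PT_rev; ptv.
exists (fun n => n + 1); first by pb.
move=> e [b a] s; rewrite /strip_step; case: b => /=; rewrite !sz_pair /= !sz_bool ?sz_cons; first by lia.
by rewrite sz_nil; have := sz_gt0 a; lia.
Qed.

Lemma strip_certE w y : strip_cert (w ++ Sep :: map bit y) = w.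
Proof.
rewrite /strip_cert rev_cat rev_cons -cats1 -catA foldl_cat.
have -> : foldl strip_step (false, [::]) (rev [seq bit i | i <- y]) = (false, [::]).
  elim/last_ind: y => // y b IH; rewrite map_rcons rev_rcons /= -{2}IH.
  by congr foldl; case: b.
rewrite [cat _ _]/= [foldl _ _ _]/= {1}/strip_step /=.
suff H a : (foldl strip_step (true, a) (rev w)).2 = w ++ a by rewrite H cats0.
elim/last_ind: w a => // w s IH a.
by rewrite rev_rcons /= IH cat_rcons.
Qed.

(** The verifier discards the certificate and decides by itself, so the empty certificate serves. *)
Lemma PT_InNP (L : seq sym -> Prop) (d : seq sym -> bool) :
  PT d -> (forall w, d w <-> L w) -> InNP L.
Proof.
move=> Hd HL.
have /PT_decide [M [c H]] : PT (fun w => d (strip_cert w)).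
  exact: PT_comp Hd PT_strip_cert.
(* The exponent is doubled because the delimiter lengthens the input:
   [size w + 3 <= (size w + 2) ^ 2]. *)
exists M, (2 * c) => w; rewrite -HL; split.
  move=> dw; exists [::]; split => //.
  apply/(proj2 (H (w ++ [:: Sep]) _ _)); last by rewrite (strip_certE w [::]).
  by rewrite size_cat /= addn1 expnM leq_expl // expnS expn1; nia.
(* The time [T] depends on [size w] only and may be too short for [PT_decide] on [w']; but an
   accepting configuration is stationary, so running longer changes nothing. *)
case=> y [_ Hy]; set w' := w ++ _ in Hy; set T := _ ^ _ in Hy.
have Hh : halted (run M T w') by rewrite /halted Hy eqxx.
have [_ H2] := H w' (T + (size w').+2 ^ c) (leq_addl _ _).
move: H2; rewrite strip_certE => <-.
by rewrite /run addnC iterD iter_halted.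
Qed.

(** * Dickson's lemma and local search *)

Lemma fin_bound (I : finType) (Q : I -> nat -> Prop) :
  (forall i m n, m <= n -> Q i m -> Q i n) -> (forall i, exists n, Q i n) ->
  exists n, forall i, Q i n.
Proof.
move=> mono /fin_all_exists [f Hf]; exists (\max_i f i) => i.
by apply: mono (Hf i); apply: leq_bigmax.
Qed.

(* The induction is on the set [J] of coordinates that are not constant on [P]. *)
Lemma dickson_rec (I : finType) n (J : {set I}) (P : (I -> nat) -> Prop) :
  #|J| <= n -> (forall p q i, P p -> P q -> i \notin J -> p i = q i) ->
  exists B, forall p, P p ->
    exists q, [/\ P q, forall i, q i <= p i & \sum_i q i <= B].
Proof.
elim: n J P => [|n IH] J P Jn HP.
all: have [[p0 Pp0]|nP] := classic (exists p, P p);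
  last by exists 0 => p Pp; case: nP; exists p.
  have J0 : J = set0 by apply/eqP; rewrite -cards_eq0 -leqn0.
  exists (\sum_i p0 i) => p Pp; exists p0; split => // i.
  by rewrite (HP p0 p i) // J0 inE.
(* A vector of [P] not above [p0] has some coordinate [i] with a value below [p0 i]. There are
   finitely many such slices of [P], and each has one varying coordinate fewer. *)
have /fin_bound [|B HB] : forall i : I, exists B, forall c p, c < p0 i -> i \in J ->
    P p -> p i = c -> exists q, [/\ P q, forall i, q i <= p i & \sum_i q i <= B].
- move=> i; have [iJ|iJ] := boolP (i \in J); last by exists 0.
  have /fin_bound [|B HB] : forall c : 'I_(p0 i), exists B, forall p, P p -> p i = c ->
      exists q, [/\ P q, forall i, q i <= p i & \sum_i q i <= B].
  + move=> c; have [||B HB] := IH (J :\ i) (fun p => P p /\ p i = c).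
    * by rewrite -ltnS (leq_trans _ Jn) // (cardsD1 i J) iJ.
    * move=> p q j [Pp pc] [Pq qc]; rewrite !inE negb_and negbK => /orP [/eqP ->|jJ].
        by rewrite pc qc.
      exact: HP.
    exists B => p Pp pc; have [|q [[Pq _] H1 H2]] := HB p; first by [].
    by exists q.
  + move=> c m m' mm H p Pp pc; have [q [H1 H2 H3]] := H p Pp pc.
    by exists q; split => //; apply: leq_trans mm.
  by exists B => c p ci _ Pp pc; apply: (HB (Ordinal ci)).
- move=> i m m' mm H c p ci iJ Pp pc; have [q [H1 H2 H3]] := H c p ci iJ Pp pc.
  by exists q; split => //; apply: leq_trans mm.
exists (maxn B (\sum_i p0 i)) => p Pp.
have [/forallP le|] := boolP [forall i, p0 i <= p i].
  by exists p0; split => //; rewrite leq_maxr.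
rewrite negb_forall => /existsP [i]; rewrite -ltnNge => lti.
have iJ : i \in J.
  by apply/negPn/negP => iJ; move: lti; rewrite (HP p p0 i) // ltnn.
have [q [H1 H2 H3]] := HB i (p i) p lti iJ Pp erefl.
by exists q; split => //; apply: leq_trans H3 (leq_maxl _ _).
Qed.

(** Finiteness of the set of minimal vectors, in the form of a uniform bound on the sum of their
    entries. *)
Lemma dickson (I : finType) (P : (I -> nat) -> Prop) :
  exists B, forall p, P p ->
    exists q, [/\ P q, forall i, q i <= p i & \sum_i q i <= B].
Proof. by apply: (@dickson_rec I #|I| setT) => [|p q i _ _]; rewrite ?cardsT ?inE. Qed.

Definition dist (m n : nat) := (m - n) + (n - m).

(* Convexity: [x'] and [y'] arise from [x] and [y] by opposite steps inside their segment. *)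
Lemma dist_segment b x y x' y' u v :
  u <= y - x -> v <= x - y -> x' + v = x + u -> y' + u = y + v ->
  dist x' b + dist y' b <= dist x b + dist y b.
Proof. rewrite /dist; lia. Qed.

(** Serves to deal out atoms among layers, and later to choose a subtable with prescribed row
    sums. *)
Lemma sum_pick (K : finType) (c : K -> nat) n : n <= \sum_k c k ->
  exists c' : K -> nat, (forall k, c' k <= c k) /\ \sum_k c' k = n.
Proof.
elim: n => [|n IH] nc; first by exists (fun _ => 0); rewrite big1.
have [c' [le E]] := IH (ltnW nc).
have [/existsP [k lt]|] := boolP [exists k, c' k < c k]; last first.
  rewrite negb_exists => /forallP ge; move: nc; rewrite -E ltnNge.
  by rewrite leq_sum // => k _; rewrite leqNgt ge.
exists (fun j => c' j + (j == k)); split.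
  by move=> j; case: eqP => [->|_]; rewrite ?addn1 ?addn0.
rewrite big_split /= E (bigD1 k) //= eqxx big1 ?addn0 ?addn1 // => j /negbTE->.
by [].
Qed.

Lemma sum_sub_parts (I : finType) (Q : pred I) (x y : I -> nat) :
  (\sum_(i | Q i) y i - \sum_(i | Q i) x i) + \sum_(i | Q i) (x i - y i) =
  (\sum_(i | Q i) x i - \sum_(i | Q i) y i) + \sum_(i | Q i) (y i - x i).
Proof.
have : \sum_(i | Q i) x i + \sum_(i | Q i) (y i - x i) =
  \sum_(i | Q i) y i + \sum_(i | Q i) (x i - y i).
  by rewrite -!big_split; apply: eq_bigr => i _ /=; lia.
by move=> *; lia.
Qed.

Section NFold.
Variables (L P : finType) (D : P -> L -> bool).

Definition coord : finType := ((L + P) * bool)%type.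

(* A vector with its positive ([true]) and negative ([false]) parts,
   together with those of its local row sums. *)
Definition local_ker (h : coord -> nat) := forall p,
  h (inr p, true) + \sum_(i | D p i) h (inl i, false) =
  h (inr p, false) + \sum_(i | D p i) h (inl i, true).

Definition conformal (h : coord -> nat) :=
  forall s, h (s, true) = 0 \/ h (s, false) = 0.

Definition local_nz (h : coord -> nat) := exists i b, 0 < h (inl i, b).

(** Conformality excludes equal nonzero positive and negative parts of a row sum, which the kernel
    equations alone would allow. *)
Lemma local_ker_zero h : local_ker h -> conformal h -> ~ local_nz h -> forall s, h s = 0.
Proof.
move=> Hk Hc nz; have E i b : h (inl i, b) = 0.
  by apply/eqP; rewrite -leqn0 leqNgt; apply/negP => H; apply: nz; exists i, b.
case=> [[i|p] b] //; have := Hk p; rewrite !big1 // !addn0.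
by case: b; case: (Hc (inr p)) => H1 H2;
  first [exact: H1 | exact: etrans H2 H1 | exact: etrans (esym H2) H1].
Qed.

Lemma local_ker_sub h q : local_ker h -> local_ker q -> (forall s, q s <= h s) ->
  local_ker (fun s => h s - q s).
Proof.
move=> Hh Hq le p; have := Hh p; have := Hq p.
have E b : \sum_(i | D p i) (h (inl i, b) - q (inl i, b)) + \sum_(i | D p i) q (inl i, b) =
    \sum_(i | D p i) h (inl i, b).
  by rewrite -big_split; apply: eq_bigr => i _ /=; rewrite subnK.
have := E true; have := E false; have := le (inr p, true); have := le (inr p, false).
by move=> /= *; lia.
Qed.

Lemma sum_coord (F : coord -> nat) :
  \sum_i (F (inl i, true) + F (inl i, false)) <= \sum_s F s.
Proof.
have -> : \sum_s F s = \sum_u \sum_b F (u, b).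
  by rewrite pair_bigA; apply: eq_bigr => -[].
rewrite big_sumType /=; apply: leq_trans (leq_addr _ _).
by apply: leq_sum => i _; rewrite big_bool.
Qed.

Lemma shift_row (a a' u v f t : nat) : a' + f = a + t -> u + f = v + t -> a' + v = a + u.
Proof. lia. Qed.

Section Decompose.
Variable B : nat.
Hypothesis HB : forall p, local_ker p /\ local_nz p ->
  exists q, [/\ local_ker q /\ local_nz q, forall i, q i <= p i & \sum_i q i <= B].

(** All vectors with entries at most [B], in the kernel or not: what counts is that this type is
    finite and common to all layers. *)
Definition atom : finType := {ffun coord -> 'I_B.+1}.
Definition atom_val (t : atom) (s : coord) : nat := t s.

(** Small kernel vectors below [h] are split off one at a time. The remainder stays in the kernel by
    linearity, and conformal because it lies below [h]. *)
Lemma atom_decomp h : local_ker h -> conformal h ->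
  exists c : atom -> nat, (forall s, h s = \sum_t c t * atom_val t s) /\
    (forall t, 0 < c t -> local_nz (atom_val t) /\ local_ker (atom_val t)).
Proof.
have [n] := ubnP (\sum_s h s); elim: n h => // n IH h hn Hk Hc.
have [nz|z] := classic (local_nz h); last first.
  exists (fun _ => 0); split => // s; rewrite big1 ?(local_ker_zero Hk Hc z) //.
have [q [[qk qnz] le qB]] := HB (conj Hk nz).
have qlt s : q s < B.+1.
  by rewrite ltnS (leq_trans _ qB) // (bigD1 s) //= leq_addr.
pose t0 : atom := [ffun s => Ordinal (qlt s)].
have Et s : atom_val t0 s = q s by rewrite /atom_val ffunE.
have [|||c [E Hc']] := IH (fun s => h s - q s).
- rewrite -ltnS; apply: leq_trans hn; rewrite ltnS; have [i [b qib]] := qnz.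
  rewrite (bigD1 (inl i, b)) //= [X in _ < X](bigD1 (inl i, b)) //=.
  rewrite -addSn leq_add //; last by apply: leq_sum => s _; apply: leq_subr.
  by rewrite ltn_subrL qib (leq_trans qib (le _)).
- exact: local_ker_sub.
- by move=> s; case: (Hc s) => ->; [left|right].
exists (fun t => c t + (t == t0)); split.
  move=> s; rewrite -(subnK (le s)) E -Et [in RHS](bigD1 t0) //= eqxx.
  rewrite [in LHS](bigD1 t0) //= mulnDl mul1n addnAC; congr (_ + _ + _).
  by apply: eq_bigr => t /negbTE ->; rewrite addn0.
move=> t; have [->|_] := eqVneq t t0; last by rewrite addn0; apply: Hc'.
move=> _; have -> : atom_val t0 = q by apply: functional_extensionality.
by [].
Qed.

End Decompose.
Definition violation (t : nat) (b : 'I_t -> P -> nat) (g : L -> nat) (x : 'I_t -> L -> nat) :=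
  \sum_k \sum_p dist (\sum_(i | D p i) x k i) (b k p) + \sum_i dist (\sum_k x k i) (g i).

Definition move_size (t : nat) (x y : 'I_t -> L -> nat) := \sum_k \sum_i dist (x k i) (y k i).

(** Row sums are recorded next to the entries because rows may be violated: a vector below
    [diff x y] in all these coordinates also keeps the row sums between those of [x] and [y], where
    convexity of the error applies. *)
Definition diff (x y : L -> nat) (s : coord) : nat :=
  match s with
  | (inl i, b) => if b then y i - x i else x i - y i
  | (inr p, b) => let X := \sum_(i | D p i) x i in let Y := \sum_(i | D p i) y i in
                  if b then Y - X else X - Y
  end.

Lemma diff_ker x y : local_ker (diff x y).
Proof.
by move=> p; apply: sum_sub_parts.
Qed.

Lemma diff_conformal x y : conformal (diff x y).
Proof. by case=> [i|p] /=; lia. Qed.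

(** [C] can be chosen before [t], since the coordinates in the second use of Dickson's lemma are
    only the atoms and the signed vertical sums. *)
Lemma local_search :
  exists C, forall t (b : 'I_t -> P -> nat) g (x y : 'I_t -> L -> nat),
    violation b g y < violation b g x ->
    exists x', move_size x x' <= C /\ violation b g x' < violation b g x.
Proof.
have [B1 HB1] := dickson (fun p => local_ker p /\ local_nz p).
pose T := atom B1.
pose global_ker (w : T + L * bool -> nat) := forall i,
  w (inr (i, true)) + \sum_a w (inl a) * atom_val a (inl i, false) =
  w (inr (i, false)) + \sum_a w (inl a) * atom_val a (inl i, true).
have [B2 HB2] := dickson (fun w => global_ker w /\ exists a, 0 < w (inl a)).
exists (B2 * (#|coord| * B1)) => t b g x y.
(* Induction on the distance from [x] to the better table [y]. *)
have [n] := ubnP (move_size x y); elim: n y => // n IH y yn Hxy.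
have dec k : exists c : T -> nat, (forall s, diff (x k) (y k) s = \sum_a c a * atom_val a s) /\
    (forall a, 0 < c a -> local_nz (atom_val a) /\ local_ker (atom_val a)).
  exact: (atom_decomp HB1 (@diff_ker (x k) (y k)) (@diff_conformal (x k) (y k))).
have {dec} [c Hc] := fin_all_exists dec.
(* Layers are forgotten: only the multiplicity of each atom over all layers remains, with the
   positive and negative parts of the change in each vertical sum. *)
pose w (s : T + L * bool) := match s with
  | inl a => \sum_k c k a
  | inr (i, b) => let X := \sum_k x k i in let Y := \sum_k y k i in
                  if b then Y - X else X - Y end.
have sum_c (i : L) (e : bool) :
    \sum_a w (inl a) * atom_val a (inl i, e) = \sum_k diff (x k) (y k) (inl i, e).
  under eq_bigr do rewrite big_distrl.
  by rewrite exchange_big; apply: eq_bigr => k _; rewrite (proj1 (Hc k)).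
have wk : global_ker w.
  by move=> i; rewrite !sum_c; apply: sum_sub_parts.
have wnz : exists a, 0 < w (inl a).
  have [//|nw] := classic (exists a, 0 < w (inl a)).
  have c0 k a : c k a = 0.
    apply/eqP; rewrite -leqn0 leqNgt; apply/negP => ca; apply: nw; exists a.
    by rewrite /w (bigD1 k) //= ltn_addr.
  have E : x = y.
    apply: functional_extensionality => k; apply: functional_extensionality => i.
    have := proj1 (Hc k) (inl i, true); have := proj1 (Hc k) (inl i, false).
    by rewrite !big1 => [/= | a _ | a _]; rewrite ?c0 //; lia.
  by rewrite E ltnn in Hxy.
have [w' [[wk' [a0 wa0]] wle wB]] := HB2 w (conj wk wnz).
(* The selected copies of an atom are dealt back to layers whose decompositions contain them. *)
have /fin_all_exists [c' Hc'] : forall a, exists f : 'I_t -> nat,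
    (forall k, f k <= c k a) /\ \sum_k f k = w' (inl a).
  by move=> a; apply: sum_pick; apply: (wle (inl a)).
pose al k s := \sum_a c' a k * atom_val a s.
have al_le k s : al k s <= diff (x k) (y k) s.
  rewrite (proj1 (Hc k)); apply: leq_sum => a _; rewrite leq_mul2r.
  by rewrite (proj1 (Hc' a)) orbT.
have al_ker k : local_ker (al k).
  move=> p.
  have E e : \sum_(i | D p i) al k (inl i, e) =
      \sum_a c' a k * \sum_(i | D p i) atom_val a (inl i, e).
    by rewrite exchange_big; apply: eq_bigr => a _; rewrite big_distrr.
  rewrite !E -!big_split; apply: eq_bigr => a _ /=; rewrite -!mulnDr.
  have [->//|ca] := posnP (c' a k); congr (_ * _).
  have [_] := proj2 (Hc k) a (leq_trans ca (proj1 (Hc' a) k)); exact.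
have sum_al (i : L) (e : bool) : \sum_k al k (inl i, e) = \sum_a w' (inl a) * atom_val a (inl i, e).
  rewrite exchange_big; apply: eq_bigr => a _.
  by rewrite -(proj2 (Hc' a)) big_distrl.
(* The selection is added to [x] and taken back from [y]. Both results stay nonnegative, as the
   selection lies below the signed parts of [y - x]. *)
pose x' k i := x k i + al k (inl i, true) - al k (inl i, false).
pose y' k i := y k i + al k (inl i, false) - al k (inl i, true).
have Ex k i : x' k i + al k (inl i, false) = x k i + al k (inl i, true).
  by have := al_le k (inl i, true); have := al_le k (inl i, false); rewrite /x' /=; lia.
have Ey k i : y' k i + al k (inl i, true) = y k i + al k (inl i, false).
  by have := al_le k (inl i, true); have := al_le k (inl i, false); rewrite /y' /=; lia.
have small : move_size x x' <= B2 * (#|coord| * B1).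
  apply: (@leq_trans (\sum_k \sum_s al k s)).
    apply: leq_sum => k _.
    apply: (@leq_trans (\sum_i (al k (inl i, true) + al k (inl i, false)))).
      apply: leq_sum => i _; have := Ex k i; rewrite /dist; lia.
    exact: sum_coord.
  apply: (@leq_trans (\sum_k \sum_a c' a k * (#|coord| * B1))).
    apply: leq_sum => k _; rewrite exchange_big; apply: leq_sum => a _.
    rewrite -big_distrr leq_mul2l; apply/orP; right.
    rewrite -sum_nat_const; apply: leq_sum => s _.
    by rewrite -ltnS; apply: ltn_ord.
  rewrite exchange_big; under eq_bigr => a _ do rewrite -big_distrl (proj2 (Hc' a)).
  rewrite -big_distrl leq_mul2r; apply/orP; right; apply: leq_trans wB.
  by rewrite big_sumType leq_addr.
have convex : violation b g x' + violation b g y' <= violation b g x + violation b g y.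
  rewrite /violation addnACA [leqRHS]addnACA -!big_split leq_add //.
    apply: leq_sum => k _; rewrite -!big_split; apply: leq_sum => p _.
    have E : \sum_(i | D p i) x' k i + \sum_(i | D p i) al k (inl i, false) =
        \sum_(i | D p i) x k i + \sum_(i | D p i) al k (inl i, true).
      by rewrite -!big_split; apply: eq_bigr => i _; apply: Ex.
    have E' : \sum_(i | D p i) y' k i + \sum_(i | D p i) al k (inl i, true) =
        \sum_(i | D p i) y k i + \sum_(i | D p i) al k (inl i, false).
      by rewrite -!big_split; apply: eq_bigr => i _; apply: Ey.
    apply: (dist_segment _ (al_le k (inr p, true)) (al_le k (inr p, false))).
      exact: shift_row E (al_ker k p).
    exact: shift_row E' (esym (al_ker k p)).
  apply: leq_sum => i _.
  have E : \sum_k x' k i + \sum_k al k (inl i, false) = \sum_k x k i + \sum_k al k (inl i, true).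
    by rewrite -!big_split; apply: eq_bigr => k _; apply: Ex.
  have E' : \sum_k y' k i + \sum_k al k (inl i, true) = \sum_k y k i + \sum_k al k (inl i, false).
    by rewrite -!big_split; apply: eq_bigr => k _; apply: Ey.
  rewrite !sum_al in E E'.
  apply: (dist_segment _ (wle (inr (i, true))) (wle (inr (i, false)))).
    exact: shift_row E (wk' i).
  exact: shift_row E' (esym (wk' i)).
have closer : move_size x y' < move_size x y.
  have -> : move_size x y = move_size x y' +
      \sum_k \sum_i (al k (inl i, true) + al k (inl i, false)).
    rewrite -big_split; apply: eq_bigr => k _; rewrite -big_split; apply: eq_bigr => i _.
    have := al_le k (inl i, true); have := al_le k (inl i, false); have := Ey k i.
    by rewrite /dist /=; lia.
  rewrite -addn1 leq_add2l.
  have [k ck] : exists k, 0 < c' a0 k.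
    apply: NNPP => nk; move: wa0; rewrite -(proj2 (Hc' a0)) big1 // => k _.
    by apply/eqP; rewrite -leqn0 leqNgt; apply/negP => H; apply: nk; exists k.
  have [[i [e ie]] _] := proj2 (Hc k) a0 (leq_trans ck (proj1 (Hc' a0) k)).
  have : 0 < al k (inl i, e) by rewrite /al (bigD1 a0) //= ltn_addr // muln_gt0 ck.
  by rewrite (bigD1 k) //= (bigD1 i) //=; case: (e); lia.
(* If [x'] does not improve on [x], convexity makes [y'] no worse than [y], and [y'] is closer to
   [x]. *)
have [|ge] := ltnP (violation b g x') (violation b g x); first by exists x'.
apply: (IH y'); first by lia.
by lia.
Qed.

End NFold.

(** * The scaling algorithm *)

Definition key := (nat * (nat * nat))%type.

(* In a row index 0 is a wildcard and [n.+1] stands for [n]. *)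
Definition wild (r c : nat) := (r == 0) || (r == c.+1).
Definition matches (r c : key) :=
  wild r.1 c.1 && (wild r.2.1 c.2.1 && wild r.2.2 c.2.2).

Definition key_eq (c d : key) := (c.1 == d.1) && ((c.2.1 == d.2.1) && (c.2.2 == d.2.2)).

Lemma key_eqE c d : key_eq c d = (c == d).
Proof. by []. Qed.

Definition rowsum (r : key) (x : seq (key * nat)) : nat :=
  foldr (fun cv s => if matches r cv.1 then s + cv.2 else s) 0 x.

Definition viol (A : seq (key * nat)) (x : seq (key * nat)) : nat :=
  foldr (fun rb s => s + dist (rowsum rb.1 x) rb.2) 0 A.

Definition map_val (f : nat -> nat) (x : seq (key * nat)) := [seq (cv.1, f cv.2) | cv <- x].

Definition bump_val (c : key) (u : bool) (x : seq (key * nat)) :=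
  [seq (cv.1, if key_eq cv.1 c then if u then cv.2 + 1 else cv.2 - 1 else cv.2) | cv <- x].

(** [x] is its own neighbour, so that balls increase with the radius. *)
Definition nbrs (x : seq (key * nat)) :=
  x :: flatten [seq [:: bump_val cv.1 true x; bump_val cv.1 false x] | cv <- x].

Fixpoint ball (C : nat) (x : seq (key * nat)) :=
  if C is C'.+1 then flatten [seq nbrs y | y <- ball C' x] else [:: x].

Definition improve C A x := head x [seq y <- ball C x | viol A y < viol A x].

(** A unary clock of length [size A * (size x + 2) + 1], one more than the bound on the excess of a
    doubled optimum; see [rescale_opt]. *)
Definition fuel (A x : seq (key * nat)) : seq bool :=
  false :: flatten [seq false :: false :: [seq false | _ <- x] | _ <- A].

Definition rescale C (A x : seq (key * nat)) :=
  foldl (fun y _ => improve C A y) (map_val double x) (fuel A x).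

(** The coarsest system comes first, so that [solve] refines as it goes; the length of [s] is the
    number of scales. *)
Definition levels X (A : seq (key * nat)) (s : seq X) :=
  (foldl (fun a _ => (map_val half a.1, a.1 :: a.2)) (A, [::]) s).2.

Definition solve X C (A : seq (key * nat)) (x0 : seq (key * nat)) (s : seq X) :=
  foldl (fun x B => rescale C B x) x0 (levels A s).

Lemma size_fuel A x : size (fuel A x) = (size A * (size x).+2).+1.
Proof.
rewrite /fuel /= size_flatten /shape -map_comp.
by elim: A => //= a A; rewrite size_map; lia.
Qed.

Definition opt A d := fun x : seq (key * nat) =>
  unzip1 x = d /\ forall y, unzip1 y = d -> viol A x <= viol A y.

Definition radius C A d := forall x y, unzip1 x = d -> unzip1 y = d ->
  viol A y < viol A x -> exists2 x', x' \in ball C x & viol A x' < viol A x.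

Lemma unzip1_map_val f x : unzip1 (map_val f x) = unzip1 x.
Proof. by rewrite /unzip1 -map_comp; apply: eq_map. Qed.

Lemma unzip1_bump_val c u x : unzip1 (bump_val c u x) = unzip1 x.
Proof. by rewrite /unzip1 -map_comp; apply: eq_map. Qed.

Lemma unzip1_nbrs x y : y \in nbrs x -> unzip1 y = unzip1 x.
Proof.
rewrite inE => /orP [/eqP -> //|/flattenP [s /mapP [cv _ ->]]].
by rewrite !inE => /orP [] /eqP ->; apply: unzip1_bump_val.
Qed.

Lemma unzip1_ball C x y : y \in ball C x -> unzip1 y = unzip1 x.
Proof.
elim: C y => [|C IH] y /=; first by rewrite inE => /eqP ->.
by move=> /flattenP [s /mapP [z /IH <- ->]] /unzip1_nbrs.
Qed.

Lemma improve_ball C A x :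
  improve C A x = x \/ improve C A x \in ball C x /\ viol A (improve C A x) < viol A x.
Proof.
rewrite /improve; case E: [seq _ <- _ | _] => [|y s] /=; [by left|right].
have : y \in [seq y <- ball C x | viol A y < viol A x] by rewrite E inE eqxx.
by rewrite mem_filter => /andP [].
Qed.

Lemma unzip1_improve C A x : unzip1 (improve C A x) = unzip1 x.
Proof. by case: (improve_ball C A x) => [->//|[/unzip1_ball]]. Qed.

Lemma improve_le C A x : viol A (improve C A x) <= viol A x.
Proof. by case: (improve_ball C A x) => [->//|[_ /ltnW]]. Qed.

Lemma improve_opt C A d x : radius C A d -> unzip1 x = d ->
  opt A d x \/ viol A (improve C A x) < viol A x.
Proof.
move=> HC Ex; have [[y Ey lt]|nlt] := classic (exists2 y, unzip1 y = d & viol A y < viol A x).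
  right; have [x' x'b lt'] := HC x y Ex Ey lt.
  have : x' \in [seq y <- ball C x | viol A y < viol A x] by rewrite mem_filter lt'.
  rewrite /improve; case E: [seq _ <- _ | _] => [|z s] //= _.
  have : z \in [seq y <- ball C x | viol A y < viol A x] by rewrite E inE eqxx.
  by rewrite mem_filter => /andP [].
left; split => // y Ey; rewrite leqNgt; apply/negP => lt; apply: nlt; by exists y.
Qed.

(** Violations are natural numbers, so each step short of the optimum gains at least one. *)
Lemma improve_iter X C A d x (s : seq X) : radius C A d -> unzip1 x = d ->
  let y := foldl (fun y _ => improve C A y) x s in
  unzip1 y = d /\ (opt A d y \/ viol A y + size s <= viol A x).
Proof.
move=> HC; elim: s x => [|a s IH] x Ex /=; first by split => //; right; rewrite addn0.
have Ei : unzip1 (improve C A x) = d by rewrite unzip1_improve.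
have [E [H|H]] := IH _ Ei; split => //; first by left.
have [[_ Ho]|lt] := improve_opt HC Ex; last by right; lia.
left; split => // z /Ho; apply: leq_trans; apply: leq_trans (improve_le C A x).
by apply: leq_trans H; rewrite leq_addr.
Qed.

Lemma rowsum_double r x : rowsum r (map_val double x) = (rowsum r x).*2.
Proof. by elim: x => //= cv x ->; case: ifP => //; rewrite doubleD. Qed.

Lemma rowsum_half r x :
  (rowsum r (map_val half x)).*2 <= rowsum r x <= (rowsum r (map_val half x)).*2 + size x.
Proof. by elim: x => //= cv x; case: ifP; lia. Qed.

Lemma viol_double A x : viol A (map_val double x) <= (viol (map_val half A) x).*2 + size A.
Proof. by elim: A => //= rb A; rewrite rowsum_double /dist; lia. Qed.

Lemma viol_half A x :
  (viol (map_val half A) (map_val half x)).*2 <= viol A x + size A * (size x).+1.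
Proof.
elim: A => //= rb A; have := rowsum_half rb.1 x; rewrite /dist mulSn.
by move: (size A * _) => z; lia.
Qed.

(** Doubling [x] costs at most [size A], and halving a competitor costs at most
    [size A * (size x + 1)]. Hence the doubled table exceeds any competitor by less than the number
    of descent steps, and a descent that gained one at every step would contradict this. *)
Lemma rescale_opt C A d x : radius C A d ->
  opt (map_val half A) d x -> opt A d (rescale C A x).
Proof.
move=> HC [Ex Hx].
have E2 : unzip1 (map_val double x) = d by rewrite unzip1_map_val.
have [Ey [//|Hy]] := improve_iter (fuel A x) HC E2.
exfalso; move: Ey Hy; rewrite -/(rescale C A x) size_fuel; set y := rescale C A x => Ey.
have := Hx (map_val half y); rewrite unzip1_map_val => /(_ Ey).
have := viol_double A x; have := viol_half A y.
have -> : size y = size x by rewrite -(size_map fst y) -(size_map fst x) -/(unzip1 _) Ey -Ex.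
rewrite !mulnS; move: (size A * _) => z; lia.
Qed.

Lemma levels_rec X (A : seq (key * nat)) (s : seq X) :
  levels A s = [seq iter i (map_val half) A | i <- rev (iota 0 (size s))].
Proof.
suff H n L : (foldl (fun a _ => (map_val half a.1, a.1 :: a.2))
    (iter n (map_val half) A, L) s).2 =
    [seq iter i (map_val half) A | i <- rev (iota n (size s))] ++ L.
  by rewrite /levels (H 0) cats0.
elim: s n L => //= a s IH n L; rewrite -iterS IH rev_cons map_rcons cat_rcons //.
Qed.

(** After [size s] halvings all right-hand sides vanish and the zero table is optimal; each scale
    hands optimality on to the next finer one. *)
Lemma solve_opt X C A d x0 (s : seq X) :
  (forall i, radius C (iter i (map_val half) A) d) ->
  unzip1 x0 = d -> (forall cv, cv \in x0 -> cv.2 = 0) ->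
  (forall rb, rb \in A -> rb.2 < 2 ^ size s) ->
  opt A d (solve C A x0 s).
Proof.
move=> HC Ex z0 HA; rewrite /solve levels_rec.
suff H n : n <= size s -> opt (iter (size s - n) (map_val half) A) d
   (foldl (fun x B => rescale C B x) x0
     [seq iter i (map_val half) A | i <- take n (rev (iota 0 (size s)))]).
  have := H _ (leqnn _); rewrite subnn take_oversize // size_rev size_iota //.
elim: n => [|n IH] ns.
  rewrite take0 subn0 /=; split => // y _.
  suff -> : viol (iter (size s) (map_val half) A) x0 = 0 by [].
  have r0 r : rowsum r x0 = 0.
    elim: (x0) z0 => //= cv x IHx z0; rewrite IHx => [|c cx]; last by apply: z0; rewrite inE cx orbT.
    by rewrite z0 ?inE ?eqxx // if_same.
  have HA' k : k <= size s -> forall rb, rb \in iter k (map_val half) A -> rb.2 < 2 ^ (size s - k).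
    elim: k => [|k IHk] ks; first by rewrite subn0.
    move=> rb /mapP [rb' /(IHk (ltnW ks)) H ->] /=.
    have : 2 ^ (size s - k) = 2 ^ (size s - k.+1) * 2 by rewrite -expnSr; congr (2 ^ _); lia.
    move=> E; rewrite E in H; move: H; move: (2 ^ _) (rb'.2) => u v; lia.
  have := HA' _ (leqnn _); rewrite subnn expn0; elim: (iter _ _ _) => //= rb B IHB HB.
  rewrite IHB => [|c cx]; last by apply: HB; rewrite inE cx orbT.
  by have := HB rb; rewrite inE eqxx r0 /dist => /(_ isT); rewrite ltnS leqn0 => /eqP ->.
have -> : take n.+1 (rev (iota 0 (size s))) = rcons (take n (rev (iota 0 (size s)))) (size s - n.+1).
  rewrite (take_nth 0) ?size_rev ?size_iota //; congr rcons.
  by rewrite nth_rev ?size_iota // nth_iota ?add0n //; lia.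
rewrite map_rcons foldl_rcons; apply: rescale_opt.
  exact: HC.
rewrite -iterS; have -> : (size s - n.+1).+1 = size s - n by lia.
exact: IH (ltnW ns).
Qed.

(** * Running time of the scaling algorithm *)

Ltac pt1 := lazymatch goal with
  | |- PT (fun _ => ?c) => apply: PT_const
  | |- PT (fun e => cons (@?f e) (@?s e)) => apply: PT_cons
  | |- PT (fun e => addn (@?f e) (@?s e)) => apply: PT_addn
  | |- PT (fun e => subn (@?f e) (@?s e)) => apply: PT_subn
  | |- PT (fun e => muln (@?f e) (@?s e)) => apply: PT_muln
  | |- PT (fun e => double (@?f e)) => apply: PT_double
  | |- PT (fun e => half (@?f e)) => apply: PT_half
  | |- PT (fun e => andb (@?f e) (@?s e)) => apply: PT_andb
  | |- PT (fun e => orb (@?f e) (@?s e)) => apply: PT_orb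
  | |- PT (fun e => negb (@?f e)) => apply: PT_negb
  | |- PT (fun e => S (@?f e) <= @?g e) => apply: PT_ltn
  | |- PT (fun e => leq (@?f e) (@?g e)) => apply: PT_leq
  | |- PT (fun e => (@?f e) == 0) => apply: PT_eqn0
  | |- PT (fun e => (@?f e) == (@?g e)) => apply: PT_eqn
  | |- PT (fun e => nilp (@?s e)) => apply: PT_nilp
  | |- PT (fun e => behead (@?s e)) => apply: PT_behead
  | |- PT (fun e => head (@?x e) (@?s e)) => apply: PT_head
  | |- PT (fun e => rev (@?s e)) => apply: PT_rev
  | |- PT (fun e => cat (@?s e) (@?t e)) => apply: PT_cat
  | |- PT (fun e => flatten (@?s e)) => apply: PT_flatten
  | |- PT (fun e => map (@?f e) (@?s e)) => apply: (PT_map (f := f)); cbv beta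
  | |- PT (fun e => filter (@?f e) (@?s e)) => apply: (PT_filter (f := f)); cbv beta
  | |- PT (fun e => all (@?f e) (@?s e)) => apply: (PT_all (f := f)); cbv beta
  | |- PT (fun e => if _ then _ else _) => apply: PT_if
  | H : PT ?g |- PT (fun e => ?g (@?f e)) => apply: (PT_comp (f := f) H)
  | _ => ptv1
  end.
Ltac pt := repeat pt1; try assumption.

Lemma PT_succ A `{Enc A} (f : A -> nat) : PT f -> PT (fun a => (f a).+1).
Proof.
move=> Hf; apply: (@PT_ext _ _ _ _ (fun a => f a + 1)) => [a|]; first by rewrite addn1.
by pt.
Qed.

Lemma PT_dist A `{Enc A} (f g : A -> nat) : PT f -> PT g -> PT (fun a => dist (f a) (g a)).
Proof. by move=> Hf Hg; rewrite /dist; pt. Qed.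

Lemma PT_wild A `{Enc A} (f g : A -> nat) : PT f -> PT g -> PT (fun a => wild (f a) (g a)).
Proof. by move=> Hf Hg; rewrite /wild; pt; apply: PT_succ. Qed.

Lemma PT_matches A `{Enc A} (f g : A -> key) :
  PT f -> PT g -> PT (fun a => matches (f a) (g a)).
Proof. by move=> Hf Hg; rewrite /matches; pt; apply: PT_wild; pt. Qed.

Lemma PT_key_eq A `{Enc A} (f g : A -> key) :
  PT f -> PT g -> PT (fun a => key_eq (f a) (g a)).
Proof. by move=> Hf Hg; rewrite /key_eq; pt. Qed.

Notation state := (seq (key * nat)).

Lemma PT_rowsum A `{Enc A} (r : A -> key) (x : A -> state) :
  PT r -> PT x -> PT (fun a => rowsum (r a) (x a)).
Proof.
move=> Hr Hx; apply: (PT_foldr (h := fun a cv s => if matches (r a) cv.1 then s + cv.2 else s)) => //.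
- by pt; apply: PT_matches; pt.
- exact: PT_const.
exists (fun n => n + 5); first by pb.
move=> e a x0; case: ifP => _; last by lia.
by apply: leq_trans (sz_add _ _) _; rewrite [sz x0]sz_pair; lia.
Qed.

Lemma PT_viol A `{Enc A} (B : A -> state) (x : A -> state) :
  PT B -> PT x -> PT (fun a => viol (B a) (x a)).
Proof.
move=> HB Hx.
have Hd : PT (fun p : A * (key * nat) => dist (rowsum p.2.1 (x p.1)) p.2.2).
  by apply: PT_dist; pt; apply: PT_rowsum; pt.
apply: (PT_foldr (h := fun a rb s => s + dist (rowsum rb.1 (x a)) rb.2)) => //.
- pt; apply: (PT_comp (f := fun p : A * nat * (key * nat) => (p.1.1, p.2)) Hd); pt.
- exact: PT_const.
have [q qq Hq] := PT_size2 (h := fun a (rb : key * nat) => dist (rowsum rb.1 (x a)) rb.2) Hd.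
exists (fun n => q n + 5); first by pb.
move=> e a x0; apply: leq_trans (sz_add _ _) _.
by have := Hq e x0; lia.
Qed.

Lemma PT_map_val A `{Enc A} f (x : A -> state) :
  PT f -> PT x -> PT (fun a => map_val f (x a)).
Proof. by move=> Hf Hx; rewrite /map_val; pt; apply: (PT_comp Hf); pt. Qed.

Lemma PT_bump_val A `{Enc A} (c : A -> key) u (x : A -> state) :
  PT c -> PT x -> PT (fun a => bump_val (c a) u (x a)).
Proof.
move=> Hc Hx; rewrite /bump_val; pt.
apply: PT_key_eq; pt.
Qed.

Lemma PT_nbrs A `{Enc A} (x : A -> state) : PT x -> PT (fun a => nbrs (x a)).
Proof.
move=> Hx; rewrite /nbrs; pt; apply: PT_bump_val; pt.
Qed.

(** The radius is a constant, so the recursion unfolds into a fixed number of polynomial-time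
    maps. *)
Lemma PT_ball A `{Enc A} C (x : A -> state) : PT x -> PT (fun a => ball C (x a)).
Proof. by move=> Hx; elim: C => [|C IH] /=; pt; apply: PT_nbrs; pt. Qed.

Lemma PT_improve A `{Enc A} C (B x : A -> state) :
  PT B -> PT x -> PT (fun a => improve C (B a) (x a)).
Proof.
move=> HB Hx; rewrite /improve; pt; last by apply: PT_ball.
all: by apply: PT_viol; pt.
Qed.

Lemma PT_fuel A `{Enc A} (B x : A -> state) :
  PT B -> PT x -> PT (fun a => fuel (B a) (x a)).
Proof. by move=> HB Hx; rewrite /fuel; pt. Qed.

(** The growth bound is required only under the invariant [I]. In the descent, an improvement adds
    boundedly many bits per entry, and the number of entries is what stays invariant. *)
Lemma PT_foldl_inv E A X `{Enc E} `{Enc A} `{Enc X} (I : E -> A -> Prop)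
    (h : E -> A -> X -> A) (i : E -> A) (s : E -> seq X) :
  PT (fun p : E * A * X => h p.1.1 p.1.2 p.2) -> PT i -> PT s ->
  (forall e, I e (i e)) -> (forall e a x, I e a -> I e (h e a x)) ->
  (exists2 q, pbound q & forall e a x, I e a -> sz (h e a x) <= sz a + q (sz e + sz x)) ->
  PT (fun e => foldl (h e) (i e) (s e)).
Proof.
move=> Hh Hi Hs I0 IS [q [c Hc] Hq]; apply: PT_foldl => //.
have [p1 pp1 Hp1] := PT_size Hi; have [p2 pp2 Hp2] := PT_size Hs.
exists (fun n => p1 n + p2 n * (n + p2 n).+2 ^ c); first by pb; apply: pbound_id.
move=> e n; set l := take n (s e).
have Hl : sz l <= p2 (sz e) by apply: leq_trans (sz_take _ _) _.
clearbody l.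
have key : forall a : A, I e a ->
    sz (foldl (h e) a l) <= sz a + size l * (sz e + p2 (sz e)).+2 ^ c.
  elim: l Hl => [|x l IH] Hl a Ia /=; first by rewrite leq_addr.
  rewrite sz_cons in Hl; apply: leq_trans (IH _ _ (IS _ _ _ Ia)) _; first by lia.
  rewrite mulSn addnA leq_add2r; apply: leq_trans (Hq _ _ _ Ia) _; rewrite leq_add2l.
  by apply: leq_trans (Hc _) _; apply: leq_expl; lia.
apply: leq_trans (key (i e) (I0 e)) _; apply: leq_add => //.
by rewrite leq_mul2r (leq_trans (sz_size l)) ?orbT.
Qed.

Lemma sz_map_val f (x : state) : (forall n : nat, sz (f n) <= sz n + 12) ->
  sz (map_val f x) <= sz x + size x * 12.
Proof.
move=> Hf; elim: x => [|[c v] x IH] //=; rewrite !sz_cons !sz_pair /=.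
by have := Hf v; lia.
Qed.

Lemma sz_bump_val c u (x : state) : sz (bump_val c u x) <= sz x + size x * 12.
Proof.
elim: x => [|[d v] x IH] //=; rewrite !sz_cons !sz_pair /= -/(bump_val c u x).
have Hv : sz (if key_eq d c then if u then v + 1 else v - 1 else v) <= sz v + 12; last by lia.
case: ifP => _; last by lia.
case: u {IH}; first by apply: leq_trans (sz_add _ _) _; rewrite [sz 1]sz_nat /=; lia.
rewrite !sz_nat; suff : size (bin (v - 1)) <= size (bin v) by lia.
by apply: size_bin; apply: leq_ltn_trans (ltn_bin v); rewrite leq_subr.
Qed.

Lemma sz_half (n : nat) : sz n./2 <= sz n.
Proof.
rewrite !sz_nat; suff : size (bin n./2) <= size (bin n) by lia.
by apply: size_bin; apply: leq_ltn_trans (ltn_bin n); lia.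
Qed.

Lemma sz_double (n : nat) : sz n.*2 <= sz n + 6.
Proof.
rewrite !sz_nat; suff : size (bin n.*2) <= (size (bin n)).+1 by lia.
by apply: size_bin; have := ltn_bin n; rewrite expnS; lia.
Qed.

Lemma sz_ball C (x y : state) : y \in ball C x ->
  sz y <= sz x + C * (size x * 12) /\ size y = size x.
Proof.
elim: C y => [|C IH] y /=; first by rewrite inE => /eqP ->; rewrite leq_addr.
move=> /flattenP [s /mapP [z /IH [Hz Ez] ->]] Hy; split; last first.
  by rewrite -Ez -!(size_map fst) -!/(unzip1 _) (unzip1_nbrs Hy).
have : sz y <= sz z + size z * 12.
  move: Hy; rewrite inE => /orP [/eqP ->|/flattenP [s' /mapP [cv _ ->]]]; first by rewrite leq_addr.
  by rewrite !inE => /orP [] /eqP ->; apply: sz_bump_val.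
rewrite Ez mulSn => H; apply: leq_trans H _.
by rewrite [leqRHS]addnCA [leqLHS]addnC leq_add2l.
Qed.

Lemma sz_improve C A (x : state) :
  sz (improve C A x) <= sz x + C * (size x * 12) /\ size (improve C A x) = size x.
Proof.
by case: (improve_ball C A x) => [->|[/sz_ball //]]; rewrite leq_addr.
Qed.

Lemma PT_rescale A `{Enc A} C (B x : A -> state) :
  PT B -> PT x -> PT (fun a => rescale C (B a) (x a)).
Proof.
move=> HB Hx; rewrite /rescale.
have [p [c Hc] Hp] := PT_size Hx.
apply: (PT_foldl_inv (I := fun a y => size y = size (x a)) (h := fun a y _ => improve C (B a) y)).
- by apply: PT_improve; pt.
- by apply: PT_map_val => //; apply: (PT_double (f := fun n => n)); pt.
- exact: PT_fuel.
- by move=> a; rewrite size_map.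
- by move=> a y _ <-; apply: (proj2 (sz_improve _ _ _)).
exists (fun n => C * (n.+2 ^ c * 12)); first by pb; apply: pbound_id.
move=> a y b Ey; apply: leq_trans (proj1 (sz_improve _ _ _)) _.
rewrite leq_add2l leq_mul2l leq_mul2r Ey; apply/orP; right; apply/orP; right.
apply: leq_trans (sz_size _) _; apply: leq_trans (Hp _) _; apply: leq_trans (Hc _) _.
by apply: leq_expl; lia.
Qed.

Lemma sz_iter_map_half (A : state) i : sz (iter i (map_val half) A) <= sz A.
Proof.
elim: i => //= i; apply: leq_trans; elim: (iter _ _ _) => [|[c v] x IH] //=.
by rewrite !sz_cons !sz_pair /=; have := sz_half v; lia.
Qed.

Lemma PT_levels A X `{Enc A} `{Enc X} (B : A -> state) (s : A -> seq X) :
  PT B -> PT s -> PT (fun a => levels (B a) (s a)).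
Proof.
move=> HB Hs; rewrite /levels; apply: PT_snd.
have [p [c Hc] Hp] := PT_size HB.
apply: (PT_foldl_inv (I := fun a (y : state * seq state) => sz y.1 <= sz (B a))
  (h := fun _ (a : state * seq state) _ => (map_val half a.1, a.1 :: a.2))).
- by pt; apply: PT_map_val; pt; apply: (PT_half (f := fun n => n)); pt.
- by pt.
- by [].
- by [].
- by move=> a [y l] x /= Hy; apply: leq_trans (sz_iter_map_half y 1) _.
exists (fun n => n.+2 ^ c + 2); first by pb; apply: pbound_id.
move=> a [y l] x /= Hy; rewrite !sz_pair /= sz_cons.
have : sz (map_val half y) <= sz y by apply: (sz_iter_map_half y 1).
have : sz y <= (sz a + sz x).+2 ^ c.
  apply: leq_trans Hy _; apply: leq_trans (Hp _) _; apply: leq_trans (Hc _) _.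
  by apply: leq_expl; lia.
by lia.
Qed.

Lemma sz_rescale C A (x : state) :
  sz (rescale C A x) <= sz x + (size x * 12 + (size A * (size x).+2).+1 * (C * (size x * 12)))
  /\ size (rescale C A x) = size x.
Proof.
rewrite /rescale -size_fuel.
have H (s : seq bool) (y : state) : size y = size x ->
    sz (foldl (fun y _ => improve C A y) y s) <= sz y + size s * (C * (size x * 12)) /\
    size (foldl (fun y _ => improve C A y) y s) = size x.
  elim: s y => [|b s IH] y Ey /=; first by rewrite leq_addr.
  have [H1 H2] := sz_improve C A y; rewrite Ey in H1 H2.
  have [H3 H4] := IH _ H2; split => //; apply: leq_trans H3 _.
  by rewrite mulSn addnA leq_add2r.
have [|H1 H2] := H (fuel A x) (map_val double x); first by rewrite size_map.
split => //; apply: leq_trans H1 _; rewrite addnA leq_add2r.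
by apply: sz_map_val => n; apply: leq_trans (sz_double n) _; rewrite leq_add2l.
Qed.

Lemma PT_solve A X `{Enc A} `{Enc X} C (B x : A -> state) (s : A -> seq X) :
  PT B -> PT x -> PT s -> PT (fun a => solve C (B a) (x a) (s a)).
Proof.
move=> HB Hx Hs; rewrite /solve.
have [p [c Hc] Hp] := PT_size Hx.
apply: (PT_foldl_inv (I := fun a y => size y = size (x a)) (h := fun _ y D => rescale C D y)).
- by apply: PT_rescale; pt.
- by [].
- exact: PT_levels.
- by [].
- by move=> a y D <-; apply: (proj2 (sz_rescale _ _ _)).
exists (fun n => n.+2 ^ c * 12 + (n * ((n.+2 ^ c) + 2) + 1) * (C * (n.+2 ^ c * 12))).
  by pb; apply: pbound_id.
move=> a y D Ey; apply: leq_trans (proj1 (sz_rescale _ _ _)) _; rewrite Ey leq_add2l.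
have Hsx : size (x a) <= (sz a + sz D).+2 ^ c.
  apply: leq_trans (sz_size _) _; apply: leq_trans (Hp _) _; apply: leq_trans (Hc _) _.
  by apply: leq_expl; lia.
have HD : size D <= sz a + sz D by apply: leq_trans (sz_size D) _; rewrite leq_addl.
rewrite leq_add ?leq_mul2r ?Hsx // -addn1 leq_mul ?leq_mul2l ?leq_mul2r ?Hsx ?orbT //.
by rewrite leq_add2r leq_mul // -addn2 leq_add2r.
Qed.

(** * Integer decomposition of transportation tables *)

Lemma path_mono_in (T : eqType) (e e' : rel T) x p :
  (forall u v, u \in x :: p -> v \in p -> e u v -> e' u v) -> path e x p -> path e' x p.
Proof.
elim: p x => //= v p IH x H /andP [xv vp]; apply/andP; split.
  by apply: H xv; rewrite inE eqxx.
by apply: IH vp => u w uv wp; apply: H; rewrite inE ?uv ?wp orbT.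
Qed.

Section Transport.
Variables (A J : finType) (y : A -> J -> nat).

(** Residual graph on the columns: an arc means that some row of [z] can move a unit from [j] to
    [j'] while staying below [y]. *)
Definition residual (z : A -> J -> nat) : rel J :=
  fun j j' => [exists a, (0 < z a j) && (z a j' < y a j')].

(* One unit is pushed along an alternating path. *)
Lemma augment (z : A -> J -> nat) j0 p :
  path (residual z) j0 p -> uniq (j0 :: p) -> (forall a j, z a j <= y a j) ->
  exists z', [/\ forall a j, z' a j <= y a j, forall a, \sum_j z' a j = \sum_j z a j &
    forall j, \sum_a z' a j + (j == j0) = \sum_a z a j + (j == last j0 p)].
Proof.
elim: p j0 z => [|j1 p IH] j0 z; first by move=> _ _ zy; exists z.
move=> /= /andP [/existsP [a /andP [za0 za1]] pth] /andP [j0p /andP [j1p up]] zy.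
rewrite inE negb_or in j0p; have {j0p}[j01 j0p] := andP j0p.
pose z1 b j := if b == a then if j == j0 then (z b j).-1 else if j == j1 then (z b j).+1
  else z b j else z b j.
have z1y b j : z1 b j <= y b j.
  rewrite /z1; case: eqP => [->|_ //]; case: eqP => [->|_]; first by have := zy a j0; lia.
  by case: eqP => [->|_].
have j10 : j1 != j0 by rewrite eq_sym.
have z1r b : \sum_j z1 b j = \sum_j z b j.
  rewrite /z1; case: eqP => [->|_ //].
  rewrite (bigD1 j0) //= (bigD1 j1) //= [in RHS](bigD1 j0) //= [in RHS](bigD1 j1) //=.
  rewrite eqxx (negbTE j10) eqxx.
  under eq_bigr => i /andP [/negbTE -> /negbTE ->] do [].
  by move: (\sum_(_ | _) _) => s; lia.
have z1c j : \sum_b z1 b j + (j == j0) = \sum_b z b j + (j == j1).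
  rewrite (bigD1 a) //= [in RHS](bigD1 a) //= {1}/z1 eqxx.
  have -> : \sum_(b | b != a) z1 b j = \sum_(b | b != a) z b j.
    by apply: eq_bigr => b /negbTE ba; rewrite /z1 ba.
  move: (\sum_(_ | _) _) => s; case: (eqVneq j j0) => [->|nj].
    by rewrite (negbTE j01); lia.
  by case: (eqVneq j j1) => [->|_]; lia.
(* The rest of the path survives the first move: it avoids [j0], and it meets [j1] only as its
   starting point, where entries have not decreased. *)
have pth1 : path (residual z1) j1 p.
  apply: path_mono_in pth => u v up' vp /existsP [b /andP [zbu zbv]].
  have uj0 : u != j0.
    by apply: contraTneq up' => ->; rewrite inE negb_or j01.
  have vj0 : v != j0 by apply: contraTneq vp => ->.
  have vj1 : v != j1 by apply: contraTneq vp => ->.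
  apply/existsP; exists b; rewrite /z1 (negbTE uj0) (negbTE vj0) (negbTE vj1) if_same zbv andbT.
  by case: ifP => // _; case: ifP.
have [||z' [H1 H2 H3]] := IH j1 z1 pth1; [by rewrite /= j1p|by []|].
exists z'; split => //; first by move=> b; rewrite H2.
by move=> j; have := H3 j; have := z1c j; lia.
Qed.

Variables (e : J -> nat) (f : A -> nat) (n : nat).
Hypothesis n0 : 0 < n.
Hypothesis ye : forall j, \sum_a y a j = n * e j.
Hypothesis yf : forall a, \sum_j y a j = n * f a.

(** A flow argument: from a subtable with the right row sums, excess is pushed from overfull to
    underfull columns; if no underfull column is reachable, the reachable columns form a cut that
    contradicts the margins of [y]. *)
Lemma transport_split : exists z : A -> J -> nat,
  [/\ forall a j, z a j <= y a j, forall j, \sum_a z a j = e j & forall a, \sum_j z a j = f a].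
Proof.
have [z [zy zf]] : exists z : A -> J -> nat,
    (forall a j, z a j <= y a j) /\ (forall a, \sum_j z a j = f a).
  have /fin_all_exists [z Hz] : forall a, exists c : J -> nat,
      (forall j, c j <= y a j) /\ \sum_j c j = f a.
    by move=> a; apply: sum_pick; rewrite yf leq_pmull.
  by exists z; split => [a j|a]; case: (Hz a).
have [k] := ubnP (\sum_j (\sum_a z a j - e j)); elim: k z zy zf => // k IH z zy zf zk.
have [/forallP le|] := boolP [forall j, \sum_a z a j <= e j].
  exists z; split => // j; apply/eqP; rewrite eqn_leq le /= leqNgt; apply/negP => lt.
  have : \sum_j \sum_a z a j < \sum_j e j.
    rewrite (bigD1 j) //= [X in _ < X](bigD1 j) //= -addSn leq_add //.
    by apply: leq_sum => i _.
  rewrite exchange_big (eq_bigr f) //= -(ltn_pmul2l n0) !big_distrr /=.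
  rewrite (eq_bigr (fun a => \sum_j y a j)) => [|a _]; last by rewrite yf.
  rewrite exchange_big (eq_bigr (fun j => n * e j)) ?ltnn // => i _; exact: ye.
rewrite negb_forall => /existsP [j0]; rewrite -ltnNge => lt0.
have [/existsP [j1 /andP [con lt1]]|] :=
  boolP [exists j, connect (residual z) j0 j && (\sum_a z a j < e j)].
  have /connectP [p0 pth0 E0] := con; case: (shortenP pth0) E0 => p pth up _ E.
  have [z' [H1 H2 H3]] := augment pth up zy.
  apply: (IH z') => // [a|]; first by rewrite H2.
  have j01 : j0 != j1 by apply: contraTneq lt0 => ->; rewrite -leqNgt ltnW.
  rewrite -ltnS; apply: leq_trans zk; rewrite ltnS.
  rewrite (bigD1 j0) //= [X in _ < X](bigD1 j0) //= -addSn leq_add //.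
    by have := H3 j0; rewrite eqxx -E (negbTE j01); lia.
  apply: leq_sum => j jj0; have := H3 j; rewrite -E (negbTE jj0).
  by case: eqP => [->|_]; lia.
rewrite negb_exists => /forallP ge; exfalso.
pose S j := connect (residual z) j0 j.
(* A row with a unit of [z] inside [S] agrees with [y] outside [S], since otherwise an arc would
   leave [S]. Comparing full row sums, [n * f a] in [y] and [f a] in [z], gives the inequality
   inside [S]. *)
have row a : n * \sum_(j | S j) z a j <= \sum_(j | S j) y a j.
  have [/existsP [j /andP [Sj zj]]|] := boolP [exists j, S j && (0 < z a j)]; last first.
    rewrite negb_exists => /forallP H; rewrite big1 ?muln0 // => j Sj.
    by have := H j; rewrite Sj /= -eqn0Ngt => /eqP.
  have Ey : \sum_(j | ~~ S j) z a j = \sum_(j | ~~ S j) y a j.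
    apply: eq_bigr => j' Sj'; apply/eqP; rewrite eqn_leq zy /= leqNgt.
    apply: contra Sj' => lt; apply: connect_trans Sj _; apply: connect1.
    by apply/existsP; exists a; rewrite zj.
  have := yf a; rewrite -zf (bigID S) /= [X in _ = n * X](bigID S) /= Ey.
  by move: (\sum_(j | S j) y a j) (\sum_(j | S j) z a j) (\sum_(j | ~~ S j) _) => u v w; nia.
have : n * \sum_(j | S j) \sum_a z a j <= n * \sum_(j | S j) e j.
  rewrite exchange_big !big_distrr /=; apply: leq_trans (leq_sum _ (fun a _ => row a)) _.
  by rewrite exchange_big; apply: leq_sum => j _; rewrite ye.
rewrite leq_pmul2l // leqNgt => /negP; apply.
rewrite (bigD1 j0) ?/S ?connect0 //= [X in _ < X](bigD1 j0) ?connect0 //= -addSn leq_add //.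
apply: leq_sum => j /andP [Sj _]; have := ge j.
by rewrite Sj /= -leqNgt.
Qed.

End Transport.

Lemma transport_decomp (A J : finType) (e : J -> nat) (f : A -> nat) n (y : A -> J -> nat) :
  (forall j, \sum_a y a j = n * e j) -> (forall a, \sum_j y a j = n * f a) ->
  exists x : nat -> A -> J -> nat,
    (forall i, i < n -> (forall j, \sum_a x i a j = e j) /\ (forall a, \sum_j x i a j = f a)) /\
    (forall a j, \sum_(i < n) x i a j = y a j).
Proof.
elim: n y => [|n IH] y ye yf.
  exists (fun _ _ _ => 0); split => // a j; rewrite big_ord0.
  by have /eqP := ye j; rewrite mul0n sum_nat_eq0 => /forallP /(_ a) /eqP ->.
have [z [zy ze zf]] := transport_split (ltn0Sn n) ye yf.
have [||x [Hx Ex]] := IH (fun a j => y a j - z a j).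
- by move=> j; rewrite sumnB // ye ze mulSn addKn.
- by move=> a; rewrite sumnB // yf zf mulSn addKn.
exists (fun i => if i < n then x i else z); split.
  by move=> i _; case: ifP => // /Hx.
move=> a j; rewrite big_ord_recr /= ltnn.
rewrite (eq_bigr (fun i : 'I_n => x i a j)) => [|i _]; last by rewrite ltn_ord.
by rewrite Ex subnK.
Qed.

(** * Tables as lists *)

Definition graph_of (d : seq key) (F : key -> nat) : seq (key * nat) := [seq (c, F c) | c <- d].

Lemma unzip1_graph d F : unzip1 (graph_of d F) = d.
Proof. by rewrite /unzip1 -map_comp map_id. Qed.

Lemma graph_ofP d x : uniq d -> unzip1 x = d -> exists F, x = graph_of d F.
Proof.
move=> Ud Ex; exists (fun c => nth 0 (unzip2 x) (index c d)).
have Sx : size d = size x by rewrite -Ex size_map.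
apply: (@eq_from_nth _ ((0, (0, 0)), 0)); first by rewrite size_map.
move=> i ix; rewrite (nth_map (0, (0, 0))) ?Sx // index_uniq ?Sx //.
by rewrite -Ex (nth_map ((0, (0, 0)), 0)) // (nth_map ((0, (0, 0)), 0)) // -surjective_pairing.
Qed.

Lemma eq_in_graph d F G : {in d, F =1 G} -> graph_of d F = graph_of d G.
Proof. by move=> FG; apply/eq_in_map => c cd; rewrite FG. Qed.

Lemma bump_graph d c u F : bump_val c u (graph_of d F) =
  graph_of d (fun k => if k == c then if u then F k + 1 else F k - 1 else F k).
Proof. by rewrite /bump_val /graph_of -map_comp; apply: eq_map => k /=; rewrite key_eqE. Qed.

Lemma ball_self C x : x \in ball C x.
Proof.
elim: C => [|C IH] /=; first by rewrite inE.
by apply/flattenP; exists (nbrs x); [apply: map_f|rewrite inE eqxx].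
Qed.

Lemma ball_graph C d F G : uniq d -> \sum_(c <- d) dist (F c) (G c) <= C ->
  graph_of d G \in ball C (graph_of d F).
Proof.
move=> Ud; elim: C G => [|C IH] G HG.
  rewrite (@eq_in_graph d G F) ?ball_self // => c cd.
  by move: HG; rewrite (big_rem c) //= /dist; lia.
have [/allP eqFG|/allPn [c cd FGc]] := boolP (all (fun c => F c == G c) d).
  by rewrite (@eq_in_graph d G F) ?ball_self // => c /eqFG /eqP.
(* In cell [c], [G'] is one unit nearer to [F] than [G] is, and a single bump leads from [G'] to
   [G]. *)
pose G' k := if k == c then if F c < G c then G c - 1 else G c + 1 else G k.
have HG' : \sum_(k <- d) dist (F k) (G' k) <= C.
  rewrite -ltnS; apply: leq_trans HG.
  rewrite (bigD1_seq c) //= [X in _ < X](bigD1_seq c) //= -addSn leq_add //.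
    by move: FGc; rewrite /G' eqxx /dist; move: (F c) (G c) => u v; case: (ltngtP u v) => //; lia.
  by apply: leq_sum => k /negbTE kc; rewrite /G' kc.
apply/flattenP; exists (nbrs (graph_of d G')); first exact/map_f/IH.
have -> : graph_of d G = bump_val c (F c < G c) (graph_of d G').
  rewrite bump_graph; apply: eq_in_graph => k _; rewrite /G'.
  by case: eqP => // ->; move: FGc; case: (ltngtP (F c) (G c)) => //; lia.
rewrite inE; apply/orP; right; apply/flattenP.
exists [:: bump_val c true (graph_of d G'); bump_val c false (graph_of d G')].
  by apply/mapP; exists (c, G' c) => //; apply: map_f.
by case: (_ < _); rewrite !inE eqxx ?orbT.
Qed.

Lemma violE A x : viol A x = \sum_(rb <- A) dist (rowsum rb.1 x) rb.2.
Proof. by elim: A => [|rb A IH]; rewrite ?big_nil // big_cons -IH /= addnC. Qed.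

Lemma rowsum_graph r d F : rowsum r (graph_of d F) = \sum_(c <- d | matches r c) F c.
Proof.
elim: d => [|c d IH]; rewrite ?big_nil // big_cons /= IH.
by case: ifP => // _; rewrite addnC.
Qed.

Section Table.
Variables l m : nat.

Definition layer_cells : seq (nat * nat) := [seq (a, j) | a <- iota 0 l, j <- iota 0 m].
Definition cells (ks : seq nat) : seq key := [seq (k, c) | k <- ks, c <- layer_cells].

Lemma uniq_cells t : uniq (cells (iota 0 t)).
Proof.
apply: allpairs_uniq; [exact: iota_uniq| |by move=> [? ?] [? ?] _ _ /= [-> ->]].
by apply: allpairs_uniq; rewrite ?iota_uniq // => -[? ?] [? ?] _ _ /= [-> ->].
Qed.

Lemma sum_iota (n : nat) (F : nat -> nat) : \sum_(k <- iota 0 n) F k = \sum_(k < n) F k.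
Proof. by rewrite -{1}[n]subn0 big_mkord. Qed.

Definition tcell (k : nat) (i : 'I_l * 'I_m) : key := (k, (val i.1, val i.2)).

Lemma sum_layer_cells (F : nat * nat -> nat) :
  \sum_(c <- layer_cells) F c = \sum_(i : 'I_l * 'I_m) F (val i.1, val i.2).
Proof.
rewrite big_allpairs -(pair_bigA _ (fun (a : 'I_l) (j : 'I_m) => F (val a, val j))).
by rewrite sum_iota; apply: eq_bigr => a _; rewrite sum_iota.
Qed.

Lemma sum_cells t (Q : pred key) (F : key -> nat) :
  \sum_(c <- cells (iota 0 t) | Q c) F c =
  \sum_(k < t) \sum_(i : 'I_l * 'I_m | Q (tcell k i)) F (tcell k i).
Proof.
rewrite big_mkcond big_allpairs sum_iota; apply: eq_bigr => k _.
by rewrite sum_layer_cells [RHS]big_mkcond.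
Qed.

(* [inl j] stands for the sum of column [j] of a layer, [inr a] for that of row [a]. *)
Definition line (p : 'I_m + 'I_l) (i : 'I_l * 'I_m) : bool :=
  match p with inl j => i.2 == j | inr a => i.1 == a end.

Definition layer_rows (k : nat) : seq key :=
  [seq (k.+1, (0, j.+1)) | j <- iota 0 m] ++ [seq (k.+1, (a.+1, 0)) | a <- iota 0 l].
Definition vertical_rows : seq key := [seq (0, (c.1.+1, c.2.+1)) | c <- layer_cells].
Definition rows (ks : seq nat) : seq key := flatten [seq layer_rows k | k <- ks] ++ vertical_rows.

Definition row_of (k : nat) (p : 'I_m + 'I_l) : key :=
  match p with inl j => (k.+1, (0, j.+1)) | inr a => (k.+1, (a.+1, 0)) end.
Definition row_vert (i : 'I_l * 'I_m) : key := (0, (i.1.+1, i.2.+1)).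

Lemma sum_rows t (H : key -> nat) :
  \sum_(r <- rows (iota 0 t)) H r =
  \sum_(k < t) \sum_p H (row_of k p) + \sum_i H (row_vert i).
Proof.
rewrite big_cat; congr (_ + _).
  rewrite big_flatten big_map sum_iota; apply: eq_bigr => k _.
  rewrite big_cat !big_map !sum_iota big_sumType //.
by rewrite big_map sum_layer_cells.
Qed.

Lemma rowsum_local t F (k : 'I_t) p :
  rowsum (row_of k p) (graph_of (cells (iota 0 t)) F) = \sum_(i | line p i) F (tcell k i).
Proof.
rewrite rowsum_graph sum_cells (bigD1 k) //= [X in _ + X]big1 ?addn0 => [|k' kk'].
  by apply: eq_bigl => i; case: p => [j|a]; rewrite /matches /wild /= !eqSS eqxx /= ?andbT eq_sym.
have kkn : (nat_of_ord k == nat_of_ord k') = false by rewrite eq_sym; apply: negbTE kk'.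
by apply: big_pred0 => i; rewrite /matches /wild; case: p => [j|a] /=; rewrite eqSS kkn.
Qed.

Lemma rowsum_vert t F i :
  rowsum (row_vert i) (graph_of (cells (iota 0 t)) F) = \sum_(k < t) F (tcell k i).
Proof.
rewrite rowsum_graph sum_cells; apply: eq_bigr => k _; rewrite (big_pred1 i) // => -[a j].
case: i => a' j'; rewrite /matches /wild /= !eqSS /= xpair_eqE -!val_eqE.
by congr (_ && _); apply: eq_sym.
Qed.

Lemma viol_graph t H F :
  viol (graph_of (rows (iota 0 t)) H) (graph_of (cells (iota 0 t)) F) =
  violation line (fun (k : 'I_t) p => H (row_of k p)) (fun i => H (row_vert i))
    (fun k i => F (tcell k i)).
Proof.
rewrite violE big_map sum_rows; congr (_ + _).
  by apply: eq_bigr => k _; apply: eq_bigr => p _; rewrite rowsum_local.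
by apply: eq_bigr => i _; rewrite rowsum_vert.
Qed.

Definition untable t (x : 'I_t -> 'I_l * 'I_m -> nat) (c : key) : nat :=
  match insub c.1, insub c.2.1, insub c.2.2 with
  | Some k, Some a, Some j => x k (a, j)
  | _, _, _ => 0
  end.

Lemma untableK t x (k : 'I_t) i : untable x (tcell k i) = x k i.
Proof. by case: i => a j; rewrite /untable /= !valK. Qed.

(** One radius serves every number of types and every right-hand side, in particular all halved
    systems. *)
Lemma radius_exists : exists C, forall t H,
  radius C (graph_of (rows (iota 0 t)) H) (cells (iota 0 t)).
Proof.
have [C HC] := local_search line; exists C => t H x y Ex Ey.
have [F ->] := graph_ofP (uniq_cells t) Ex; have [G ->] := graph_ofP (uniq_cells t) Ey.
rewrite !viol_graph => /HC [x' [Hx' lt]].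
exists (graph_of (cells (iota 0 t)) (untable x')); last first.
  rewrite viol_graph; move: lt; congr (_ < _); congr violation.
  by apply: functional_extensionality => k; apply: functional_extensionality => i; rewrite untableK.
apply: ball_graph; first exact: uniq_cells.
rewrite sum_cells; apply: leq_trans Hx'; apply: leq_sum => k _; apply: leq_sum => i _.
by rewrite untableK.
Qed.

End Table.

(** * Instances as systems of soft constraints *)

Section Instance.
Variables l m : nat.
Notation d := (ltype0 l m).

Lemma prefix_nS (s : seq (ltype l m)) k : k < size s ->
  prefix_n s k.+1 = prefix_n s k + lt_n (nth d s k).
Proof. by move=> ks; rewrite /prefix_n (take_nth d) // -cats1 big_cat big_seq1. Qed.

Lemma sum_prefix (s : seq (ltype l m)) (F : nat -> nat) K : K <= size s ->
  \sum_(i < prefix_n s K) F i = \sum_(k < K) \sum_(prefix_n s k <= i < prefix_n s k.+1) F i.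
Proof.
elim: K => [|K IH] Ks; first by rewrite big_ord0 /prefix_n take0 big_nil big_ord0.
rewrite big_ord_recr /= -IH ?(ltnW Ks) // -!(big_mkord xpredT).
by rewrite -big_cat_nat // prefix_nS // leq_addr.
Qed.

(** Each sum [y k] is decomposed separately, and the resulting layers are laid end to end along the
    prefix sums. *)
Lemma glue_layers (s : seq (ltype l m)) (y : nat -> 'I_l -> 'I_m -> nat) K : K <= size s ->
  (forall k, k < size s ->
     (forall j, \sum_a y k a j = lt_n (nth d s k) * lt_e (nth d s k) j) /\
     (forall a, \sum_j y k a j = lt_n (nth d s k) * lt_f (nth d s k) a)) ->
  exists x : nat -> 'I_l -> 'I_m -> nat,
    (forall k i, k < K -> prefix_n s k <= i < prefix_n s k.+1 ->
       layer_ok (lt_e (nth d s k)) (lt_f (nth d s k)) (x i)) /\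
    (forall a j, \sum_(i < prefix_n s K) x i a j = \sum_(k < K) y k a j).
Proof.
move=> + Hy; elim: K => [|K IH] Ks.
  exists (fun _ _ _ => 0); split => // a j.
  by rewrite big_ord0 /prefix_n take0 big_nil big_ord0.
have [x [Hx Ex]] := IH (ltnW Ks).
have [z [Hz Ez]] := transport_decomp (proj1 (Hy K Ks)) (proj2 (Hy K Ks)).
have mono k k' : k <= k' -> k' <= size s -> prefix_n s k <= prefix_n s k'.
  move=> kk'; rewrite -(subnKC kk'); elim: (k' - k) => [|i IHi] Hs; first by rewrite addn0.
  rewrite addnS in Hs *; apply: leq_trans (IHi (ltnW Hs)) _.
  by rewrite prefix_nS // leq_addr.
exists (fun i => if i < prefix_n s K then x i else z (i - prefix_n s K)); split.
  move=> k i; rewrite ltnS leq_eqVlt => /orP [/eqP -> | kK] /andP [i1 i2].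
    rewrite ltnNge i1 /=; rewrite prefix_nS // in i2.
    by apply: Hz; rewrite ltn_subLR.
  have -> : i < prefix_n s K by apply: leq_trans i2 (mono _ _ kK (ltnW Ks)).
  by apply: Hx => //; rewrite i1.
move=> a j; rewrite big_ord_recr /= prefix_nS // big_split_ord /= -Ex -Ez; congr (_ + _).
  by apply: eq_bigr => i _; rewrite ltn_ord.
by apply: eq_bigr => i _; rewrite ltnNge leq_addr /= addKn.
Qed.

Definition rhs_local (s : seq (ltype l m)) (k : nat) (p : 'I_m + 'I_l) : nat :=
  let T := nth d s k in
  lt_n T * match p with inl j => lt_e T j | inr a => lt_f T a end.

Lemma sum_line (x : 'I_l * 'I_m -> nat) p :
  \sum_(i | line p i) x i =
  match p with inl j => \sum_a x (a, j) | inr a => \sum_j x (a, j) end.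
Proof.
have -> : \sum_(i | line p i) x i = \sum_a \sum_j if line p (a, j) then x (a, j) else 0.
  by rewrite big_mkcond pair_bigA; apply: eq_bigr => -[].
case: p => [j|a] /=.
  apply: eq_bigr => a _; rewrite (bigD1 j) //= eqxx big1 ?addn0 // => j' /negbTE -> //.
rewrite (bigD1 a) //= [X in _ + X]big1 ?addn0; first by apply: eq_bigr => j _; rewrite eqxx.
by move=> a' /negbTE na; apply: big1 => j _; rewrite na.
Qed.

Lemma dist_eq0 u v : dist u v = 0 <-> u = v.
Proof. by rewrite /dist; lia. Qed.

Lemma violation_eq0 t (b : 'I_t -> 'I_m + 'I_l -> nat) g (x : 'I_t -> 'I_l * 'I_m -> nat) :
  violation (@line l m) b g x = 0 <->
  (forall k p, \sum_(i | line p i) x k i = b k p) /\ (forall i, \sum_k x k i = g i).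
Proof.
rewrite /violation; split.
  move=> /eqP; rewrite addn_eq0 !sum_nat_eq0 => /andP [/forallP H1 /forallP H2]; split.
    by move=> k p; have := H1 k; rewrite /= sum_nat_eq0 => /forallP /(_ p) /= /eqP /dist_eq0.
  by move=> i; have /= /eqP /dist_eq0 := H2 i.
move=> [H1 H2]; rewrite big1 => [|k _]; last by apply: big1 => p _; apply/dist_eq0/H1.
by rewrite add0n; apply: big1 => i _; apply/dist_eq0/H2.
Qed.

(** An exponential number of layers is replaced by [size s] of them: layers of one type are summed,
    and integer decomposition recovers them from the sum. *)
Lemma yes_instanceP (I : inst l m) : let s := in_types I in
  yes_instance I <->
  [/\ 0 < size s, all (fun T => 0 < lt_n T) s, \sum_(T <- s) lt_n T = in_n I &
   exists x : 'I_(size s) -> 'I_l * 'I_m -> nat,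
     violation (@line l m) (fun k => rhs_local s k) (fun i => in_g I i.1 i.2) x = 0].
Proof.
set s := in_types I => /=.
have En : prefix_n s (size s) = \sum_(T <- s) lt_n T by rewrite /prefix_n take_size.
split.
  move=> [s0 pos sum_n [x [Hx Ex]]]; split => //.
  - by apply/(all_nthP d).
  - by rewrite -En.
  exists (fun k i => \sum_(prefix_n s k <= h < prefix_n s k.+1) x h i.1 i.2).
  apply/violation_eq0; split => [k p|[a j] /=]; last first.
    by rewrite -Ex -sum_n (sum_prefix (fun h => x h a j)).
  rewrite sum_line; have Ek := prefix_nS (ltn_ord k).
  have len : prefix_n s k.+1 - prefix_n s k = lt_n (nth d s k) by rewrite Ek addKn.
  case: p => [j|a] /=; rewrite /rhs_local exchange_big /= -len -sum_nat_const_nat;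
    apply: eq_big_nat => h hk; have [H1 H2] := Hx k h (ltn_ord k) hk.
    exact: H1.
  exact: H2.
move=> [s0 /(all_nthP d) pos sum_n [x /violation_eq0 [H1 H2]]]; split => //.
- by rewrite En.
pose y k a j := if insub k is Some k' then x k' (a, j) else 0.
have Ey (k : 'I_(size s)) a j : y k a j = x k (a, j) by rewrite /y valK.
have [|z [Hz Ez]] := @glue_layers s y (size s) (leqnn _).
  move=> k ks; split => [j|a].
    have := H1 (Ordinal ks) (inl j); rewrite sum_line /rhs_local /= => <-.
    by apply: eq_bigr => a _; rewrite -Ey.
  have := H1 (Ordinal ks) (inr a); rewrite sum_line /rhs_local /= => <-.
  by apply: eq_bigr => j _; rewrite -Ey.
exists z; split => // a j; rewrite -sum_n -En Ez -(H2 (a, j)).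
by apply: eq_bigr => k _; rewrite Ey.
Qed.

End Instance.

(** * Parsing *)

(** The current token and the list of finished ones are kept reversed, so that reading a bit is one
    cons. *)
Definition tok_step (a : seq bool * seq (seq bool)) (s : sym) :=
  if (sym_bits s).2 then ([::], rev a.1 :: a.2) else ((sym_bits s).1 :: a.1, a.2).

Definition scan (w : seq sym) := foldl tok_step ([::], [::]) w.
Definition tokens (w : seq sym) := rev (scan w).2.
Definition untok (ss : seq (seq bool)) : seq sym := flatten [seq map bit s ++ [:: Sep] | s <- ss].

Lemma scan_bits s a : foldl tok_step a (map bit s) = (rev s ++ a.1, a.2).
Proof.
elim: s a => [|b s IH] a /=; first by case: a.
by rewrite IH rev_cons cat_rcons; case: b.
Qed.

Lemma scan_untok ss a : foldl tok_step ([::], a) (untok ss) = ([::], rev ss ++ a).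
Proof.
elim: ss a => //= s ss IH a; rewrite /untok /= -/(untok ss) -catA foldl_cat scan_bits /=.
by rewrite {2}/tok_step /= cats0 revK IH rev_cons cat_rcons.
Qed.

Lemma tokens_untok ss : tokens (untok ss) = ss.
Proof. by rewrite /tokens /scan scan_untok cats0 revK. Qed.

Lemma scan_inv w : untok (rev (scan w).2) ++ map bit (rev (scan w).1) = w.
Proof.
elim/last_ind: w => // w s; rewrite /scan -cats1 foldl_cat /= -/(scan w).
case: (scan w) => u v /= IH.
rewrite /tok_step; case: s => /=; rewrite ?rev_cons ?map_rcons -?cats1 -?IH ?catA //.
by rewrite /untok map_cat flatten_cat /= cats0 !catA cats1 cats0.
Qed.

Lemma untok_tokens w : nilp (scan w).1 -> untok (tokens w) = w.
Proof. by move=> /nilP E; have := scan_inv w; rewrite E cats0. Qed.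

Lemma size_tokens w s : s \in tokens w -> size s <= size w.
Proof.
move=> sw; rewrite -{1}(scan_inv w) size_cat; apply: leq_trans (leq_addr _ _).
rewrite -/(tokens w); elim: (tokens w) sw => //= s' ss IH.
rewrite inE /untok /= !size_cat size_map -/(untok ss) => /orP [/eqP ->|/IH]; lia.
Qed.

(** Lists are little-endian, so the last bit is the leading one; the default [true] admits the empty
    list, which stands for 0. *)
Definition canonical (s : seq bool) := last true s.

Lemma bin_canonical s : canonical s -> bin (nbits s) = s.
Proof.
rewrite bin_nbits /canonical; suff H b : last b s -> trim s = s by exact: H.
elim: s b => // c s IH b /= Hs; rewrite (IH c) //.
by case: s Hs {IH} => //= ->.
Qed.

Lemma canonical_bin n : canonical (bin n).
Proof.
have [k] := ubnP n; elim: k n => // k IH n nk; rewrite bin_rec; case: eqP => // n0.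
rewrite /canonical /=; have [h0|h0] := eqVneq n./2 0.
  by rewrite h0 /=; move: (odd_double_half n); rewrite h0; case: (odd n) => //; lia.
have : canonical (bin n./2) by apply: IH; lia.
by rewrite /canonical; case E: (bin n./2) => //; move: E; rewrite bin_rec (negbTE h0).
Qed.

Lemma size_enum_map X (n : nat) (F : 'I_n -> X) : size [seq F j | j <- enum 'I_n] = n.
Proof. by rewrite size_map size_enum_ord. Qed.

(** * Layout of an instance as a list of numbers *)

Section Parse.
Variables l m : nat.
Notation width := (m + l + 1).

Definition type_of (S : seq nat) : ltype l m :=
  LType (fun j => nth 0 S j) (fun a => nth 0 S (m + a)) (nth 0 S (m + l)).

(** Each type receives a whole suffix of the data, of which [type_of] reads only the first
    [m + l + 1] entries. *)
Definition inst_of (t : nat) (N : seq nat) : inst l m :=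
  Inst (fun a j => nth 0 N (a * m + j))
    [seq type_of (drop (width * k) (drop (l * m) N)) | k <- iota 0 t]
    (nth 0 (drop (width * t) (drop (l * m) N)) 0).

Definition type_data (T : ltype l m) : seq nat :=
  [seq lt_e T j | j <- enum 'I_m] ++ [seq lt_f T a | a <- enum 'I_l] ++ [:: lt_n T].

Definition mat_data (g : 'I_l -> 'I_m -> nat) : seq nat :=
  flatten [seq [seq g a j | j <- enum 'I_m] | a <- enum 'I_l].

Definition data (I : inst l m) : seq nat :=
  mat_data (in_g I) ++ flatten [seq type_data T | T <- in_types I] ++ [:: in_n I].

Definition data_size (t : nat) := l * m + (width * t + 1).

(** The unary number of types is itself a token, made of ones, so an encoding is uniformly a list of
    tokens. *)
Lemma encodeE (I : inst l m) :
  encode I = untok (nseq (size (in_types I)) true :: map bin (data I)).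
Proof.
have U s : untok (map bin s) = flatten (map enc_nat s) by rewrite /untok -map_comp.
rewrite /untok /= map_nseq -/(untok (map bin (data I))) U -catA; congr (_ ++ (_ :: _)).
rewrite /data !map_cat !flatten_cat; congr (_ ++ (_ ++ _)); last by rewrite /= cats0.
  rewrite /enc_mat /mat_data map_flatten; congr flatten.
  by rewrite -map_comp; congr flatten; apply: eq_map => a; rewrite -[RHS]map_comp.
elim: (in_types I) => //= T s ->; rewrite map_cat flatten_cat; congr (_ ++ _).
rewrite /enc_type /type_data /enc_vec !map_cat !flatten_cat -!map_comp.
by rewrite /= cats0.
Qed.

Lemma size_type_data T : size (type_data T) = width.
Proof. by rewrite /type_data !size_cat !size_enum_map addnA. Qed.

Lemma drop_flatten_const X (c : X -> seq nat) W (s : seq X) k :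
  (forall x, size (c x) = W) -> drop (W * k) (flatten (map c s)) = flatten (map c (drop k s)).
Proof.
move=> Hc; elim: s k => [|x s IH] [|k] //=; rewrite ?muln0 ?drop0 //.
by rewrite mulnS addnC -drop_drop drop_size_cat.
Qed.

Lemma size_flatten_const X (c : X -> seq nat) W (s : seq X) :
  (forall x, size (c x) = W) -> size (flatten (map c s)) = W * size s.
Proof. by move=> Hc; elim: s => [|x s IH]; rewrite /= ?muln0 // size_cat Hc IH mulnS. Qed.

Lemma size_mat_data g : size (mat_data g) = l * m.
Proof.
rewrite /mat_data (@size_flatten_const _ _ m) ?size_enum_ord 1?mulnC // => a.
by rewrite size_enum_map.
Qed.

Lemma size_data I : size (data I) = data_size (size (in_types I)).
Proof.
rewrite /data !size_cat size_mat_data (@size_flatten_const _ _ width) //.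
exact: size_type_data.
Qed.

Lemma nth_enum_map (n : nat) (F : 'I_n -> nat) (i : 'I_n) : nth 0 [seq F j | j <- enum 'I_n] i = F i.
Proof. by rewrite (nth_map i) ?size_enum_ord // nth_ord_enum. Qed.

Lemma type_ofK T S : type_of (type_data T ++ S) = T.
Proof.
case: T => e f n; rewrite /type_of /type_data /=; congr LType.
- apply: functional_extensionality => j.
  by rewrite nth_cat !size_cat size_enum_map ltn_addr // nth_cat size_enum_map ltn_ord nth_enum_map.
- apply: functional_extensionality => a.
  rewrite nth_cat !size_cat !size_enum_map /= ltn_add2l ltn_addr //.
  rewrite nth_cat size_enum_map ltnNge leq_addr /= addKn.
  by rewrite nth_cat size_enum_map ltn_ord nth_enum_map.
- rewrite nth_cat !size_cat !size_enum_map /= ltn_add2l addn1 leqnn.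
  rewrite nth_cat size_enum_map ltnNge leq_addr /= addKn.
  by rewrite nth_cat size_enum_map ltnn subnn.
Qed.

Lemma inst_ofK I : inst_of (size (in_types I)) (data I) = I.
Proof.
case: I => g s n; rewrite /inst_of /data /=; congr Inst.
- apply: functional_extensionality => a; apply: functional_extensionality => j.
  have lt : a * m + j < l * m by have := ltn_ord a; have := ltn_ord j; nia.
  rewrite nth_cat size_mat_data lt -nth_drop /mat_data mulnC (@drop_flatten_const _ _ m); last first.
    by move=> b; rewrite size_enum_map.
  rewrite (drop_nth a) ?size_enum_ord // nth_ord_enum /= nth_cat size_enum_map ltn_ord.
  exact: nth_enum_map.
- rewrite drop_size_cat ?size_mat_data //.
  apply: (@eq_from_nth _ (ltype0 l m)); rewrite size_map size_iota // => k ks.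
  rewrite (nth_map 0) ?size_iota // nth_iota // add0n drop_cat.
  have lt : width * k < width * size s by rewrite ltn_pmul2l // addn1.
  rewrite (size_flatten_const _ size_type_data) lt (drop_flatten_const _ _ size_type_data).
  by rewrite (drop_nth (ltype0 l m)) //= -catA type_ofK.
- rewrite drop_size_cat ?size_mat_data // drop_size_cat //.
  by rewrite (size_flatten_const _ size_type_data).
Qed.

Lemma flatten_chunks W t (N : seq nat) : W * t <= size N ->
  flatten [seq take W (drop (W * k) N) | k <- iota 0 t] = take (W * t) N.
Proof.
elim: t => [|t IH] Ht; first by rewrite muln0 take0.
rewrite -[t.+1]addn1 iotaD map_cat flatten_cat /= cats0 IH; last by lia.
by rewrite add0n addn1 mulnSr takeD.
Qed.

Lemma map_enum_iota X (n : nat) (F : nat -> X) :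
  [seq F (val i) | i <- enum 'I_n] = [seq F i | i <- iota 0 n].
Proof. by rewrite -val_enum_ord -map_comp. Qed.

Lemma map_nth_drop (S : seq nat) i n : i + n <= size S ->
  [seq nth 0 S (i + j) | j <- iota 0 n] = take n (drop i S).
Proof.
move=> H; rewrite -(map_nth_iota0 0) ?size_drop; last by lia.
by apply: eq_map => j; rewrite nth_drop.
Qed.

Lemma type_dataK S : width <= size S -> type_data (type_of S) = take width S.
Proof.
move=> HS; rewrite /type_data /type_of /=.
rewrite (map_enum_iota m (fun j => nth 0 S (0 + j))) (map_enum_iota l (fun a => nth 0 S (m + a))).
rewrite !map_nth_drop ?drop0; try by lia.
rewrite !takeD -catA; congr (_ ++ (_ ++ _)).
by rewrite (drop_nth 0) /= ?take0 //; lia.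
Qed.

Lemma mat_dataK N : l * m <= size N ->
  mat_data (fun a j => nth 0 N (a * m + j)) = take (l * m) N.
Proof.
move=> HN; rewrite /mat_data.
rewrite (map_enum_iota l (fun a => [seq nth 0 N (a * m + nat_of_ord j) | j <- enum 'I_m])).
rewrite mulnC -(flatten_chunks (t := l)) 1?mulnC //; congr flatten.
apply/eq_in_map => a; rewrite mem_iota add0n => /andP [_ al].
rewrite (map_enum_iota m (fun j => nth 0 N (a * m + j))) map_nth_drop 1?mulnC //.
by nia.
Qed.

Lemma data_inst_of t N : size N = data_size t -> data (inst_of t N) = N.
Proof.
rewrite /data_size => HN; rewrite /data /inst_of /= mat_dataK; last by lia.
rewrite -map_comp; set R := drop (l * m) N.
have SR : size R = width * t + 1 by rewrite size_drop HN addKn.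
have -> : [seq (type_data \o (fun k => type_of (drop (width * k) R))) k | k <- iota 0 t] =
    [seq take width (drop (width * k) R) | k <- iota 0 t].
  apply/eq_in_map => k; rewrite mem_iota add0n => /andP [_ kt] /=.
  rewrite type_dataK // size_drop SR.
  have : width * k.+1 <= width * t by rewrite leq_mul2l kt orbT.
  by rewrite mulnS; lia.
rewrite flatten_chunks; last by lia.
rewrite -[RHS](cat_take_drop (l * m)) -/R -[in RHS](cat_take_drop (width * t) R).
congr (_ ++ (_ ++ _)).
have : size (drop (width * t) R) = 1 by rewrite size_drop SR addKn.
by case: (drop _ R) => [|? []].
Qed.

(** Since [HugeTable] demands that [w] be exactly an encoding, leading zeros, a wrong number of
    tokens and an unfinished last token must be rejected. *)
Definition well_formed (w : seq sym) : bool :=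
  let tk := head [::] (tokens w) in let rest := behead (tokens w) in
  [&& nilp (scan w).1, ~~ nilp (tokens w), all id tk, all canonical rest &
      size rest == data_size (size tk)].

Definition parse (w : seq sym) : inst l m :=
  inst_of (size (head [::] (tokens w))) (map nbits (behead (tokens w))).

Lemma well_formedP w : well_formed w ->
  encode (parse w) = w /\ size (in_types (parse w)) = size (head [::] (tokens w)).
Proof.
rewrite /well_formed /parse => /and5P [H1 H2 H3 H4 /eqP H5].
have Es : size (in_types (parse w)) = size (head [::] (tokens w)) by rewrite size_map size_iota.
split => //; rewrite encodeE Es data_inst_of ?size_map // -[RHS](untok_tokens H1).
case: (tokens w) H2 H3 H4 {H5 Es} => //= tk rest _ H3 H4; congr (untok (_ :: _)).
  by elim: (tk) H3 => //= -[] s IH //= /IH ->.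
by elim: (rest) H4 => //= s ss IH /andP [cs /IH ->]; rewrite bin_canonical.
Qed.

Lemma well_formed_encode I : well_formed (encode I) /\ parse (encode I) = I.
Proof.
rewrite /well_formed /parse encodeE /scan scan_untok tokens_untok /= size_nseq; split; last first.
  rewrite -map_comp (eq_map (g := id)) ?map_id ?inst_ofK // => n; exact: nbits_bin.
rewrite size_map size_data eqxx andbT; apply/andP; split; first by elim: (size _).
by rewrite all_map; apply/allP => n _; apply: canonical_bin.
Qed.

Lemma HugeTable_parse w : HugeTable l m w <-> well_formed w /\ yes_instance (parse w).
Proof.
split; last by move=> [/well_formedP [E _] Y]; exists (parse w).
by move=> [I [<- Y]]; have [H ->] := well_formed_encode I.
Qed.

Lemma HugeTable_t_parse t w : HugeTable_t l m t w <->
  [/\ well_formed w, yes_instance (parse w) & size (head [::] (tokens w)) = t].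
Proof.
split; last by move=> [/well_formedP [E <-] Y Et]; exists (parse w).
move=> [I [It [<- Y]]]; have [H ->] := well_formed_encode I; split => //.
by rewrite encodeE tokens_untok /= size_nseq.
Qed.

End Parse.

(** * The decision procedure *)

Lemma PT_drop A X `{Enc A} `{Enc X} i (s : A -> seq X) :
  PT s -> PT (fun a => drop i (s a)).
Proof.
move=> Hs; apply: (@PT_ext _ _ _ _ (fun a => iter i behead (s a))).
  by move=> a; elim: i => [|i IH] /=; rewrite ?drop0 // IH -drop1 drop_drop add1n.
by elim: i => [|i IH] /=; pt.
Qed.

Lemma PT_nth A X `{Enc A} `{Enc X} (x0 : X) i (s : A -> seq X) :
  PT s -> PT (fun a => nth x0 (s a) i).
Proof.
move=> Hs; apply: (@PT_ext _ _ _ _ (fun a => head x0 (drop i (s a)))).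
  by move=> a; rewrite -nth0 nth_drop addn0.
by pt; apply: PT_drop.
Qed.

Lemma PT_mkseq A X B `{Enc A} `{Enc B} (F : X -> A -> B) (s : seq X) :
  (forall x, PT (F x)) -> PT (fun a => [seq F x a | x <- s]).
Proof. by move=> HF; elim: s => [|x s IH] /=; [apply: PT_const|apply: PT_cons]. Qed.

(** Lengths are compared in unary, by shortening one list along the other. *)
Lemma PT_size_leq A X Y `{Enc A} `{Enc X} `{Enc Y} (s : A -> seq X) (t : A -> seq Y) :
  PT s -> PT t -> PT (fun a => size (s a) <= size (t a)).
Proof.
move=> Hs Ht; apply: (@PT_ext _ _ _ _ (fun a => nilp (foldl (fun u _ => behead u) (s a) (t a)))).
  move=> a; rewrite /nilp -subn_eq0 -size_drop; congr (size _ == 0).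
  by elim: (t a) (s a) => [|y u IH] v /=; rewrite ?drop0 // IH -drop1 drop_drop addn1.
apply: PT_nilp; apply: (PT_foldl_add (h := fun _ u _ => behead u)) => //; first by pt.
exists (fun _ => 0); first exact: pbound_const.
by move=> e u x; rewrite addn0 sz_behead.
Qed.

Lemma PT_size_eq A X Y `{Enc A} `{Enc X} `{Enc Y} (s : A -> seq X) (t : A -> seq Y) :
  PT s -> PT t -> PT (fun a => size (s a) == size (t a)).
Proof.
move=> Hs Ht; apply: (@PT_ext _ _ _ _ (fun a =>
    (size (s a) <= size (t a)) && (size (t a) <= size (s a)))).
  by move=> a; rewrite eqn_leq.
by apply: PT_andb; apply: PT_size_leq.
Qed.

Lemma PT_sumn A `{Enc A} (s : A -> seq nat) : PT s -> PT (fun a => sumn (s a)).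
Proof.
move=> Hs; apply: (@PT_ext _ _ _ _ (fun a => foldr (fun x y => y + x) 0 (s a))).
  by move=> a; elim: (s a) => //= x u ->; rewrite addnC.
apply: (PT_foldr (h := fun _ x y => y + x)) => //; first by pt.
  exact: PT_const.
exists (fun n => n + 5); first by pb.
by move=> e a x; apply: leq_trans (sz_add _ _) _; lia.
Qed.

Lemma sz_rev X `{Enc X} (s : seq X) : sz (rev s) = sz s.
Proof.
elim: s => // x s IH; rewrite rev_cons -cats1; apply: succn_inj.
by rewrite sz_cat IH !sz_cons sz_nil; lia.
Qed.

Lemma PT_scan : PT scan.
Proof.
apply: (PT_foldl_add (h := fun _ => tok_step)).
- rewrite /tok_step; apply: PT_if; pt; apply: PT_sym_bits; pt.
- by pt.
- by pt.
exists (fun n => n + 6); first by pb.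
move=> e [u v] s; rewrite /tok_step; case: (sym_bits s).2; rewrite !sz_pair /= sz_cons ?sz_rev.
  by rewrite sz_nil; lia.
by rewrite sz_bool; lia.
Qed.

Lemma PT_tokens : PT tokens.
Proof. by rewrite /tokens; apply: PT_rev; apply: PT_snd; apply: PT_scan. Qed.

Lemma sz_drop X `{Enc X} i (s : seq X) : sz (drop i s) <= sz s.
Proof.
by elim: i s => [|i IH] [|x u] //=; apply: leq_trans (IH u) _; rewrite sz_cons; lia.
Qed.

Lemma sz_unary (n : nat) : sz n <= 6 * n + 1.
Proof.
by rewrite sz_nat; have : size (bin n) <= n by [apply/size_bin/ltn_expl]; lia.
Qed.

Section Decider.
Variables l m : nat.
Notation width := (m + l + 1).

Definition blocks_step (a : nat * (seq nat * seq (nat * seq nat))) (_ : bool) :=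
  (a.1 + 1, (drop width a.2.1, (a.1, a.2.1) :: a.2.2)).
(** Keeping suffixes instead of exact blocks makes each turn a [drop] by a constant; the total size
    is still polynomial. *)
Definition blocks (R : seq nat) (tk : seq bool) := rev (foldl blocks_step (0, (R, [::])) tk).2.2.

Lemma blocksE R tk : blocks R tk = [seq (k, drop (width * k) R) | k <- iota 0 (size tk)].
Proof.
suff H i acc : (foldl blocks_step (i, (drop (width * i) R, acc)) tk).2.2 =
    rev [seq (k, drop (width * k) R) | k <- iota i (size tk)] ++ acc.
  by have := H 0 [::]; rewrite muln0 drop0 /blocks => ->; rewrite cats0 revK.
elim: tk i acc => //= b tk IH i acc.
rewrite [blocks_step _ _]/= {2}/blocks_step /= drop_drop -mulnS addn1 IH rev_cons cat_rcons //.
Qed.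

Lemma PT_blocks A `{Enc A} (R : A -> seq nat) (tk : A -> seq bool) :
  PT R -> PT tk -> PT (fun a => blocks (R a) (tk a)).
Proof.
move=> HR Htk; rewrite /blocks; apply: PT_rev; apply: PT_snd; apply: PT_snd.
have [p pp Hp] := PT_size HR; have [q qq Hq] := PT_size Htk.
apply: (PT_foldl (h := fun _ => blocks_step)).
- by rewrite /blocks_step; pt; apply: PT_drop; pt.
- by pt.
- by [].
exists (fun n => 1 + q n * (6 * q n + p n + 3) + 6 * q n + p n + 3); first by pb.
move=> a n; have Hn : size (take n (tk a)) <= q (sz a).
  by rewrite size_take_min geq_min (leq_trans (sz_size (tk a))) ?orbT.
(* [PT_foldl_add] does not apply, as each turn stores the current index and suffix, which belong to
   the accumulator; here they are bounded by [K] and [Z] throughout. *)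
have Hgrow K Z u k S acc : k + size u <= K -> sz S <= Z -> sz (foldl blocks_step (k, (S, acc)) u) <=
    sz acc + size u * (6 * K + Z + 3) + 6 * K + Z + 3.
  elim: u k S acc => [|b u IH] k S acc /= HK HZ.
    by rewrite !sz_pair /=; have := sz_unary k; lia.
  rewrite {2}/blocks_step /=; apply: leq_trans (IH _ _ _ _ _) _; first by lia.
    by apply: leq_trans (sz_drop _ _) _.
  by rewrite /= sz_cons sz_pair /=; have := sz_unary k; lia.
apply: leq_trans (Hgrow (q (sz a)) (p (sz a)) _ _ _ _ _ _) _ => //.
by rewrite sz_nil !leq_add2r leq_add2l leq_mul2r Hn orbT.
Qed.

Definition block_rows (b : nat * seq nat) : state :=
  [seq ((b.1.+1, (0, j.+1)), nth 0 b.2 (m + l) * nth 0 b.2 j) | j <- iota 0 m] ++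
  [seq ((b.1.+1, (a.+1, 0)), nth 0 b.2 (m + l) * nth 0 b.2 (m + a)) | a <- iota 0 l].

Definition system (N : seq nat) (bs : seq (nat * seq nat)) : state :=
  flatten [seq block_rows b | b <- bs] ++
  [seq ((0, (c.1.+1, c.2.+1)), nth 0 N (c.1 * m + c.2)) | c <- layer_cells l m].

Definition zero_table (bs : seq (nat * seq nat)) : state :=
  flatten [seq [seq ((b.1, c), 0) | c <- layer_cells l m] | b <- bs].

Lemma PT_system A `{Enc A} (N : A -> seq nat) (bs : A -> seq (nat * seq nat)) :
  PT N -> PT bs -> PT (fun a => system (N a) (bs a)).
Proof.
move=> HN Hb; apply: PT_cat; last first.
  by apply: (PT_mkseq (F := fun c a => ((0, (c.1.+1, c.2.+1)), nth 0 (N a) (c.1 * m + c.2)))) => c;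
    pt; apply: PT_nth.
apply: PT_flatten; apply: (PT_map (f := fun _ => block_rows)) => //; apply: PT_cat.
  by apply: (PT_mkseq (F := fun j (a : A * (nat * seq nat)) =>
   ((a.2.1.+1, (0, j.+1)), nth 0 a.2.2 (m + l) * nth 0 a.2.2 j))) => j;
   pt; first [apply: PT_succ | apply: PT_nth]; pt.
by apply: (PT_mkseq (F := fun j (a : A * (nat * seq nat)) =>
   ((a.2.1.+1, (j.+1, 0)), nth 0 a.2.2 (m + l) * nth 0 a.2.2 (m + j)))) => j;
   pt; first [apply: PT_succ | apply: PT_nth]; pt.
Qed.

Lemma PT_zero_table A `{Enc A} (bs : A -> seq (nat * seq nat)) :
  PT bs -> PT (fun a => zero_table (bs a)).
Proof.
move=> Hb; apply: PT_flatten.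
apply: (PT_map (f := fun _ (b : nat * seq nat) => [seq ((b.1, c), 0) | c <- layer_cells l m])) => //.
by apply: (PT_mkseq (F := fun c (a : A * (nat * seq nat)) => ((a.2.1, c), 0))) => c; pt.
Qed.

Variable radius_bound : nat.

(** The clock [w ++ w] gives [2 * size w] scales, because the margins of a sum of layers are
    products of two numbers below [2 ^ size w]. *)
Definition decide (w : seq sym) : bool :=
  let tk := head [::] (tokens w) in let N := map nbits (behead (tokens w)) in
  let R := drop (l * m) N in let bs := blocks R tk in
  [&& well_formed l m w, ~~ nilp tk, all (fun b => 0 < nth 0 b.2 (m + l)) bs,
    sumn [seq nth 0 b.2 (m + l) | b <- bs] == last 0 N &
    viol (system N bs) (solve radius_bound (system N bs) (zero_table bs) (w ++ w)) == 0].

Lemma PT_well_formed : PT (well_formed l m).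
Proof.
have Ht := PT_tokens; have Hs := PT_scan.
(* The value [data_size] becomes the length of an explicit list, so that the number of tokens can be
   checked in unary. *)
apply: (@PT_ext _ _ _ _ (fun w => [&& nilp (scan w).1, ~~ nilp (tokens w),
   all id (head [::] (tokens w)), all (fun s => head true (rev s)) (behead (tokens w)) &
   size (behead (tokens w)) == size (nseq (l * m + 1) true ++
     flatten [seq nseq width true | _ <- head [::] (tokens w)])])).
  move=> w; rewrite /well_formed; congr [&& _, _, _, _ & _].
    apply: eq_all => s; rewrite /canonical -nth0 /=.
    by case/lastP: s => // s x; rewrite rev_rcons last_rcons.
  rewrite size_cat size_nseq size_flatten /shape -map_comp /data_size.
  congr (_ == _); rewrite -addnA; congr (_ + _); rewrite addnC; congr (_ + _).
  by elim: (head _ _) => [|b s IH] /=; rewrite ?muln0 // size_nseq mulnS -IH.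
do 3 (apply: PT_andb; first by pt).
apply: PT_andb; first by pt.
by apply: PT_size_eq; pt.
Qed.

Lemma PT_decide_table : PT decide.
Proof.
have Ht := PT_tokens; have Hwf := PT_well_formed.
have HN : PT (fun w => map nbits (behead (tokens w))).
  by pt; apply: PT_nbits; pt.
have Htk : PT (fun w => head [::] (tokens w)) by pt.
have Hb : PT (fun w => blocks (drop (l * m) (map nbits (behead (tokens w)))) (head [::] (tokens w))).
  by apply: PT_blocks => //; apply: PT_drop.
have HA := PT_system HN Hb.
apply: PT_andb; first exact: Hwf.
apply: PT_andb; first by pt.
apply: PT_andb.
  apply: (PT_all (f := fun _ (b : nat * seq nat) => 0 < nth 0 b.2 (m + l))) => //.
  by pt; apply: PT_nth; pt.
apply: PT_andb.
  apply: PT_eqn; first apply: PT_sumn.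
    apply: (PT_map (f := fun _ (b : nat * seq nat) => nth 0 b.2 (m + l))) => //.
    by apply: PT_nth; pt.
  apply: (@PT_ext _ _ _ _ (fun w => head 0 (rev (map nbits (behead (tokens w)))))).
    by move=> w; case/lastP: (map _ _) => // s x; rewrite rev_rcons last_rcons.
  by apply: PT_head; [apply: PT_const|apply: PT_rev].
apply: PT_eqn0; apply: PT_viol => //; apply: PT_solve => //; first exact: PT_zero_table.
by apply: PT_cat; apply: PT_id.
Qed.

End Decider.

(** * Correctness of the decision procedure *)

Lemma iter_half_graph d F i :
  iter i (map_val half) (graph_of d F) = graph_of d (fun r => iter i half (F r)).
Proof.
elim: i => //= i ->; rewrite /map_val /graph_of -map_comp; exact: eq_map.
Qed.

Section Correct.
Variables l m : nat.
Notation width := (m + l + 1).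

Definition rhs (N : seq nat) (S : nat -> seq nat) (r : key) : nat :=
  match r with
  | (0, (a.+1, j.+1)) => nth 0 N (a * m + j)
  | (k.+1, (0, j.+1)) => nth 0 (S k) (m + l) * nth 0 (S k) j
  | (k.+1, (a.+1, 0)) => nth 0 (S k) (m + l) * nth 0 (S k) (m + a)
  | _ => 0
  end.

Lemma system_graph N S t :
  system l m N [seq (k, S k) | k <- iota 0 t] = graph_of (rows l m (iota 0 t)) (rhs N S).
Proof.
rewrite /system /graph_of /rows map_cat map_flatten -!map_comp; congr (flatten _ ++ _).
by apply: eq_map => k /=; rewrite /block_rows /layer_rows map_cat -!map_comp.
Qed.

Lemma zero_table_graph S t :
  zero_table l m [seq (k, S k) | k <- iota 0 t] = graph_of (cells l m (iota 0 t)) (fun _ => 0).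
Proof.
rewrite /zero_table /graph_of /cells map_flatten -!map_comp; congr flatten.
by apply: eq_map => k /=; rewrite -!map_comp.
Qed.

Lemma decideP : exists C, forall w,
  decide l m C w <-> well_formed l m w /\ yes_instance (parse l m w).
Proof.
have [C HC] := radius_exists l m; exists C => w; rewrite /decide.
case Hw: (well_formed l m w); last by split => // -[].
have [_ Es] := well_formedP Hw.
set tk := head [::] (tokens w) in Es *; set N := map nbits _.
have SN : size N = data_size l m (size tk) by case/and5P: Hw => _ _ _ _ /eqP; rewrite size_map.
pose S k := drop (width * k) (drop (l * m) N).
rewrite blocksE -/S.
have Nlt i : nth 0 N i < 2 ^ size w.
  case: (ltnP i (size N)) => iN; last by rewrite nth_default // expn_gt0.
  rewrite size_map in iN; rewrite (nth_map [::]) //; apply: leq_trans (nbits_ltn _) _.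
  by rewrite leq_exp2l // size_tokens // mem_behead // mem_nth.
have Slt k i : nth 0 (S k) i < 2 ^ size w by rewrite !nth_drop.
have Et : in_types (parse l m w) = [seq type_of l m (S k) | k <- iota 0 (size tk)] by [].
have -> : (fun k => (k, drop (width * k) (drop (l * m) N))) = (fun k => (k, S k)) by [].
rewrite system_graph zero_table_graph.
have Hopt : opt (graph_of (rows l m (iota 0 (size tk))) (rhs N S)) (cells l m (iota 0 (size tk)))
    (solve C (graph_of (rows l m (iota 0 (size tk))) (rhs N S))
       (graph_of (cells l m (iota 0 (size tk))) (fun _ => 0)) (w ++ w)).
  (* Halving leaves the row keys unchanged, so the radius [C] is valid at every scale. *)
  apply: solve_opt; first by move=> i; rewrite iter_half_graph.
  - exact: unzip1_graph.
  - by move=> cv /mapP [c _ ->].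
  move=> rb /mapP [r _ ->] /=; rewrite size_cat expnD.
  have P : 0 < 2 ^ size w by rewrite expn_gt0.
  have lt1 u : u < 2 ^ size w -> u < 2 ^ size w * 2 ^ size w.
    by move=> H; apply: leq_trans H _; rewrite leq_pmulr.
  by case: r => -[|k] [[|a] [|j]] /=; rewrite ?muln_gt0 ?P ?(lt1 _ (Nlt _)) ?ltn_mul.
have Hviol F : viol (graph_of (rows l m (iota 0 (size tk))) (rhs N S))
    (graph_of (cells l m (iota 0 (size tk))) F) =
    violation (@line l m) (fun k : 'I_(size tk) => rhs_local (in_types (parse l m w)) k)
      (fun i => in_g (parse l m w) i.1 i.2) (fun k i => F (tcell k i)).
  rewrite viol_graph; congr violation.
  apply: functional_extensionality => k; apply: functional_extensionality => p.
  rewrite /rhs_local Et (nth_map 0) ?size_iota // nth_iota // add0n.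
  by case: p.
(* If some table has violation 0, so has the optimal one that [solve] returns. *)
have key : viol (graph_of (rows l m (iota 0 (size tk))) (rhs N S))
    (solve C (graph_of (rows l m (iota 0 (size tk))) (rhs N S))
       (graph_of (cells l m (iota 0 (size tk))) (fun _ => 0)) (w ++ w)) = 0 <->
  exists x : 'I_(size tk) -> 'I_l * 'I_m -> nat,
    violation (@line l m) (fun k : 'I_(size tk) => rhs_local (in_types (parse l m w)) k)
      (fun i => in_g (parse l m w) i.1 i.2) x = 0.
  case: Hopt => Eu Hmin; split.
    have [F ->] := graph_ofP (uniq_cells l m (size tk)) Eu.
    by rewrite Hviol => E; eexists; exact: E.
  move=> [x Ex]; apply/eqP; rewrite -leqn0.
  apply: leq_trans (Hmin _ (unzip1_graph _ (untable x))) _; rewrite Hviol.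
  have -> : (fun (k : 'I_(size tk)) i => untable x (tcell k i)) = x; last by rewrite Ex.
  by apply: functional_extensionality => k; apply: functional_extensionality => i; rewrite untableK.
have En : in_n (parse l m w) = last 0 N.
  by rewrite -nth_last SN /data_size addnA addn1 /= !nth_drop addn0.
rewrite yes_instanceP Es -En; split.
  move=> /and5P [_ t0 Hpos /eqP Hsum /eqP /key Hx]; split => //; split => //.
  - by rewrite lt0n.
  - by rewrite Et all_map; rewrite all_map in Hpos.
  - by rewrite -Hsum Et sumnE !big_map.
move=> [_ [t0 Hpos Hsum /key ->]]; rewrite -Hsum Et sumnE !big_map !eqxx.
rewrite Et all_map in Hpos; rewrite all_map /nilp -lt0n t0 !andbT; exact: Hpos.
Qed.

Lemma table_decidable : exists2 d : seq sym -> bool, PT d & forall w, d w <-> HugeTable l m w.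
Proof.
have [C HC] := decideP; exists (decide l m C); first exact: PT_decide_table.
by move=> w; rewrite HC HugeTable_parse.
Qed.

Lemma table_t_decidable t :
  exists2 d : seq sym -> bool, PT d & forall w, d w <-> HugeTable_t l m t w.
Proof.
have [d Hd HdP] := table_decidable.
(* The number of types is the length of the first token. *)
exists (fun w => d w && (size (head [::] (tokens w)) == size (nseq t true))).
  have Ht := PT_tokens; apply: PT_andb => //.
  by apply: PT_size_eq; pt.
move=> w; rewrite HugeTable_t_parse size_nseq; split.
  by move=> /andP [/HdP /HugeTable_parse [Hw Y] /eqP].
by move=> [Hw Y ->]; rewrite eqxx andbT; apply/HdP/HugeTable_parse.
Qed.

End Correct.

Unset Implicit Arguments.

Theorem theorem1p1 (l m : nat) (hl : 0 < l) (hm : 0 < m) :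
  (forall t : nat, InP (HugeTable_t l m t)) /\
  (InNP (HugeTable l m) /\ InCoNP (HugeTable l m)).
Proof.
split.
  by move=> t; have [d Hd HdP] := table_t_decidable l m t; apply: PT_InP Hd HdP.
have [d Hd HdP] := table_decidable l m; split; first exact: PT_InNP Hd HdP.
apply: (PT_InNP (d := fun w => ~~ d w)); first by apply: PT_negb.
by move=> w; rewrite -HdP; split; [move/negP|move=> H; apply/negP].
Qed.
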